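(* Let $n\ge0$ and let $D\subset F_n$ be a $\sigma$-invariant normal subgroup that is contained in the Frattini subgroup $\mathrm{Fr}(F_n)$ and invariant under $\mathrm{Aut}_\sigma(F_n)$. Let $G$ be a weak Schur $\sigma$-group with $d_G=n$. If $D$ is open in $F_n$, then $$\mu_\infty(U_{D,G})\ =\ \frac{C_\infty}{C_{n-m_{D,G}}}\cdot\frac{1}{|\mathrm{Aut}_\sigma(G_D)|}.$$
   Context: Fix a prime $p>2$ and a group $\{1,\sigma\}$ of order $2$. All homomorphisms of pro-$p$-groups are continuous, all subgroups are closed, and ''generated'' means topologically generated. A $\sigma$-pro-$p$-group is a pro-$p$-group $G$ with a continuous action of $\{1,\sigma\}$, written $a\mapsto{}^\sigma a$; $\sigma$-homomorphisms and $\sigma$-isomorphisms are the $\sigma$-equivariant ones, and $\mathrm{Aut}_\sigma(G)$ is the group of $\sigma$-equivariant automorphisms. Put $G^-:=\{a\in G\mid {}^\sigma a=a^{-1}\}$. Let $d_G:=\dim_{\mathbb F_p}H^1(G,\mathbb F_p)$ be the minimal number of generators of $G$. Let $D_i(G)$ ($i\ge1$) be the Zassenhaus filtration (dimension subgroups mod $p$): $D_1(G)=G$, and $D_i(G)$ is generated by the $p$-th powers of elements of $D_{\lceil i/p\rceil}(G)$ and all $[D_j(G),D_k(G)]$ with $j+k=i$. $F_n$ is the free pro-$p$-group on $x_1,\dots,x_n$, made a $\sigma$-pro-$p$-group by ${}^\sigma x_i=x_i^{-1}$. For $r=(r_1,\dots,r_n)\in(F_n^-)^n$ let $N_r$ be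 the normal subgroup of $F_n$ generated by all conjugates of $r_1,\dots,r_n$, and $G_r:=F_n/N_r$. A weak Schur $\sigma$-group is a $\sigma$-pro-$p$-group $\sigma$-isomorphic to some $G_r$ with $n\ge0$, $r\in(F_n^-)^n$. $\mathrm{Sch}$ is the set of $\sigma$-isomorphism classes $[G]$ of weak Schur $\sigma$-groups, with the topology having as basis the sets $U_{i,G}:=\{[H]\in\mathrm{Sch}\mid H/D_i(H)\cong G/D_i(G)\ \sigma\text{-isomorphic}\}$ for all $i\ge2$ and all weak Schur $\sigma$-groups $G$. The Haar measure on $F_n^-$ is the unique Borel probability measure such that for every $\sigma$-invariant open normal subgroup $N\triangleleft F_n$ every fiber of the (surjective) map $F_n^-\to(F_n/N)^-$ has measure $1/|(F_n/N)^-|$. Let $\tilde\mu_n$ be the product measure on $(F_n^-)^n$, and $\mu_n$ its pushforward under the continuous map $(F_n^-)^n\to\mathrm{Sch}$, $r\mapsto[G_r]$. The probability measure $\mu_\infty$ on $\mathrm{Sch}$ is the limit $\mu_\infty(A)=\lim_{n\to\infty}\mu_n(A)$ for all Borel $A\subset\mathrm{Sch}$ (which exists). For $0\le k\le\infty$ put $C_k:=\prod_{i=1}^k(1-p^{-i})$. For $n$, $D$ as in the claim and a weak Schur $\sigma$-group $G$ with $d_G=n$, there is a surjective $\sigma$-homomorphism $\pi\colon F_n\twoheadrightarrow G$, unique up to composition with an element of $\mathrm{Aut}_\sigma(F_n)$. Put $G_D:=G/\pi(D)$ and $N:=\ker\pi$; these are independent of $\pi$ in the sense that $\pi(D)$ does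 not depend on $\pi$ and $N$ is unique up to $\mathrm{Aut}_\sigma(F_n)$. Let $m_{D,G}$ be the minimal number of generators of $ND/D$ as a normal subgroup of $F_n/D$; it depends only on $D$ and $G$ and satisfies $m_{D,G}\le n$. Define $U_{D,G}:=\{[H]\in\mathrm{Sch}\mid d_H=n \text{ and } H_D\cong G_D\ \sigma\text{-isomorphic}\}$. *)

(* Defs.v *)
From HB Require Import structures.
From mathcomp Require Import all_boot all_order all_algebra finmap.
From mathcomp Require Import all_classical all_reals all_analysis.
From mathcomp Require Import zify.

Set Implicit Arguments.
Unset Strict Implicit.
Unset Printing Implicit Defensive.
Import Order.TTheory GRing.Theory Num.Theory.
Import numFieldNormedType.Exports.

Local Open Scope classical_set_scope.
Local Open Scope group_scope.

HB.mixin Record isTopologicalGroup G of Group G & Topological G := {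
  mulg_continuous : continuous (fun z : G * G => z.1 * z.2);
  invg_continuous : continuous (fun x : G => x^-1)
}.

#[short(type="topGroupType")]
HB.structure Definition TopologicalGroup :=
  {G of Group G & Topological G & isTopologicalGroup G}.

HB.mixin Record hasSigma G of TopologicalGroup G := {
  sigma : G -> G;
  sigmaM : {morph sigma : x y / x * y};
  sigmaK : involutive sigma;
  sigma_continuous : continuous sigma
}.

#[short(type="sigmaGroupType")]
HB.structure Definition SigmaGroup := {G of TopologicalGroup G & hasSigma G}.

Section Subgroups.
Variable G : groupType.
Implicit Types (H N S : set G).

Definition is_subgroup H := H 1 /\ forall x y, H x -> H y -> H (x * y^-1).

Definition is_normal N := is_subgroup N /\ forall x g, N x -> N (x ^ g).

Definition conjugates S : set G := [set y | exists x g, S x /\ y = x ^ g].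

Definition lcosets N : set (set G) := range (fun g => [set g * x | x in N]).

End Subgroups.

(* Closed subgroups only: [gen S] is the topologically generated subgroup. *)
Definition gen (G : topGroupType) (S : set G) : set G :=
  \bigcap_(H in [set H | is_subgroup H /\ closed H /\ S `<=` H]) H.

(* Closed normal subgroup generated by [S]. *)
Definition ngen (G : topGroupType) (S : set G) : set G := gen (conjugates S).

Definition is_pro_p (p : nat) (G : topGroupType) : Prop :=
  [/\ compact [set: G], hausdorff_space G,
      forall U : set G, nbhs 1 U ->
        exists N, [/\ is_normal N, open N & N `<=` U] &
      forall N : set G, is_normal N -> open N ->
        exists k, (lcosets N #= `I_(p ^ k)%N)%card].

Definition is_hom (G H : topGroupType) (f : G -> H) :=
  continuous f /\ {morph f : x y / x * y}.

Definition is_sigma_hom (G H : sigmaGroupType) (f : G -> H) :=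
  is_hom f /\ {morph f : x / sigma x}.

Definition is_sigma_iso (G H : sigmaGroupType) (f : G -> H) :=
  is_sigma_hom f /\
  exists g : H -> G, [/\ is_sigma_hom g, cancel f g & cancel g f].

Definition sigma_isomorphic (G H : sigmaGroupType) :=
  exists f : G -> H, is_sigma_iso f.

Record sigmaNormal (G : sigmaGroupType) := SigmaNormal {
  nset :> set G;
  nset_normal : is_normal nset;
  nset_sigma : forall x, nset x -> nset (sigma x)
}.

Section SubgroupTheory.
Variables (G : groupType) (H : set G).
Hypothesis sgH : is_subgroup H.

Lemma sg1 : H 1. Proof. by case: sgH. Qed.
Lemma sgV x : H x -> H x^-1.
Proof. by move=> Hx; rewrite -[_^-1]mul1g; apply: sgH.2 => //; exact: sg1. Qed.
Lemma sgM x y : H x -> H y -> H (x * y).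
Proof. by move=> Hx Hy; rewrite -[y]invgK; apply: sgH.2 => //; exact: sgV. Qed.
End SubgroupTheory.

Section Homs.
Variables (G H : groupType) (f : G -> H).
Hypothesis fM : {morph f : x y / x * y}.

Lemma hom1 : f 1 = 1.
Proof. by apply: (mulgI (f 1)); rewrite -fM !mulg1. Qed.
Lemma homV x : f x^-1 = (f x)^-1.
Proof. by apply: (mulgI (f x)); rewrite -fM !mulgV hom1. Qed.
Lemma homJ x y : f (x ^ y) = f x ^ f y.
Proof. by rewrite !conjgE !fM homV. Qed.
Lemma homR x y : f [~ x, y] = [~ f x, f y].
Proof. by rewrite !commgEl fM homV homJ. Qed.
Lemma homX x n : f (x ^+ n) = f x ^+ n.
Proof. by elim: n => [|n IH]; rewrite ?expg0 ?hom1// !expgS fM IH. Qed.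
End Homs.

Section QuotientRel.
Variables (G : sigmaGroupType) (N : sigmaNormal G).

Definition quot_rel (x y : G) := `[< nset N (x^-1 * y) >].

Let sgN := (nset_normal N).1.

Lemma quot_rel_refl : reflexive quot_rel.
Proof. by move=> x; apply/asboolP; rewrite mulVg; exact: sg1. Qed.

Lemma quot_rel_sym : symmetric quot_rel.
Proof.
move=> x y; apply/asboolP/asboolP => /(sgV sgN); by rewrite invgM invgK.
Qed.

Lemma quot_rel_trans : transitive quot_rel.
Proof.
move=> y x z /asboolP xy /asboolP yz; apply/asboolP.
by have := sgM sgN xy yz; rewrite -mulgA mulVKg.
Qed.

Canonical quot_equiv := EquivRel quot_rel quot_rel_refl quot_rel_sym quot_rel_trans.

End QuotientRel.

Definition quot (G : sigmaGroupType) (N : sigmaNormal G) : Type :=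
  quotient_topology {eq_quot (quot_equiv N)}%qT.

Lemma mulgr_continuous (G : topGroupType) (m : G) :
  continuous (fun x : G => x * m).
Proof.
move=> x; apply: (@cvg_comp _ _ _ (fun y => (y, m)) (fun z => z.1 * z.2)).
  exact: (cvg_pair (@cvg_id _ _) (cvg_cst _)).
exact: (@mulg_continuous G (x, m)).
Qed.

Lemma nbhs_open_ex (T : topologicalType) (x : T) (A : set T) :
  nbhs x A -> exists2 U, open_nbhs x U & U `<=` A.
Proof. by rewrite nbhsE. Qed.

Section QuotientGroup.
Variables (G : sigmaGroupType) (N : sigmaNormal G).
Local Notation Q := (quot N).


HB.instance Definition _ := Topological.on Q.

Definition coset (x : G) : Q := (\pi_Q x)%qT.
Definition coset_repr (a : Q) : G := repr a.

Lemma coset_reprK : cancel coset_repr coset.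
Proof. exact: reprK. Qed.

Lemma cosetP x y : reflect (coset x = coset y) (`[< nset N (x^-1 * y) >]).
Proof. exact: (@eqmodP _ (quot_equiv N)). Qed.

Lemma coset_eq x y : coset x = coset y <-> nset N (x^-1 * y).
Proof. by split=> [/cosetP/asboolP|/asboolP/cosetP]. Qed.

Let sgN := (nset_normal N).1.
Let nN := (nset_normal N).2.

Definition qmul (a b : Q) : Q := coset (coset_repr a * coset_repr b).
Definition qinv (a : Q) : Q := coset (coset_repr a)^-1.
Definition qsigma (a : Q) : Q := coset (sigma (coset_repr a)).

Lemma repr_coset x : nset N ((coset_repr (coset x))^-1 * x).
Proof. by apply/coset_eq; rewrite coset_reprK. Qed.

Lemma qmulE x y : qmul (coset x) (coset y) = coset (x * y).
Proof.
apply/coset_eq; set a := coset_repr _; set b := coset_repr _.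
have -> : (a * b)^-1 * (x * y) = ((a^-1 * x) ^ b) * (b^-1 * y).
  by rewrite conjgE invgM -!mulgA mulVKg.
by apply: sgM => //; [apply: nN|]; exact: repr_coset.
Qed.

Lemma qinvE x : qinv (coset x) = coset x^-1.
Proof.
apply/coset_eq; set a := coset_repr _.
have -> : (a^-1)^-1 * x^-1 = ((a^-1 * x)^-1) ^ a^-1.
  by rewrite conjgE !invgM !invgK -!mulgA mulgV mulg1.
by apply: nN; apply: sgV => //; exact: repr_coset.
Qed.

Lemma qsigmaE x : qsigma (coset x) = coset (sigma x).
Proof.
apply/coset_eq; set a := coset_repr _.
rewrite -(homV (@sigmaM G)) -sigmaM; apply: nset_sigma; exact: repr_coset.
Qed.

Lemma quotP (P : Q -> Prop) : (forall x, P (coset x)) -> forall a, P a.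
Proof. by move=> H a; rewrite -(coset_reprK a). Qed.

Lemma qmulA : associative qmul.
Proof.
by elim/quotP=> x; elim/quotP=> y; elim/quotP=> z; rewrite !qmulE mulgA.
Qed.
Lemma qmul1 : left_id (coset 1) qmul.
Proof. by elim/quotP=> x; rewrite qmulE mul1g. Qed.
Lemma qmulr1 : right_id (coset 1) qmul.
Proof. by elim/quotP=> x; rewrite qmulE mulg1. Qed.
Lemma qmulV : left_inverse (coset 1) qinv qmul.
Proof. by elim/quotP=> x; rewrite qinvE qmulE mulVg. Qed.
Lemma qmulrV : right_inverse (coset 1) qinv qmul.
Proof. by elim/quotP=> x; rewrite qinvE qmulE mulgV. Qed.

HB.instance Definition _ :=
  isGroup.Build Q qmulA qmul1 qmulr1 qmulV qmulrV.

Lemma cosetM : {morph coset : x y / x * y}.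
Proof. by move=> x y; rewrite -qmulE. Qed.

Lemma cosetV x : coset x^-1 = (coset x)^-1.
Proof. by rewrite -qinvE. Qed.

Lemma coset_continuous : continuous coset.
Proof. exact: pi_continuous. Qed.

Lemma open_quotE (U : set Q) : open U = open (coset @^-1` U).
Proof. by []. Qed.

Lemma coset_open (U : set G) : open U -> open (coset @` U).
Proof.
move=> oU; rewrite open_quotE.
have -> : coset @^-1` (coset @` U) = \bigcup_(m in nset N) (fun x => x * m) @^-1` U.
  apply/seteqP; split=> x /=.
    move=> [u Uu /esym/coset_eq Nux]; exists (x^-1 * u) => //=.
    by rewrite mulVKg.
  move=> [m Nm /= Uxm]; exists (x * m) => //; apply/esym/coset_eq.
  by rewrite mulKg.
apply: bigcup_open => m _; move/continuousP: (@mulgr_continuous G m); exact.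
Qed.

Lemma qmul_continuous : continuous (fun z : Q * Q => z.1 * z.2).
Proof.
move=> [a b]; elim/quotP: a => x; elim/quotP: b => y.
move=> U0 nU0.
have [U [oU]] := nbhs_open_ex nU0.
rewrite -[_ * _]cosetM => Uxy sU.
have : nbhs (x * y) (coset @^-1` U) by apply: open_nbhs_nbhs; split.
move=> /(@mulg_continuous G (x, y)) [[A B] /= [nA nB] AB].
have [A' [oA' A'x] sA] := nbhs_open_ex nA.
have [B' [oB' B'y] sB] := nbhs_open_ex nB.
suff H : nbhs ((coset x, coset y) : Q * Q)
    ((fun z : Q * Q => z.1 * z.2) @^-1` U0). by exact: H.
apply: (filterS (P := (coset @` A') `*` (coset @` B'))).
  move=> [_ _] /= [[u A'u <-] [v B'v <-]]; rewrite -cosetM.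
  by apply/sU/(AB (u, v)); split; [exact: sA|exact: sB].
exists (coset @` A', coset @` B') => //=.
split; apply: open_nbhs_nbhs; (split; first exact: coset_open).
  by exists x.
by exists y.
Qed.

Lemma qinv_continuous : continuous (fun a : Q => a^-1).
Proof.
apply/continuousP => U oU; rewrite open_quotE.
have -> : coset @^-1` ((fun a : Q => a^-1) @^-1` U)
    = (fun x : G => x^-1) @^-1` (coset @^-1` U).
  by apply/seteqP; split=> x /=; rewrite cosetV.
by move/continuousP: (@invg_continuous G); apply.
Qed.

HB.instance Definition _ :=
  isTopologicalGroup.Build Q qmul_continuous qinv_continuous.

Lemma qsigmaM : {morph qsigma : a b / a * b}.
Proof.
elim/quotP=> x; elim/quotP=> y.
by rewrite -cosetM !qsigmaE -cosetM sigmaM.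
Qed.

Lemma qsigmaK : involutive qsigma.
Proof. by elim/quotP=> x; rewrite !qsigmaE sigmaK. Qed.

Lemma qsigma_continuous : continuous qsigma.
Proof.
apply/continuousP => U oU; rewrite open_quotE.
have -> : coset @^-1` (qsigma @^-1` U) = (@sigma G) @^-1` (coset @^-1` U).
  by apply/seteqP; split=> x /=; rewrite qsigmaE.
by move/continuousP: (@sigma_continuous G); apply.
Qed.

HB.instance Definition _ :=
  hasSigma.Build Q qsigmaM qsigmaK qsigma_continuous.

Lemma coset_sigma : {morph coset : x / sigma x}.
Proof. by move=> x; rewrite -qsigmaE. Qed.

End QuotientGroup.

Lemma mulgl_continuous (G : topGroupType) (m : G) :
  continuous (fun x : G => m * x).
Proof.
move=> x; apply: (@cvg_comp _ _ _ (fun y => (m, y)) (fun z => z.1 * z.2)).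
  exact: (cvg_pair (cvg_cst _) (@cvg_id _ _)).
exact: (@mulg_continuous G (m, x)).
Qed.

Section QuotientProP.
Variables (p : nat) (G : sigmaGroupType) (N : sigmaNormal G).
Hypotheses (pG : is_pro_p p G) (clN : closed (nset N)).

Lemma normal_preim (M : set (quot N)) :
  is_normal M -> is_normal ((@coset G N) @^-1` M).
Proof.
case=> -[M1 Mm] Mj; split; first split => //=.
  by move=> x y Mx My; rewrite cosetM cosetV; exact: Mm.
by move=> x g /= Mx; rewrite (homJ (@cosetM _ N)); exact: Mj.
Qed.

Lemma normal_image (M : set G) :
  is_normal M -> is_normal ((@coset G N) @` M).
Proof.
case=> sM Mj; split; first split.
- by exists 1 => //; exact: sg1.
- move=> _ _ [x Mx <-] [y My <-]; exists (x * y^-1); first exact: sM.2.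
  by rewrite cosetM cosetV.
- move=> _ g [x Mx <-]; elim/quotP: g => g; exists (x ^ g); first exact: Mj.
  by rewrite (homJ (@cosetM _ N)).
Qed.

Lemma quot_pro_p : is_pro_p p (quot N).
Proof.
have [cG hG bG iG] := pG; split.
- have -> : [set: quot N] = (@coset G N) @` setT.
    by apply/seteqP; split=> // a _; elim/quotP: a => x; exists x.
  apply: continuous_compact => //; apply: continuous_subspaceT.
  exact: coset_continuous.
- rewrite open_hausdorff => a b; elim/quotP: a => x; elim/quotP: b => y.
  move=> /eqP xy; have nN : ~ nset N (x^-1 * y) by move/coset_eq.
  have [M [nM oM sM]] : exists M, [/\ is_normal M, open M &
      M `<=` (fun z => (x^-1 * y) * z) @^-1` (~` nset N)].
    apply: bG; apply: open_nbhs_nbhs; split; last by rewrite /= mulg1.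
    by move/continuousP: (@mulgl_continuous G (x^-1 * y)); apply; exact: closed_openC.
  have op z : open ((fun t => z^-1 * t) @^-1` M).
    by move/continuousP: (@mulgl_continuous G z^-1); apply.
  exists ((@coset G N) @` ((fun t => x^-1 * t) @^-1` M),
          (@coset G N) @` ((fun t => y^-1 * t) @^-1` M)) => /=.
    split; rewrite inE /=; [exists x|exists y] => //=; rewrite mulVg;
      by case: nM => sM1 _; exact: sg1.
  split; try exact: coset_open.
  apply/eqP/seteqP; split=> // c [[u /= Mu <-] [v /= Mv]].
  move=> /esym/coset_eq Nuv.
  apply: (sM (((x^-1 * u)^-1 ^ (x^-1 * y)) * (y^-1 * v))) => /=.
    apply: sgM; [exact: nM.1| apply: nM.2; apply: sgV => //; exact: nM.1|by []].
  by rewrite mulgA -conjgC invgM invgK -!mulgA !mulVKg.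
- move=> U nU.
  have [M [nM oM sM]] := bG _ (@coset_continuous G N 1 U nU).
  exists ((@coset G N) @` M); split; [exact: normal_image|exact: coset_open|].
  by move=> _ [x Mx <-]; exact: sM.
- move=> M nM oM.
  have [k hk] := iG _ (normal_preim nM) oM; exists k.
  apply: card_eq_trans hk.
  have -> : lcosets M = image ^~ (@coset G N) @` lcosets ((@coset G N) @^-1` M).
    apply/seteqP; split=> [_ [a _ <-]|_ [_ [x _ <-] <-]].
      elim/quotP: a => x; exists [set x * y | y in (@coset G N) @^-1` M].
        by exists x.
      apply/seteqP; split=> [_ [_ [y My <-] <-]|_ [b Mb <-]].
        by exists (coset N y) => //; rewrite cosetM.
      elim/quotP: b Mb => y My; exists (x * y); first by exists y.
      by rewrite cosetM.
    exists (coset N x) => //; apply/seteqP; split=> [_ [b Mb <-]|].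
      elim/quotP: b Mb => y My; exists (x * y); first by exists y.
      by rewrite cosetM.
    by move=> _ [_ [y My <-] <-]; exists (coset N y) => //; rewrite cosetM.
  apply: inj_card_eq => _ _ /set_mem [x _ <-] /set_mem [y _ <-] e.
  have fK (z : G) : (@coset G N) @^-1` ((@coset G N) @`
      [set z * t | t in (@coset G N) @^-1` M]) =
      [set z * t | t in (@coset G N) @^-1` M].
    apply/seteqP; split=> [t /= [_ [u Mu <-]]|t [u Mu <-]].
      rewrite cosetM => e'; exists (z^-1 * t); last by rewrite mulVKg.
      by rewrite /= cosetM cosetV -e' mulKg.
    by exists (z * u) => //; exists u.
  by rewrite -(fK x) -(fK y); congr (_ @^-1` _).
Qed.

End QuotientProP.

Section GenTheory.
Variable G : topGroupType.
Implicit Type S : set G.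

Lemma gen_subgroup S : is_subgroup (gen S).
Proof.
split=> [H [sH _]|x y Sx Sy H HS]; first exact: sg1.
by apply: (HS.1).2; [exact: Sx|exact: Sy].
Qed.

Lemma gen_closed S : closed (gen S).
Proof. by apply: closed_bigI => H [_ []]. Qed.

Lemma sub_gen S : S `<=` gen S.
Proof. by move=> x Sx H [_ [_ sSH]]; exact: sSH. Qed.

End GenTheory.

Lemma gen_hom (G H : topGroupType) (f : G -> H) (S : set G) (T : set H) :
  is_hom f -> (forall x, S x -> gen T (f x)) ->
  forall x, gen S x -> gen T (f x).
Proof.
move=> [cf fM] sST x Sx.
apply: (Sx (f @^-1` gen T)); split; last split; last by [].
  split=> /= [|y z Ty Tz]; first by rewrite (hom1 fM); exact: (gen_subgroup T).1.
  by rewrite fM (homV fM); apply: (gen_subgroup T).2.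
by move/continuous_closedP: cf; apply; exact: gen_closed.
Qed.

Section NgenTheory.
Variable G : topGroupType.
Implicit Type S : set G.

Lemma conj_hom (g : G) : is_hom (fun x => x ^ g).
Proof.
split=> [|x y]; last by rewrite conjMg.
have -> : (fun x => x ^ g) = (fun x => g^-1 * x) \o (fun x => x * g) by [].
move=> x; apply: continuous_comp; first exact: mulgr_continuous.
exact: mulgl_continuous.
Qed.

Lemma ngen_normal S : is_normal (ngen S).
Proof.
split=> [|x g]; first exact: gen_subgroup.
move: x; apply: (gen_hom (conj_hom g)) => _ [x [h [Sx ->]]].
by apply: sub_gen; exists x, (h * g); rewrite conjgM.
Qed.

End NgenTheory.

Lemma sigma_is_hom (G : sigmaGroupType) : is_hom (@sigma G).
Proof. by split; [exact: sigma_continuous|exact: sigmaM]. Qed.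

Section Zassenhaus.
Variables (p : nat) (G : topGroupType).

(* Strong recursion on [i] through a fuel argument, any fuel at least [i] being
   enough; see [zassenhausE] for the recursion equation.  [(i + p).-1 %/ p] is
   the ceiling of [i / p]. *)
Fixpoint zassenhaus_rec (fuel i : nat) : set G :=
  if fuel is f.+1 then
    if (i <= 1)%N then setT else
    gen ([set x ^+ p | x in zassenhaus_rec f ((i + p).-1 %/ p)%N] `|`
         [set y | exists j k a b, [/\ (0 < j)%N, (0 < k)%N, (j + k)%N = i &
            [/\ zassenhaus_rec f j a, zassenhaus_rec f k b & y = [~ a, b]]]])
  else setT.

Definition zassenhaus (i : nat) : set G := zassenhaus_rec i i.

End Zassenhaus.

Arguments zassenhaus_rec p G fuel i : clear implicits.
Arguments zassenhaus p G i : clear implicits.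

Lemma ceil_lt p i : (1 < p)%N -> (1 < i)%N -> ((i + p).-1 %/ p < i)%N.
Proof.
move=> p1 i1; rewrite ltn_divLR ?(ltnW p1)//.
rewrite -(subnK i1) -(subnK p1); nia.
Qed.

Lemma zassenhaus_rec_stable p (G : topGroupType) f i : (1 < p)%N -> (i <= f)%N ->
  zassenhaus_rec p G f i = zassenhaus p G i.
Proof.
move=> p1; elim/ltn_ind: i f => i IH f.
case: f => [|f]; first by rewrite leqn0 => /eqP ->.
case: i IH => [//|i] IH if1; rewrite /zassenhaus /=.
case: ifPn => //; rewrite -ltnNge => i1; have lt := ceil_lt p1 i1.
congr (gen (_ `|` _)).
  by move: lt; set c := (_ %/ _)%N => lt; rewrite !IH//; lia.
by apply/seteqP; split=> y [j [k [a [b [j0 k0 jk [ja kb ->]]]]]];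
  exists j, k, a, b; split=> //; split=> //; move: ja kb; rewrite !IH//; lia.
Qed.

Lemma zassenhausE p (G : topGroupType) i : (1 < p)%N -> (1 < i)%N ->
  zassenhaus p G i =
    gen ([set x ^+ p | x in zassenhaus p G ((i + p).-1 %/ p)%N] `|`
         [set y | exists j k a b, [/\ (0 < j)%N, (0 < k)%N, (j + k)%N = i &
            [/\ zassenhaus p G j a, zassenhaus p G k b & y = [~ a, b]]]]).
Proof.
move=> p1 i1; have lt := ceil_lt p1 i1; rewrite {1}/zassenhaus.
case: i i1 lt => [//|i] i1 lt /=; rewrite leqNgt i1 /=.
congr (gen (_ `|` _)).
  by move: lt; set c := (_ %/ _)%N => lt; rewrite zassenhaus_rec_stable//; lia.
apply/seteqP; split=> y [j [k [a [b [j0 k0 jk [ja kb ->]]]]]];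
  exists j, k, a, b; split=> //; split=> //; move: ja kb;
  rewrite !zassenhaus_rec_stable//; lia.
Qed.

Lemma zassenhaus_rec_hom p (G H : topGroupType) (f : G -> H) k i :
  is_hom f -> forall x, zassenhaus_rec p G k i x -> zassenhaus_rec p H k i (f x).
Proof.
move=> hf; elim: k i => [//|k IH] i /=; case: ifP => // _.
apply: gen_hom => // _ [[x Dx <-]|[j [l [a [b [j0 l0 jl [ja lb ->]]]]]]].
  by apply: sub_gen; left; exists (f x); [exact: IH|rewrite (homX hf.2)].
apply: sub_gen; right; exists j, l, (f a), (f b); split=> //.
by split; [exact: IH|exact: IH|rewrite (homR hf.2)].
Qed.

Lemma zassenhaus_subgroup p (G : topGroupType) i : is_subgroup (zassenhaus p G i).
Proof.
rewrite /zassenhaus; case: {1}i => [//|k] /=; case: ifP => // _.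
exact: gen_subgroup.
Qed.

Lemma zassenhaus_normal p (G : topGroupType) i : is_normal (zassenhaus p G i).
Proof.
split=> [|x g]; first exact: zassenhaus_subgroup.
exact: (zassenhaus_rec_hom (conj_hom g)).
Qed.

Lemma zassenhaus_sigma p (G : sigmaGroupType) i x :
  zassenhaus p G i x -> zassenhaus p G i (sigma x).
Proof. exact: (zassenhaus_rec_hom (@sigma_is_hom G)). Qed.

Definition zassenhausN (p : nat) (G : sigmaGroupType) (i : nat) : sigmaNormal G :=
  SigmaNormal (zassenhaus_normal p G i) (@zassenhaus_sigma p G i).

(* [H^1(G, 'F_p)] is the space of homomorphisms to ['F_p], continuous for the
   discrete topology of ['F_p]. *)
Definition H1 (p : nat) (G : topGroupType) (f : G -> 'F_p) : Prop :=
  (forall a, open (f @^-1` [set a])) /\ {morph f : x y / x * y >-> (x + y)%R}.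

Definition H1_dim (p : nat) (G : topGroupType) (n : nat) : Prop :=
  exists b : 'I_n -> G -> 'F_p, (forall i, H1 (b i)) /\
    forall f : G -> 'F_p, H1 f -> exists! c : {ffun 'I_n -> 'F_p},
      f = (fun x => \sum_(i < n) c i * b i x)%R.

Definition frattini (G : topGroupType) : set G :=
  \bigcap_(M in [set M : set G | [/\ is_subgroup M, closed M, M <> setT &
     forall K, is_subgroup K -> closed K -> M `<=` K -> K = M \/ K = setT]]) M.

Definition minus_set (G : sigmaGroupType) : set G := [set a | sigma a = a^-1].

Definition minus (G : sigmaGroupType) : Type := set_type (@minus_set G).

Lemma minus_set1 (G : sigmaGroupType) : (1 : G) \in @minus_set G.
Proof. by rewrite inE /minus_set /= invg1 (hom1 (@sigmaM G)). Qed.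

HB.instance Definition _ (G : sigmaGroupType) := Topological.on (minus G).
HB.instance Definition _ (G : sigmaGroupType) :=
  isPointed.Build (minus G) (exist _ 1 (@minus_set1 G)).

Definition minus_borel (G : sigmaGroupType) :=
  g_sigma_algebraType (@open (minus G)).

Definition minus_val (G : sigmaGroupType) (a : minus_borel G) : G := \val a.

Record sigmaFreeProP (p n : nat) := SigmaFreeProP {
  free_sort :> sigmaGroupType;
  free_pro_p : is_pro_p p free_sort;
  free_gen : 'I_n -> free_sort;
  free_univ : forall (H : topGroupType) (h : 'I_n -> H), is_pro_p p H ->
    exists! f : free_sort -> H, is_hom f /\ forall i, f (free_gen i) = h i;
  free_sigma : forall i, sigma (free_gen i) = (free_gen i)^-1
}.

Section Relators.
Variables (G : sigmaGroupType) (n : nat) (r : n.-tuple (minus_borel G)).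

Definition relators : set G := range (fun i => minus_val (tnth r i)).

Lemma relators_sigma x : ngen relators x -> ngen relators (sigma x).
Proof.
apply: (gen_hom (@sigma_is_hom G)).
move=> _ [_ [g [[i _ <-] ->]]].
rewrite (homJ (@sigmaM G)).
have -> : sigma (minus_val (tnth r i)) = (minus_val (tnth r i))^-1.
  by have /set_mem := valP (tnth r i).
rewrite conjVg; apply: (sgV (gen_subgroup _)).
by apply: sub_gen; exists (minus_val (tnth r i)), (sigma g); split=> //; exists i.
Qed.

Definition relN : sigmaNormal G := SigmaNormal (ngen_normal relators) relators_sigma.

End Relators.

Lemma sigma_iso_refl G : sigma_isomorphic G G.
Proof.
have hid : is_sigma_hom (@id G) by split=> //; split=> // x; exact: cvg_id.
by exists id; split=> //; exists id; split.
Qed.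

Lemma sigma_iso_sym G H : sigma_isomorphic G H -> sigma_isomorphic H G.
Proof. by move=> [f [hf [g [hg fK gK]]]]; exists g; split=> //; exists f. Qed.

Lemma sigma_hom_comp (G H K : sigmaGroupType) (f : G -> H) (g : H -> K) :
  is_sigma_hom f -> is_sigma_hom g -> is_sigma_hom (g \o f).
Proof.
move=> [[cf fM] fs] [[cg gM] gs]; split; first split.
- by move=> x; apply: continuous_comp; [exact: cf|exact: cg].
- by move=> x y /=; rewrite fM gM.
- by move=> x /=; rewrite fs gs.
Qed.

Lemma sigma_iso_trans G H K :
  sigma_isomorphic G H -> sigma_isomorphic H K -> sigma_isomorphic G K.
Proof.
move=> [f [hf [f' [hf' fK f'K]]]] [g [hg [g' [hg' gK g'K]]]].
exists (g \o f); split; first exact: sigma_hom_comp.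
exists (f' \o g'); split; first exact: sigma_hom_comp.
  exact: can_comp.
exact: can_comp.
Qed.

Section Schur.
Variables (p : nat) (F : forall n, sigmaFreeProP p n).

Definition Gr n (r : n.-tuple (minus_borel (F n))) : sigmaGroupType :=
  quot (relN r).

Definition weak_schur (G : sigmaGroupType) : Prop :=
  is_pro_p p G /\
  exists n, exists r : n.-tuple (minus_borel (F n)), sigma_isomorphic G (Gr r).

Lemma weak_schur_Gr n (r : n.-tuple (minus_borel (F n))) : weak_schur (Gr r).
Proof.
split; last by exists n, r; exact: sigma_iso_refl.
by apply: quot_pro_p; [exact: free_pro_p|exact: gen_closed].
Qed.

(* A set of isomorphism classes of groups taken in [sigmaGroupType] does not fit
   in the universe of that type.  As each class is by definition that of some
   [Gr r], [Sch] is the quotient of the small type of all relator tuples by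
   isomorphism of the groups they present. *)
Definition relator_tuples : Type := {n & n.-tuple (minus_borel (F n))}.

HB.instance Definition _ := Choice.on relator_tuples.

Definition same_Gr (r s : relator_tuples) : bool :=
  `[< sigma_isomorphic (Gr (tagged r)) (Gr (tagged s)) >].

Lemma same_Gr_refl : reflexive same_Gr.
Proof. by move=> r; apply/asboolP; exact: sigma_iso_refl. Qed.

Lemma same_Gr_sym : symmetric same_Gr.
Proof. by move=> r s; apply/asboolP/asboolP; exact: sigma_iso_sym. Qed.

Lemma same_Gr_trans : transitive same_Gr.
Proof.
move=> s r t /asboolP rs /asboolP st; apply/asboolP; exact: sigma_iso_trans st.
Qed.

Canonical same_Gr_equiv :=
  EquivRel same_Gr same_Gr_refl same_Gr_sym same_Gr_trans.

Definition Sch : Type := {eq_quot same_Gr_equiv}%qT.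

HB.instance Definition _ := Choice.on Sch.

Definition sch_of_relators n (r : n.-tuple (minus_borel (F n))) : Sch :=
  (\pi_({eq_quot same_Gr_equiv}) (Tagged (fun n => n.-tuple (minus_borel (F n))) r))%qT.

HB.instance Definition _ := isPointed.Build Sch (sch_of_relators [tuple]).

(* [is_class G c] means [c = [G]]. *)
Definition is_class (G : sigmaGroupType) (c : Sch) : Prop :=
  exists n (r : n.-tuple (minus_borel (F n))),
    sigma_isomorphic G (Gr r) /\ c = sch_of_relators r.

Definition sch_basic (i : nat) (G : sigmaGroupType) : set Sch :=
  [set c : Sch | exists H, [/\ weak_schur H, is_class H c &
     sigma_isomorphic (quot (zassenhausN p H i)) (quot (zassenhausN p G i))]].

(* Open sets are the unions of members of the basis. *)
Definition sch_open : set (set Sch) :=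
  [set A | exists B : set (set Sch),
     (forall U, B U -> exists i G, [/\ (2 <= i)%N, weak_schur G & U = sch_basic i G])
     /\ A = \bigcup_(U in B) U].

Definition sch_borel := g_sigma_algebraType sch_open.

Definition sch_map n (r : n.-tuple (minus_borel (F n))) : sch_borel :=
  sch_of_relators r.

End Schur.

Record sigmaSurj (G H : sigmaGroupType) := SigmaSurj {
  surj_fun :> G -> H;
  surj_hom : is_sigma_hom surj_fun;
  surjP : forall y, exists x, surj_fun x = y
}.

Section Image.
Variables (G H : sigmaGroupType) (f : sigmaSurj G H) (D : sigmaNormal G).

Let fM := (surj_hom f).1.2.

Lemma img_normal : is_normal (f @` nset D).
Proof.
have [sD nD] := nset_normal D; split; first split.
- by exists 1; [exact: sg1|exact: (hom1 fM)].
- move=> _ _ [x Dx <-] [y Dy <-]; exists (x * y^-1); first exact: sD.2.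
  by rewrite fM (homV fM).
- move=> _ h [x Dx <-]; have [g <-] := surjP f h; exists (x ^ g); first exact: nD.
  by rewrite (homJ fM).
Qed.

Lemma img_sigma y : (f @` nset D) y -> (f @` nset D) (sigma y).
Proof.
move=> [x Dx <-]; exists (sigma x); first exact: nset_sigma.
exact: (surj_hom f).2.
Qed.

Definition img : sigmaNormal H := SigmaNormal img_normal img_sigma.

End Image.

Definition ncard (T : choiceType) (A : set T) : nat := (#|` fset_set A|)%fset.

Definition sigma_auts (G : sigmaGroupType) : set (G -> G) := [set f | @is_sigma_iso G G f].

Definition min_nat (P : set nat) : nat :=
  xget 0%N [set m | P m /\ forall k, P k -> (m <= k)%N].

Local Open Scope ring_scope.

(* [C_k] for finite [k]; [C_infty] is its limit. *)
Definition C_ (R : realType) (p k : nat) : R :=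
  \prod_(1 <= i < k.+1) (1 - p%:R ^- i).

Definition C_infty (R : realType) (p : nat) : R := lim (C_ R p k @[k --> \oo]).

Local Open Scope ereal_scope.

Definition is_haar (R : realType) (G : sigmaGroupType)
    (mu : probability (minus_borel G) R) : Prop :=
  forall N : sigmaNormal G, open (nset N) ->
  forall q : quot N, minus_set q ->
    mu [set a | coset N (minus_val a) = q] =
      ((ncard (@minus_set (quot N)))%:R^-1)%:E.

(* The sigma-algebra of [n.-tuple T] is the product one. *)
Definition is_product (d : measure_display) (T : measurableType d) (R : realType) (n : nat)
    (mu : probability T R) (nu : probability (n.-tuple T) R) : Prop :=
  forall A : 'I_n -> set T, (forall i, measurable (A i)) ->
    nu [set t | forall i, A i (tnth t i)] = \prod_(i < n) mu (A i).

Section Measures.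
Variables (R : realType) (p : nat) (F : forall n, sigmaFreeProP p n).
Variable mutilde : forall n, probability (n.-tuple (minus_borel (F n))) R.

Definition mu_ n : set (sch_borel F) -> \bar R := pushforward (mutilde n) (@sch_map p F n).

Definition mu_infty (A : set (sch_borel F)) : \bar R := lim (mu_ n A @[n --> \oo]).

End Measures.

Section Target.
Variables (p : nat) (F : forall n, sigmaFreeProP p n) (n : nat).
Variables (D : sigmaNormal (F n)) (G : sigmaGroupType) (prj : sigmaSurj (F n) G).

Definition G_D : sigmaGroupType := quot (img prj D).

(* [coset D @` ker prj] is the image [ND/D] of [N = ker prj] in [F n / D]. *)
Definition m_D : nat := min_nat [set m | exists t : 'I_m -> quot D,
  ngen (range t) = coset D @` [set x | prj x = 1%g]].

Definition U_D : set (sch_borel F) :=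
  [set c | exists H, [/\ weak_schur F H, is_class H c, H1_dim p H n &
     exists prjH : sigmaSurj (F n) H, sigma_isomorphic (quot (img prjH D)) G_D]].

End Target.

(* Main.v *)
Require Import Defs.
From HB Require Import structures.
From mathcomp Require Import all_boot all_order all_algebra finmap.
From mathcomp Require Import all_fingroup all_solvable.
From mathcomp Require Import all_classical all_reals all_analysis.
From mathcomp Require Import measurable_realfun zify ring lra.

(** Write [Q] for [G_D] and [q : F_n -> Q] for the projection.  For a relator
    tuple [r] in [F_m], the class of [G_r] lies in [U_{D,G}] iff there is a
    surjective [sigma]-homomorphism [th : F_m -> Q] whose kernel is the preimage
    of [pi(D)] for some surjection [pi : F_n -> G_r] with [d_(G_r) = n]; for such
    an [r] these [th] form a torsor under [Aut_sigma Q].  Hence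
    [|Aut_sigma Q| mu_m(U_{D,G})] is the sum over all surjections [th] of the
    probability that [r] realizes [th].

    Fix [th], put [R = ker th] and lift [q] to [tau : F_n -> F_m].  Then [r]
    realizes [th] iff its entries lie in [R] and, together with [tau(D)],
    generate [R] as a normal subgroup, i.e. iff they span the quotient of
    [R / R^p [R, F_m]] by the image of [tau(D)].  This space has dimension
    [d = m - n + m_{D,G}] and [sigma] acts on it as [-1]; it is handled through
    its dual, the [F_m]-invariant characters of [R] that vanish on [tau(D)].  So
    the probability is that of all [r_i] lying in [R], which is [|Q^-|^(-m)],
    times that of [m] random vectors spanning ['F_p^d], which is
    [C_m / C_(m - d)].  The same count with [d = n] shows that there are
    [|Q^-|^m C_m / C_(m - n)] surjections [th].  Altogether
    [mu_m(U_{D,G}) = C_m / C_(m - n) * C_m / C_(n - m_{D,G}) / |Aut_sigma Q|]. *)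

Set Implicit Arguments.
Unset Strict Implicit.
Unset Printing Implicit Defensive.
Import Order.TTheory GRing.Theory Num.Theory.
Import numFieldNormedType.Exports.

Local Open Scope ring_scope.

(** * Counting matrices of full rank *)

(** That [sigma] acts as -1 on the characters does not come from [Q] alone but from the presentation
    of [G]. By the generation criterion its anti-invariant relators separate the characters attached
    to that presentation, so [g \o sigma + g] vanishes for every character [g] of [ker q] trivial on
    [D]. For an arbitrary [th] the lift [tau] is chosen with a retraction [lam] over [Q]. This
    splits the characters into pullbacks along [lam] of characters of [ker q] and restrictions of
    those elements of H1 of [F_m] that vanish on [tau(F_n)]; on the latter [sigma] is always -1. The
    summands have dimensions [m_{D,G}] and [m - n], and comparison with the number of relators of
    [G] gives [m_{D,G} <= n]. The sign matters because the Haar measure sees only anti-invariant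
    cosets: every coset of the joint kernel inside [R] is one, so the coordinates of a random
    relator in [R] are uniform. Lifting along surjections stays inside anti-invariant elements
    because [p] is odd. *)

Section CountRowFree.
Variable K : finFieldType.

Lemma row_free_col_mx d m (v : 'rV[K]_m) (A : 'M[K]_(d, m)) :
  row_free (col_mx v A) = row_free A && ~~ (v <= A)%MS.
Proof.
have rA := rank_leq_row A; have rv := rank_leq_row v.
have rv' := mxrank_adds_leqif v A.
have le := rv'.1; rewrite /row_free.
have e : \rank (col_mx v A) = \rank (v + A)%MS by rewrite addsmxE.
rewrite e; have [vA|nvA] := boolP (v <= A)%MS.
  rewrite (addsmx_idPr vA) andbF; apply/eqP => e'; move: rA; rewrite e'; lia.
have lt : (\rank A < \rank (v + A)%MS)%N.
  by apply: rank_ltmx; rewrite /ltmx addsmxSr addsmx_sub negb_and nvA.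
rewrite andbT; apply/eqP/eqP => h; lia.
Qed.

Lemma card_rowspace d m (A : 'M[K]_(d, m)) : row_free A ->
  #|[set v : 'rV[K]_m | (v <= A)%MS]%SET| = (#|K| ^ d)%N.
Proof.
move=> fA; have -> : [set v : 'rV[K]_m | (v <= A)%MS]%SET = [set u *m A | u : 'rV[K]_d]%SET.
  apply/setP => v; rewrite finset.inE; apply/submxP/imsetP => [[u ->]|[u _ ->]]; first by exists u.
  by exists u.
rewrite card_imset; last exact: row_free_inj.
by rewrite card_mx mul1n.
Qed.

(** A new row must avoid the span of the [d] independent rows below it, which has [#|K| ^ d]
    elements. *)
Lemma card_row_free d m : (d <= m)%N ->
  #|[set A : 'M[K]_(d, m) | row_free A]%SET| = (\prod_(i < d) (#|K| ^ m - #|K| ^ i))%N.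
Proof.
elim: d => [|d IH] dm.
  rewrite big_ord0 (_ : [set A | _]%SET = [set: 'M[K]_(0, m)]%SET); last first.
    by apply/setP => A; rewrite !finset.inE /row_free flatmx0 mxrank0 eqxx.
  by rewrite cardsT card_mx mul0n expn0.
rewrite big_ord_recr /= -(IH (ltnW dm)) -[in LHS]sum1_card -[X in _ = (X * _)%N]sum1_card.
rewrite (reindex (fun u : 'rV[K]_m * 'M[K]_(d, m) => (col_mx u.1 u.2 : 'M[K]_(d.+1, m)))) /=; last first.
  exists (fun M : 'M[K]_(1 + d, m) => (usubmx M, dsubmx M)) => [[v A] _|M _] /=.
    by rewrite col_mxKu col_mxKd.
  by rewrite vsubmxK.
under eq_bigl do rewrite finset.inE row_free_col_mx.
rewrite -(pair_big_dep predT (fun v A => row_free A && ~~ (v <= A)%MS) (fun _ _ => 1%N)) /=.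
rewrite (exchange_big_dep (fun A => row_free A)) /=; last by move=> v A _ /andP[].
rewrite big_distrl /=; apply: eq_big => [A|A fA]; first by rewrite finset.inE.
rewrite mul1n (eq_bigl (fun v => v \in ~: [set v : 'rV[K]_m | (v <= A)%MS]%SET)); last first.
  by move=> v; rewrite !finset.inE fA.
rewrite sum1_card -(card_rowspace fA); apply/eqP.
rewrite -(eqn_add2l #|[set v : 'rV[K]_m | (v <= A)%MS]%SET|) cardsC card_mx mul1n.
rewrite subnKC// card_rowspace//; apply: leq_pexp2l; last exact: ltnW.
by apply/card_gt0P; exists 0.
Qed.


End CountRowFree.

Local Open Scope group_scope.

(** * Characters of finite p-groups *)

Section FiniteCharacters.
Variables (gT : finGroupType) (p : nat).
Hypothesis p_pr : prime p.

(** [R / M] is cyclic of order [p], and [f] is the exponent of a coset with respect to a generator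
    [c]. Extension by 0 outside [R] is the convention that [is_char] adopts later. *)
Lemma index_prime_char (R M : {group gT}) : normal M R -> #|R : M| = p ->
  exists f : gT -> 'F_p, [/\ {in R &, forall x y, f (x * y) = (f x + f y)%R},
    forall x, x \notin R -> f x = 0%R &
    {in R, forall x, (f x == 0%R) = (x \in M)}].
Proof.
move=> nMR iMR.
have oRM : #|R / M| = p by rewrite card_quotient// normal_norm.
have /cyclicP[c Ec] : cyclic (R / M) by apply: prime_cyclic; rewrite oRM.
have oc : #[c] = p by rewrite orderE -Ec oRM.
(* On [R] the [pick] always succeeds, since exponents of [c] can be reduced modulo [p]. *)
pose f x : 'F_p := if x \in R then
  (if [pick i : 'I_p | coset M x == c ^+ i] is Some i then i%:R%R else 0%R) else 0%R.
have eqF i j : i = j %[mod p] -> (i%:R = j%:R :> 'F_p)%R.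
  by move=> e; rewrite -(Fp_nat_mod p_pr i) -(Fp_nat_mod p_pr j) e.
have fE x i : x \in R -> coset M x = c ^+ i -> f x = i%:R%R.
  move=> xR e; rewrite /f xR; case: pickP => [j /eqP e'|].
    by apply: eqF; have /eqP := etrans (esym e') e; rewrite eq_expg_mod_order oc => /eqP.
  have lt : (i %% p < p)%N by rewrite ltn_mod prime_gt0.
  have em : c ^+ (i %% p) = c ^+ i by rewrite -[in LHS]oc expg_mod_order.
  by move/(_ (Ordinal lt)); rewrite /= e em eqxx.
have ex x : x \in R -> exists i, coset M x = c ^+ i.
  by move=> xR; apply/cycleP; rewrite -Ec mem_quotient.
have nM x : x \in R -> x \in 'N(M) by move=> xR; apply: (fintype.subsetP (normal_norm nMR)).
exists f; split=> [x y xR yR|x xR|x xR].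
- have [i ei] := ex x xR; have [j ej] := ex y yR.
  rewrite (fE _ _ xR ei) (fE _ _ yR ej) -natrD; apply: fE; first exact: groupM.
  have -> : coset M (x * y) = coset M x * coset M y by apply: morphM; exact: nM.
  by rewrite ei ej expgD.
- by rewrite /f (negbTE xR).
- have [i ei] := ex x xR; rewrite (fE _ _ xR ei).
  rewrite -(dvdn_pcharf (pchar_Fp p_pr)) -oc order_dvdn -ei.
  by apply/eqP/idP => [/coset_idr->//|/coset_id//]; exact: nM.
Qed.

(** By nilpotency of the quotient by [S], the join of [S] and [[~: R, [set: gT]]] is proper in [R].
    A maximal subgroup of [R] above it has index [p], and its character is conjugation invariant
    because it kills the commutators. *)
Lemma pgroup_normal_char (R S : {group gT}) : p.-group [set: gT] ->
  normal R [set: gT] -> normal S [set: gT] -> S \proper R ->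
  exists f : gT -> 'F_p, [/\ {in R &, forall x y, f (x * y) = (f x + f y)%R},
    forall x, x \notin R -> f x = 0%R, {in R, forall x g, f (x ^ g) = f x},
    {in S, forall x, f x = 0%R} & exists2 x, x \in R & f x != 0%R].
Proof.
move=> pG nR nS pSR.
have sSR := proper_sub pSR.
have sCR : [~: R, [set: gT]] \subset R by rewrite commg_subl normal_norm.
have nCR : S <*> [~: R, [set: gT]] \subset R by rewrite join_subG sSR.
have [e|[M maxM sM]] := maximal_exists nCR.
  have nS' : [set: gT] \subset 'N(S) := normal_norm nS.
  have nRS : R \subset 'N(S) by apply: fintype.subset_trans nS'; exact: finset.subsetT.
  have R1 : R / S :!=: 1.
    by rewrite -subG1 quotient_sub1//; case/andP: pSR.
  have nil : nilpotent ([set: gT] / S) := pgroup_nil (quotient_pgroup S pG).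
  have nN : [set: gT] / S \subset ([set: gT] / S :&: 'N(R / S)).
    by rewrite finset.subsetI fintype.subxx quotient_norms// normal_norm.
  have := nil_comm_properl nil (quotientS S (finset.subsetT R)) R1 nN.
  rewrite -quotientR// => /properP[_ [_ /morphimP[x Nx Rx ->]]]/negP[].
  move: Rx; rewrite -{1}e /= norm_joinEr; last first.
    by apply: fintype.subset_trans nRS.
  case/mulsgP=> s t sS tC ->; have tN : t \in 'N(S) by apply: (fintype.subsetP nS'); rewrite inE.
  have sN : s \in 'N(S) by apply: (fintype.subsetP nS'); rewrite inE.
  have -> : coset S (s * t) = coset S s * coset S t by exact: morphM.
  by rewrite coset_id// mul1g; exact: mem_quotient.
have pR : p.-group R := pgroupS (finset.subsetT R) pG.
have [f [fM f0 fE]] := index_prime_char (p_maximal_normal pR maxM) (p_maximal_index pR maxM).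
have sMR := maxgroupp maxM.
move: sM; rewrite join_subG => /andP[sSM sCM].
exists f; split=> //.
- move=> x xR g; rewrite conjg_mulR fM//; last first.
    by apply: (fintype.subsetP sCR); rewrite mem_commg// inE.
  have -> : f [~ x, g] = 0%R.
    apply/eqP; rewrite fE; last by apply: (fintype.subsetP sCR); rewrite mem_commg// inE.
    by apply: (fintype.subsetP sCM); rewrite mem_commg// inE.
  by rewrite GRing.addr0.
- by move=> x xS; apply/eqP; rewrite fE ?(fintype.subsetP sSR)// (fintype.subsetP sSM).
- have /properP[_ [x xR xM]] := maxgroupp maxM.
  by exists x => //; rewrite fE.
Qed.

(** Here [H] need not be normal: in a p-group a maximal subgroup above it is normal of index [p]. *)
Lemma pgroup_maximal_char (H : {group gT}) : p.-group [set: gT] -> H \proper [set: gT] ->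
  exists f : gT -> 'F_p, [/\ forall x y, f (x * y) = (f x + f y)%R,
    {in H, forall x, f x = 0%R} & exists x, f x != 0%R].
Proof.
move=> pG pH.
have [e|[M maxM sM]] := maximal_exists (finset.subsetT H).
  by move: pH; rewrite e fintype.properxx.
have pGT : p.-group [set: gT]%G := pG.
have [f [fM f0 fE]] := index_prime_char (p_maximal_normal pGT maxM) (p_maximal_index pGT maxM).
exists f; split=> [x y|x xH|].
- by apply: fM; rewrite inE.
- by apply/eqP; rewrite fE ?inE// (fintype.subsetP sM).
- have /properP[_ [x _ xM]] := maxgroupp maxM.
  by exists x; rewrite fE ?inE.
Qed.

End FiniteCharacters.

Local Open Scope classical_set_scope.
Local Open Scope ring_scope.
Local Open Scope group_scope.

(* An alias, because a finiteness hypothesis cannot be attached to the quotient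
   groups themselves as a canonical [finGroupType] structure. *)
Definition fin_copy (T : groupType) of finite_set [set: T] : Type := T.

Section FinCopy.
Variables (T : groupType) (finT : finite_set [set: T]).
Local Notation fT := (fin_copy finT).

HB.instance Definition _ := Group.copy fT T.

Let fenum : seq fT := fset_set [set: T].

Let mem_fenum x : x \in fenum.
Proof. by rewrite /fenum in_fset_set// in_setT. Qed.

Let fpickle (x : fT) : nat := index x fenum.
Let funpickle (i : nat) : option fT := Some (nth 1 fenum i).

Let fpickleK : pcancel fpickle funpickle.
Proof. by move=> x; rewrite /funpickle /fpickle nth_index. Qed.

HB.instance Definition _ := PCanIsCountable fpickleK.

Let fenumP : Finite.axiom fenum.
Proof. by move=> x; rewrite count_uniq_mem ?mem_fenum// fset_uniq. Qed.

HB.instance Definition _ := fintype.isFinite.Build fT fenumP.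
HB.instance Definition _ := Finite.on fT.

Lemma card_fin_copy : #|[set: fT]%SET| = (#|` fset_set [set: T]|)%fset.
Proof. by rewrite cardsT cardE enumT unlock. Qed.

End FinCopy.

(** * Finite characters for subgroups given as classical sets *)

Section FiniteTransport.
Variables (p k : nat) (T : groupType).
Hypotheses (p_pr : prime p) (cardT : ([set: T] #= `I_(p ^ k))%card).

Let finT : finite_set [set: T].
Proof. by apply/finite_setP; exists (p ^ k)%N. Qed.
Local Notation fT := (fin_copy finT).

Let cardfT : #|[set: fT]%SET| = (p ^ k)%N.
Proof. by rewrite card_fin_copy (card_fset_set cardT). Qed.

Let pT : p.-group [set: fT]%SET.
Proof. by rewrite /pgroup cardfT pnatX pnat_id. Qed.

Let finset_of (H : set T) : {set fT} := [set x : fT | x \in H]%SET.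

Let in_finset_of H (x : fT) : (x \in finset_of H) = (x \in H).
Proof. by rewrite finset.inE. Qed.

Let finset_of_group H : is_subgroup H -> group_set (finset_of H).
Proof.
move=> sH; apply/group_setP; split; first by rewrite in_finset_of; apply/mem_set; exact: sg1.
move=> x y; rewrite !in_finset_of => /set_mem Hx /set_mem Hy; apply/mem_set.
exact: sgM.
Qed.

Let normal_of H (nH : is_normal H) : normal (Group (finset_of_group nH.1)) [set: fT]%SET.
Proof.
apply/normalP; split; first exact: finset.subsetT.
move=> g _; apply/setP => x; rewrite mem_conjg !in_finset_of.
apply/idP/idP => /set_mem h; apply/mem_set.
  by have := nH.2 _ g h; rewrite conjgKV.
exact: nH.2.
Qed.

Lemma finite_normal_char (R S : set T) : is_normal R -> is_normal S ->
  S `<=` R -> S <> R ->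
  exists f : T -> 'F_p, [/\ forall x y, R x -> R y -> f (x * y) = (f x + f y)%R,
    forall x, ~ R x -> f x = 0%R, forall x g, R x -> f (x ^ g) = f x,
    forall x, S x -> f x = 0%R & exists2 x, R x & f x <> 0%R].
Proof.
move=> nR nS sSR neq.
have [|f [fM f0 fJ fS [x xR fx]]] :=
  @pgroup_normal_char _ _ p_pr (Group (finset_of_group nR.1))
    (Group (finset_of_group nS.1)) pT (normal_of nR) (normal_of nS).
  apply/properP; split.
    apply/fintype.subsetP => x /=; rewrite !in_finset_of => /set_mem Sx.
    exact/mem_set/sSR.
  have [x Rx Sx] : exists2 x, R x & ~ S x.
    apply: contrapT => h; apply: neq; apply/seteqP; split=> // x Rx.
    by apply: contrapT => Sx; apply: h; exists x.
  exists x => /=; rewrite in_finset_of; first exact: mem_set.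
  by apply/negP => /set_mem.
exists f; split.
- by move=> a b Ra Rb; apply: fM => /=; rewrite in_finset_of mem_set.
- by move=> a Ra; apply: f0 => /=; rewrite in_finset_of; apply/negP => /set_mem.
- by move=> a g Ra; apply: fJ => /=; rewrite in_finset_of mem_set.
- by move=> a Sa; apply: fS => /=; rewrite in_finset_of mem_set.
- exists x; last exact/eqP.
  by move: xR; rewrite /= in_finset_of => /set_mem.
Qed.

Lemma finite_maximal_char (H : set T) : is_subgroup H -> H <> setT ->
  exists f : T -> 'F_p, [/\ forall x y, f (x * y) = (f x + f y)%R,
    forall x, H x -> f x = 0%R & exists x, f x <> 0%R].
Proof.
move=> sH neq.
have [|f [fM fH [x fx]]] :=
  @pgroup_maximal_char _ _ p_pr (Group (finset_of_group sH)) pT.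
  apply/properP; split; first exact: finset.subsetT.
  have [x Hx] : exists x, ~ H x.
    apply: contrapT => h; apply: neq; apply/seteqP; split=> // x _.
    by apply: contrapT => Sx; apply: h; exists x.
  exists x => /=; first exact: finset.in_setT.
  by rewrite in_finset_of; apply/negP => /set_mem.
exists f; split=> //; last by exists x; exact/eqP.
by move=> a Ha; apply: fH => /=; rewrite in_finset_of mem_set.
Qed.

Lemma finite_expg (x : T) : x ^+ (p ^ k) = 1.
Proof.
by rewrite -cardfT; apply: (@expg_cardG fT [set: fT]%G); rewrite finset.inE.
Qed.

End FiniteTransport.

(* [fingroup] also defines [coset]. *)
Import Defs.

(** * Characters of pro-p-groups *)

Lemma open_mulgl (G : topGroupType) (x : G) (A : set G) :
  open A -> open ((fun y => x * y) @^-1` A).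
Proof. by move: A; apply/continuousP; exact: mulgl_continuous. Qed.

Lemma open_subgroup_closed (G : topGroupType) (H : set G) :
  is_subgroup H -> open H -> closed H.
Proof.
move=> sH oH; rewrite -[H]setCK; apply: open_closedC.
have -> : ~` H = \bigcup_(x in ~` H) ((fun y => x^-1 * y) @^-1` H).
  apply/seteqP; split=> [x Hx|x [y Hy /= Hyx] Hx].
    by exists x => //=; rewrite mulVg; exact: sg1.
  apply: Hy; have := sgM sH Hx (sgV sH Hyx).
  by rewrite invgM invgK mulVKg.
by apply: bigcup_open => x _; exact: open_mulgl.
Qed.

Lemma closed_image (X Y : topologicalType) (f : X -> Y) (A : set X) :
  compact [set: X] -> hausdorff_space Y -> continuous f -> closed A -> closed (f @` A).
Proof.
move=> cX hY cf clA; apply: compact_closed => //; apply: continuous_compact.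
  exact: continuous_subspaceT.
by apply: (subclosed_compact clA cX).
Qed.

(** A continuous map from a compact space to a Hausdorff space is closed, so the surjection [f] is a
    topological quotient map. *)
Lemma factor_continuous (X Y Z : topologicalType) (f : X -> Y) (g : Y -> Z) :
  compact [set: X] -> hausdorff_space Y -> continuous f ->
  (forall y, exists x, f x = y) -> continuous (g \o f) -> continuous g.
Proof.
move=> cX hY cf sf cgf; apply/continuous_closedP => C clC.
have -> : g @^-1` C = f @` ((g \o f) @^-1` C).
  apply/seteqP; split=> [y Cy|_ [x Cx <-]//].
  by have [x ?] := sf y; subst y; exists x.
apply: closed_image => //; by move/continuous_closedP: cgf; apply.
Qed.

Definition sigma_surj (G H : sigmaGroupType) (f : G -> H) :=
  is_sigma_hom f /\ forall y, exists x, f x = y.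

Lemma coset_surj (G : sigmaGroupType) (N : sigmaNormal G) (a : quot N) :
  exists x, coset N x = a.
Proof. by exists (coset_repr a); exact: coset_reprK. Qed.

Lemma coset1P (G : sigmaGroupType) (N : sigmaNormal G) x : coset N x = 1 <-> nset N x.
Proof.
split=> [e|Nx].
  have /coset_eq : coset N 1 = coset N x := esym e.
  by rewrite invg1 mul1g.
by apply/esym/coset_eq; rewrite invg1 mul1g.
Qed.

Lemma coset_sigma_hom (G : sigmaGroupType) (N : sigmaNormal G) : is_sigma_hom (@coset G N).
Proof. by split; [split; [exact: coset_continuous|exact: cosetM]|exact: coset_sigma]. Qed.

Lemma coset_sigma_surj (G : sigmaGroupType) (N : sigmaNormal G) : sigma_surj (@coset G N).
Proof. by split; [exact: coset_sigma_hom|exact: coset_surj]. Qed.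

Section SigmaNormalBasis.
Variables (p : nat) (G : sigmaGroupType).
Hypothesis pG : is_pro_p p G.

Lemma sigma_preim_normal (N : set G) : is_normal N -> is_normal (@sigma G @^-1` N).
Proof.
move=> nN; split; first split.
- by rewrite /= (hom1 (@sigmaM G)); exact: (sg1 nN.1).
- by move=> x y /= Nx Ny; rewrite sigmaM (homV (@sigmaM G)); exact: nN.1.2.
- by move=> x g /= Nx; rewrite (homJ (@sigmaM G)); exact: nN.2.
Qed.

Lemma normalI (M N : set G) : is_normal M -> is_normal N -> is_normal (M `&` N).
Proof.
move=> nM nN; split; first split.
- by split; [exact: (sg1 nM.1)|exact: (sg1 nN.1)].
- by move=> x y [Mx Nx] [My Ny]; split; [exact: nM.1.2|exact: nN.1.2].
- by move=> x g [Mx Nx]; split; [exact: nM.2|exact: nN.2].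
Qed.

Lemma sigma_normal_basis (U : set G) : nbhs 1 U ->
  exists N : sigmaNormal G, open (nset N) /\ nset N `<=` U.
Proof.
have [_ _ bG _] := pG; move=> /bG[N [nN oN sN]].
have sg x : (N `&` @sigma G @^-1` N) x -> (N `&` @sigma G @^-1` N) (sigma x).
  by move=> [Nx Nsx]; split=> //=; rewrite sigmaK.
exists (SigmaNormal (normalI nN (sigma_preim_normal nN)) sg); split=> /=.
  by apply: openI => //; move/continuousP: (@sigma_continuous G); apply.
by move=> x [Nx _]; exact: sN.
Qed.

Section OpenQuotient.
Variable N : sigmaNormal G.
Hypothesis oN : open (nset N).

Lemma open_quot (A : set (quot N)) : open A.
Proof.
rewrite open_quotE.
have -> : @coset G N @^-1` A = \bigcup_(x in @coset G N @^-1` A)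
    ((fun y => x^-1 * y) @^-1` nset N).
  apply/seteqP; split=> [x Ax|x [y Ay /= /coset_eq e]]; last by rewrite /= -e.
  by exists x => //=; rewrite mulVg; exact: (sg1 (nset_normal N).1).
by apply: bigcup_open => x _; exact: open_mulgl.
Qed.

Lemma card_quot : exists k, ([set: quot N] #= `I_(p ^ k)%N)%card.
Proof.
have [_ _ _ iG] := pG.
have [k hk] := iG _ (nset_normal N) oN; exists k; apply: card_eq_trans hk.
pose F (a : quot N) := [set coset_repr a * x | x in nset N].
have FE x : F (coset N x) = [set x * y | y in nset N].
  apply/seteqP; split=> _ [y Ny <-].
    exists (x^-1 * coset_repr (coset N x) * y); last by rewrite -!mulgA mulVKg.
    apply: sgM => //; first exact: (nset_normal N).1.
    by apply/coset_eq; rewrite coset_reprK.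
  exists ((coset_repr (coset N x))^-1 * x * y); last by rewrite -!mulgA mulVKg.
  apply: sgM => //; first exact: (nset_normal N).1.
  by apply/coset_eq; rewrite coset_reprK.
have -> : lcosets (nset N) = F @` setT.
  apply/seteqP; split=> [_ [x _ <-]|_ [a _ <-]].
    by exists (coset N x) => //; rewrite FE.
  by exists (coset_repr a).
rewrite card_eq_sym; apply: inj_card_eq => a b _ _.
have [x <-] := coset_surj a; have [y <-] := coset_surj b.
rewrite !FE => e; apply/coset_eq.
have : [set y * z | z in nset N] y.
  by exists 1; rewrite ?mulg1//; exact: (sg1 (nset_normal N).1).
by rewrite -e => -[z Nz <-]; rewrite mulKg.
Qed.

Lemma finite_quot : finite_set [set: quot N].
Proof. by have [k hk] := card_quot; apply/finite_setP; exists (p ^ k)%N. Qed.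

Lemma expg_open : exists k, forall x : G, nset N (x ^+ (p ^ k)).
Proof.
have [k hk] := card_quot; exists k => x.
have := finite_expg hk (coset N x).
rewrite -(homX (@cosetM _ N)) => e.
have /coset_eq : coset N 1 = coset N (x ^+ (p ^ k)) by rewrite e.
by rewrite invg1 mul1g.
Qed.

End OpenQuotient.

(* A model of the dual of [R / R^p [R, G]] (for [R] open and normal): a character
   of [R] is extended by [0] outside [R]. *)
Definition is_char (R : set G) (f : G -> 'F_p) :=
  [/\ forall a, open (f @^-1` [set a]),
    forall x y, R x -> R y -> f (x * y) = (f x + f y)%R,
    forall x g, R x -> f (x ^ g) = f x &
    forall x, ~ R x -> f x = 0%R].

Hypothesis p_pr : prime p.

Lemma preim_coset_open (N : sigmaNormal G) (f : quot N -> 'F_p) :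
  open (nset N) -> forall a, open ((f \o coset N) @^-1` [set a]).
Proof. by move=> oN a; rewrite comp_preimage -open_quotE; exact: open_quot. Qed.

(** Reduction to a finite quotient by an open [N]: inside [R], so that [R] is the full preimage of
    its image, and with [x N] disjoint from [S], so that the images of [R] and [S] still differ. *)
Lemma profinite_normal_char (R S : set G) : is_normal R -> open R ->
  is_normal S -> closed S -> S `<=` R -> S <> R ->
  exists f, [/\ is_char R f, forall x, S x -> f x = 0%R & exists2 x, R x & f x <> 0%R].
Proof.
move=> nR oR nS clS sSR neq.
have [x Rx Sx] : exists2 x, R x & ~ S x.
  apply: contrapT => h; apply: neq; apply/seteqP; split=> // x Rx.
  by apply: contrapT => Sx; apply: h; exists x.
have [N [oN sN]] : exists N : sigmaNormal G, open (nset N) /\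
    nset N `<=` R `&` ((fun y => x * y) @^-1` (~` S)).
  apply: sigma_normal_basis; apply: open_nbhs_nbhs; split.
    by apply: openI => //; apply: open_mulgl; exact: closed_openC.
  by split; [exact: (sg1 nR.1)|rewrite /= mulg1].
have [k hk] := card_quot oN.
have RN y : (coset N @` R) (coset N y) -> R y.
  move=> [z Rz /coset_eq /sN[Rzy _]].
  by have := sgM nR.1 Rz Rzy; rewrite mulVKg.
have [|e|f [fM f0 fJ fS [y Ry fy]]] :=
    finite_normal_char p_pr hk (normal_image N nR) (normal_image N nS).
- by move=> _ [s Ss <-]; exists s => //; exact: sSR.
- have : (coset N @` R) (coset N x) by exists x.
  rewrite -e => -[s Ss /esym/coset_eq/sN[_]].
  by rewrite /= mulVKg.
exists (f \o coset N); split; first split.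
- exact: preim_coset_open.
- by move=> a b Ra Rb /=; rewrite cosetM; apply: fM; [exists a|exists b].
- by move=> a g Ra /=; rewrite (homJ (@cosetM _ N)); apply: fJ; exists a.
- by move=> a Ra /=; apply: f0 => /RN.
- by move=> a Sa; apply: fS; exists a.
- by have [z ez] := coset_surj y; subst y; exists z => //; exact: RN.
Qed.

(** The same reduction, with [x N] disjoint from [H]. It serves to prove surjectivity: a proper
    closed image is annihilated by a nonzero class in H1. *)
Lemma profinite_maximal_char (H : set G) : is_subgroup H -> closed H -> H <> setT ->
  exists f : G -> 'F_p, [/\ H1 f, forall x, H x -> f x = 0%R & exists x, f x <> 0%R].
Proof.
move=> sH clH neq.
have [x Hx] : exists x, ~ H x.
  apply: contrapT => h; apply: neq; apply/seteqP; split=> // x _.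
  by apply: contrapT => Sx; apply: h; exists x.
have [N [oN sN]] : exists N : sigmaNormal G, open (nset N) /\
    nset N `<=` ((fun y => x * y) @^-1` (~` H)).
  apply: sigma_normal_basis; apply: open_nbhs_nbhs; split; last by rewrite /= mulg1.
  by apply: open_mulgl; exact: closed_openC.
have [k hk] := card_quot oN.
have sHN : is_subgroup (coset N @` H).
  split; first by exists 1 => //; exact: sg1.
  move=> _ _ [a Ha <-] [b Hb <-]; exists (a * b^-1); first exact: sH.2.
  by rewrite cosetM cosetV.
have [e|f [fM fH [y fy]]] := finite_maximal_char p_pr hk sHN.
  have : (coset N @` H) (coset N x) by rewrite e.
  by move=> -[s Ss /esym/coset_eq/sN]; rewrite /= mulVKg.
exists (f \o coset N); split; first split.
- exact: preim_coset_open.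
- by move=> a b /=; rewrite cosetM fM.
- by move=> a Ha; apply: fH; exists a.
- by have [z ez] := coset_surj y; subst y; exists z.
Qed.

End SigmaNormalBasis.

(** Replaces the limit of a sequence: a cluster point inherits every closed condition that holds
    eventually, which is enough to transport identities. *)
Lemma compact_cluster_seq (X : topologicalType) (u : nat -> X) :
  compact [set: X] -> exists x, forall A : set X, closed A ->
    (exists n0, forall n, (n0 <= n)%N -> A (u n)) -> A x.
Proof.
move=> cX; have [|x [_ clx]] := cX (u @ \oo) _; first exact: filterT.
exists x => A clA [n0 hn]; apply: clA => B nB; apply: clx => //.
by exists n0.
Qed.

Lemma closed_eqmap (X Y : topologicalType) (f g : X -> Y) :
  hausdorff_space Y -> continuous f -> continuous g -> closed [set x | f x = g x].
Proof.
rewrite open_hausdorff => hY cf cg.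
rewrite -[X in closed X]setCK; apply: open_closedC.
rewrite openE => x /= /eqP /hY[[A B] /= [fA gB] [oA oB /eqP AB0]].
have : nbhs x (f @^-1` A `&` g @^-1` B).
  by apply: filterI; [apply: cf|apply: cg]; apply: open_nbhs_nbhs; split=> //;
    exact/set_mem.
apply: filterS => y [/= Ay By] e; suff : (A `&` B) (f y) by rewrite AB0.
by split=> //; rewrite e.
Qed.

Section ProP.
Variables (p : nat) (G : sigmaGroupType).
Hypothesis pG : is_pro_p p G.

Lemma pro_p_eq1 (x : G) :
  (forall N : sigmaNormal G, open (nset N) -> nset N x) -> x = 1.
Proof.
move=> h; have [_ hG _ _] := pG; apply: hG => A B nA nB.
pose C := [set y | A (x * y)] `&` B.
have [N [oN sN]] : exists N : sigmaNormal G, open (nset N) /\ nset N `<=` [set y | A (x * y)].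
  apply: (sigma_normal_basis pG).
  by apply: (@mulgl_continuous G x 1); rewrite mulg1.
exists 1; split; last exact: nbhs_singleton nB.
rewrite -(mulgV x); apply: sN; apply: sgV (h _ oN); exact: (nset_normal N).1.
Qed.

End ProP.

(** * Lifting anti-invariant elements *)

Section MinusLift.
Variables (p : nat) (A B : sigmaGroupType) (alpha : A -> B).
Hypotheses (p_pr : prime p) (p_gt2 : (2 < p)%N).
Hypotheses (pA : is_pro_p p A) (hB : hausdorff_space B) (hal : is_sigma_hom alpha).

Let halfp k := ((p ^ k).+1./2)%N.

Let halfpE k : (halfp k + halfp k)%N = (p ^ k).+1.
Proof.
rewrite addnn -[RHS]odd_double_half /halfp /= oddX.
by case: (even_prime p_pr) p_gt2 => [->|->]; rewrite ?orbT.
Qed.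

(* The element [c = sigma y * y] lies in the kernel.  A cluster point of its powers
   of exponent [(p^k + 1) / 2] is a square root [k] of [c], and [y * k^-1] is the
   required lift. *)
Lemma minus_lift (y : A) : minus_set (alpha y) ->
  exists2 a, minus_set a & alpha a = alpha y.
Proof.
move=> ay; have [[ca aM] as_] := hal; pose c := sigma y * y.
have [cA hA _ _] := pA.
have ac : alpha c = 1 by rewrite /c aM as_ ay mulVg.
have [k hk] := compact_cluster_seq (fun i => c ^+ halfp i) cA.
have ak : alpha k = 1.
  apply: (hk [set x | alpha x = 1]).
    by apply: closed_eqmap => // x; exact: cvg_cst.
  by exists 0%N => n _ /=; rewrite (homX aM) ac expg1n.
(* The identity [sigma c = y * c * y^-1] passes to all powers of [c], and then to the cluster
   point. *)
have sk : sigma k = y * k * y^-1.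
  apply: (hk [set x | sigma x = y * x * y^-1]).
    apply: closed_eqmap => //; first exact: sigma_continuous.
    have -> : (fun x => y * x * y^-1) = (fun x => x * y^-1) \o (fun x => y * x) by [].
    move=> x; apply: continuous_comp; first exact: mulgl_continuous.
    exact: mulgr_continuous.
  exists 0%N => n _ /=.
  have -> z m : y * z ^+ m * y^-1 = (z ^ y^-1) ^+ m.
    by rewrite -conjXg conjgE invgK mulgA.
  rewrite (homX (@sigmaM A)); congr (_ ^+ _).
  by rewrite /c sigmaM sigmaK conjgE invgK -!mulgA mulgV mulg1.
have kk : k * k = c.
  apply: (mulgI c^-1); rewrite mulVg; apply: (pro_p_eq1 pA) => N oN.
  apply: (hk [set x | nset N (c^-1 * (x * x))]).
    have clN : closed (nset N) := open_subgroup_closed (nset_normal N).1 oN.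
    have cf : continuous (fun x : A => c^-1 * (x * x)).
      have -> : (fun x => c^-1 * (x * x)) = (fun x => c^-1 * x) \o (fun x => x * x) by [].
      move=> x; apply: continuous_comp; last exact: mulgl_continuous.
      apply: (@cvg_comp _ _ _ (fun y => (y, y)) (fun z => z.1 * z.2)).
        exact: (cvg_pair (@cvg_id _ _) (@cvg_id _ _)).
      exact: (@mulg_continuous A (x, x)).
    by move/continuous_closedP: cf; apply.
  (* The square of [c ^+ halfp n] is [c] times [c ^+ (p ^ n)], and the latter lies in [N] once
     [p ^ j], a multiple of the exponent of [A / N], divides [p ^ n]. *)
  have [j hj] := expg_open pA oN.
  exists j => n jn /=; rewrite -expgnDr halfpE expgS mulKg.
  rewrite -(subnKC jn) expnD expgnA.
  elim: (p ^ (n - j))%N => [|m IH]; first by rewrite expg0; exact: (sg1 (nset_normal N).1).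
  rewrite expgS; apply: sgM IH; [exact: (nset_normal N).1|exact: hj].
exists (y * k^-1); last by rewrite aM (homV aM) ak invg1 mulg1.
rewrite /minus_set /= sigmaM (homV (@sigmaM A)) sk !invgM !invgK.
have -> : sigma y = k * k * y^-1 by rewrite kk /c mulgK.
by rewrite -!mulgA mulKg mulVKg.
Qed.

End MinusLift.

(** * Factoring homomorphisms through surjections *)

Section Factor.
Variables (F A : sigmaGroupType) (alpha : F -> A).
Hypotheses (cF : compact [set: F]) (hA : hausdorff_space A).
Hypotheses (hal : is_sigma_hom alpha) (sal : forall y, exists x, alpha x = y).

Lemma hom_eq_ker (X : sigmaGroupType) (Y : groupType) (f : X -> Y) (fM : {morph f : x y / x * y})
  (x y : X) : f x = f y <-> f (x^-1 * y) = 1.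
Proof.
rewrite fM (homV fM); split=> [->|e]; first by rewrite mulVg.
by apply/esym/(mulgI (f x)^-1); rewrite mulVg.
Qed.

Lemma sigma_hom_factor (B : sigmaGroupType) (beta : F -> B) :
  is_sigma_hom beta -> (forall x, alpha x = 1 -> beta x = 1) ->
  exists g : A -> B, is_sigma_hom g /\ forall x, g (alpha x) = beta x.
Proof.
move=> hbe k; have [[ca aM] as_] := hal; have [[cb bM] bs] := hbe.
pose s y := xget 1 [set x | alpha x = y].
have sP y : alpha (s y) = y by have [x ?] := sal y; apply: (@xgetPex _ 1 [set x | alpha x = y]); exists x.
have gE x : beta (s (alpha x)) = beta x.
  by apply/(hom_eq_ker bM)/k/(hom_eq_ker aM).
exists (beta \o s); split=> [|x] //=; split; first split.
- apply: (factor_continuous cF hA ca sal).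
  by have -> : (beta \o s) \o alpha = beta by apply: funext => x /=; rewrite gE.
- by move=> x y; have [u <-] := sal x; have [v <-] := sal y; rewrite /= -aM !gE bM.
- by move=> x; have [u <-] := sal x; rewrite /= -as_ !gE bs.
Qed.

End Factor.

Lemma sigma_iso_same_ker (F A B : sigmaGroupType) (alpha : F -> A) (beta : F -> B) :
  compact [set: F] -> hausdorff_space A -> hausdorff_space B ->
  is_sigma_hom alpha -> (forall y, exists x, alpha x = y) ->
  is_sigma_hom beta -> (forall y, exists x, beta x = y) ->
  (forall x, alpha x = 1 <-> beta x = 1) ->
  exists g : A -> B, is_sigma_iso g /\ forall x, g (alpha x) = beta x.
Proof.
move=> cF hA hB hal sal hbe sbe e.
have [g [hg ge]] := sigma_hom_factor cF hA hal sal hbe (fun x => proj1 (e x)).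
have [g' [hg' ge']] := sigma_hom_factor cF hB hbe sbe hal (fun x => proj2 (e x)).
exists g; split=> //; split=> //; exists g'; split=> // y.
  by have [x <-] := sal y; rewrite ge ge'.
by have [x <-] := sbe y; rewrite ge' ge.
Qed.

(** * Functions with values in ['F_p] *)

(* The additive group of ['F_p], discrete and written multiplicatively: a target for
   the universal property of free pro-p-groups. *)
Definition fp_group (p : nat) : Type := 'F_p.

Section FpGroup.
Variable p : nat.
Local Notation Z := (fp_group p).

HB.instance Definition _ := Choice.copy Z 'F_p.

Let fmul (a b : Z) : Z := ((a : 'F_p) + b)%R.
Let finv (a : Z) : Z := (- (a : 'F_p))%R.
Let fone : Z := (0 : 'F_p)%R.

Let fmulA : associative fmul. Proof. exact: GRing.addrA. Qed.
Let fmul1 : left_id fone fmul. Proof. exact: GRing.add0r. Qed.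
Let fmulr1 : right_id fone fmul. Proof. exact: GRing.addr0. Qed.
Let fmulV : left_inverse fone finv fmul. Proof. exact: GRing.addNr. Qed.
Let fmulrV : right_inverse fone finv fmul. Proof. exact: GRing.addrN. Qed.

HB.instance Definition _ := isGroup.Build Z fmulA fmul1 fmulr1 fmulV fmulrV.

Let fopen (A : set Z) := True.
Let fopenT : fopen setT. Proof. by []. Qed.
Let fopenI (A B : set Z) : fopen A -> fopen B -> fopen (A `&` B). Proof. by []. Qed.
Let fopen_bigU (I : Type) (f : I -> set Z) : (forall i, fopen (f i)) -> fopen (\bigcup_i f i).
Proof. by []. Qed.

HB.instance Definition _ := isOpenTopological.Build Z fopenT fopenI fopen_bigU.

Let fmul_continuous : continuous (fun z : Z * Z => z.1 * z.2).
Proof.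
move=> [a b] U nU; exists ([set a], [set b]) => /=.
  by split; apply: open_nbhs_nbhs.
by move=> [c d] /= [-> ->]; exact: nbhs_singleton nU.
Qed.

Let finv_continuous : continuous (fun z : Z => z^-1).
Proof. by apply/continuousP. Qed.

HB.instance Definition _ := isTopologicalGroup.Build Z fmul_continuous finv_continuous.

Hypothesis p_pr : prime p.

Let finZ : finite_set [set: Z].
Proof. exact: (@finite_finset 'F_p setT). Qed.

Lemma fp_group_pro_p : is_pro_p p Z.
Proof.
split.
- exact: finite_compact.
- rewrite open_hausdorff => a b ab; exists ([set a], [set b]) => /=.
    by rewrite !inE.
  by split=> //; apply/eqP/seteqP; split=> // c [/= -> e]; move: ab; rewrite e eqxx.
- move=> U /nbhs_singleton U1; exists [set 1]; split=> //; last by move=> _ ->.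
  split; first by split=> // x y -> ->; rewrite mulgV.
  by move=> x g ->; rewrite conj1g.
- move=> N [sN _] _.
  (* A subgroup of ['F_p] containing some [a <> 0] contains all its multiples, so [N] has index 1 or
     [p]. *)
  have [[a Na a0]|h] := pselect (exists2 a, N a & a <> 1).
    exists 0%N; have NT : N = setT.
      apply/seteqP; split=> // b _.
      have Nk k : N ((a : 'F_p) *+ k)%R.
        elim: k => [|k IH]; first exact: (sg1 sN).
        by rewrite GRing.mulrS; exact: (sgM sN).
      have -> : b = ((a : 'F_p) *+ (b / a)%R)%R :> 'F_p.
        rewrite -GRing.mulr_natr natr_Zp GRing.mulrC GRing.divfK//.
        by apply/eqP => a1; apply: a0.
      exact: Nk.
    have -> : lcosets N = [set setT].
      apply/seteqP; split=> [_ [x _ <-]|_ ->].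
        apply/seteqP; split=> // b _; exists (x^-1 * b); last by rewrite mulVKg.
        by rewrite NT.
      exists 1 => //; apply/seteqP; split=> // b _; exists b; last by rewrite mul1g.
      by rewrite NT.
    by rewrite expn0 card_set1.
  exists 1%N; have N1 : N = [set 1].
    apply/seteqP; split=> [x Nx|_ ->]; last exact: sg1.
    by apply: contrapT => x1; apply: h; exists x.
  have -> : lcosets N = (fun a => [set a]) @` [set: Z].
    by apply: eq_imagel => x _ /=; rewrite N1 image_set1 mulg1.
  have h1 : ([set: Z] #= `I_p)%card.
    have : ([set: Z] #= `I_(Zp_trunc (pdiv p)).+2)%card := card_esym card_II.
    by rewrite (Fp_cast p_pr).
  rewrite expn1; apply: card_eq_trans h1.
  by apply: inj_card_eq => a b _ _ /seteqP[/(_ a erefl)].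
Qed.

End FpGroup.

(** Linear algebra without a vector space on the side of [T]: a point [y j] acts on the function
    space [X] as the linear form of evaluation at it. Together with [spans] this says that [b] is a
    basis of [X] whose dual basis is given by the points [y]. *)
Definition dual_system (T : Type) (p : nat) (X : set (T -> 'F_p)) d
    (b : 'I_d -> T -> 'F_p) (y : 'I_d -> T) :=
  (forall i, X (b i)) /\ (forall i j, b i (y j) = (i == j)%:R%R).

Definition spans (T : Type) (p : nat) (X : set (T -> 'F_p)) d
    (b : 'I_d -> T -> 'F_p) (y : 'I_d -> T) :=
  forall f, X f -> forall x, f x = (\sum_i f (y i) * b i x)%R.

Section DualSystems.
Variables (T : Type) (p : nat) (X : set (T -> 'F_p)).
Hypothesis p_pr : prime p.
Hypotheses (X0 : X (fun=> 0%R)) (XD : forall a f g, X f -> X g -> X (fun x => (f x + a * g x)%R)).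

Lemma lin_sum d (b : 'I_d -> T -> 'F_p) (c : 'I_d -> 'F_p) : (forall i, X (b i)) ->
  X (fun x => \sum_i c i * b i x)%R.
Proof.
elim: d b c => [|d IH] b c Xb.
  by under eq_fun do rewrite big_ord0.
under eq_fun do rewrite big_ord_recr /=.
exact: (XD _ (IH (fun i => b (widen_ord (leqnSn d) i)) (fun i => c (widen_ord (leqnSn d) i)) _)).
Qed.

Definition separates k (r : 'I_k -> T) :=
  forall f, X f -> (forall i, f (r i) = 0%R) -> forall x, f x = 0%R.

Lemma dual_coef d (b : 'I_d -> T -> 'F_p) y (c : 'I_d -> 'F_p) j : dual_system X b y ->
  (\sum_i c i * b i (y j))%R = c j.
Proof.
move=> [_ by_]; rewrite (bigD1 j)//= by_ eqxx GRing.mulr1 big1 ?GRing.addr0// => i ij.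
by rewrite by_ (negbTE ij) GRing.mulr0.
Qed.

(** Evaluation at the [k] points of [r] embeds the span of [b], which has [p ^ d] elements, into
    ['F_p^k]. *)
Lemma dual_le d (b : 'I_d -> T -> 'F_p) y k (r : 'I_k -> T) :
  dual_system X b y -> separates r -> (d <= k)%N.
Proof.
move=> dby sepr.
pose F (c : {ffun 'I_d -> 'F_p}) : {ffun 'I_k -> 'F_p} :=
  [ffun i => \sum_j c j * b j (r i)]%R.
have injF : injective F.
  move=> c c' /ffunP e; apply/ffunP => j.
  have : forall x, (\sum_j (c j - c' j) * b j x)%R = 0%R.
    apply: sepr; first exact: (lin_sum _ dby.1).
    move=> i; have := e i; rewrite !ffunE => e'.
    under eq_bigr do rewrite GRing.mulrBl.
    by rewrite GRing.sumrB e' GRing.subrr.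
  by move/(_ (y j)); rewrite (dual_coef _ _ dby) => /eqP; rewrite GRing.subr_eq0 => /eqP.
have := leq_card _ injF; rewrite !card_ffun !card_ord (Fp_cast p_pr).
by rewrite leq_exp2l// prime_gt1.
Qed.

(** The difference of [f] and its interpolation in the points [y] lies in [X] and vanishes at these
    points. *)
Lemma separates_spans d (b : 'I_d -> T -> 'F_p) y :
  dual_system X b y -> separates y -> spans X b y.
Proof.
move=> dby sepy f Xf x; apply/eqP; rewrite -GRing.subr_eq0; apply/eqP.
pose g x := (f x - \sum_i f (y i) * b i x)%R.
suff : forall x, g x = 0%R by apply.
apply: sepy => [|j].
  have := XD (-1)%R Xf (lin_sum (fun i => f (y i)) dby.1).
  by congr X; apply: funext => z; rewrite /g GRing.mulN1r.
by rewrite /g (dual_coef _ _ dby) GRing.subrr.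
Qed.

Lemma dual_spans_separates d (b : 'I_d -> T -> 'F_p) y : spans X b y -> separates y.
Proof. by move=> sp f Xf f0 x; rewrite sp// big1// => i _; rewrite f0 GRing.mul0r. Qed.

(** A dual system that does not span can be enlarged by a function and a point where interpolation
    fails. By [dual_le] the size never exceeds [k], so the fuel [m] with [k < d + m] suffices. *)
Lemma dual_exists k (r : 'I_k -> T) : separates r ->
  exists d (b : 'I_d -> T -> 'F_p) y, dual_system X b y /\ spans X b y.
Proof.
move=> sepr.
have H m : forall d (b : 'I_d -> T -> 'F_p) y, (k < d + m)%N -> dual_system X b y ->
    exists d (b : 'I_d -> T -> 'F_p) y, dual_system X b y /\ spans X b y.
  elim: m => [|m IH] d b y kdm dby.
    by move: kdm; rewrite addn0 => /leq_trans/(_ (dual_le dby sepr)); rewrite ltnn.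
  have [sp|nsp] := pselect (spans X b y); first by exists d, b, y.
  have [f [Xf [x fx]]] : exists f, X f /\ exists x, f x <> (\sum_i f (y i) * b i x)%R.
    apply: contrapT => h; apply: nsp => f Xf x; apply: contrapT => fx.
    by apply: h; exists f; split=> //; exists x.
  pose g0 x := (f x - \sum_i f (y i) * b i x)%R.
  have Xg0 : X g0.
    have := XD (-1)%R Xf (lin_sum (fun i => f (y i)) dby.1).
    by congr X; apply: funext => z; rewrite /g0 GRing.mulN1r.
  have g0x : g0 x != 0%R by rewrite GRing.subr_eq0; apply/eqP.
  have g0y j : g0 (y j) = 0%R by rewrite /g0 (dual_coef _ _ dby) GRing.subrr.
  pose g z := ((g0 x)^-1 * g0 z)%R.
  have Xg : X g.
    have := XD (g0 x)^-1%R X0 Xg0; congr X; apply: funext => z; by rewrite GRing.add0r.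
  have gx : g x = 1%R by rewrite /g GRing.mulVf.
  have gy j : g (y j) = 0%R by rewrite /g g0y GRing.mulr0.
  (* Subtracting [b j x * g] makes the old functions vanish at the new point [x]; since [g] vanishes
     at the old points, their values there are unchanged. *)
  pose b' (i : 'I_d.+1) := if unlift ord_max i is Some j then
     (fun z => b j z - b j x * g z)%R else g.
  pose y' (i : 'I_d.+1) := if unlift ord_max i is Some j then y j else x.
  apply: (IH d.+1 b' y'); first by rewrite addSnnS.
  split=> [i|i j].
    rewrite /b'; case: unliftP => [k' _|_//]; have := XD (- b k' x)%R (dby.1 k') Xg.
    by congr X; apply: funext => z; rewrite GRing.mulNr.
  rewrite /b' /y'; case: (unliftP _ i) => [i' ->|->]; case: (unliftP _ j) => [j' ->|->].
  - by rewrite gy GRing.mulr0 GRing.subr0 dby.2 (inj_eq lift_inj).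
  - by rewrite gx GRing.mulr1 GRing.subrr eq_sym (negbTE (neq_lift _ _)).
  - by rewrite gy (negbTE (neq_lift _ _)).
  - by rewrite gx eqxx.
pose b0 (i : 'I_0) : T -> 'F_p := fun=> 0%R.
have [[x _]|nT] := pselect (exists x : T, True).
  by apply: (H k.+1 0%N b0 (fun=> x)); rewrite ?add0n//; split=> -[].
have y0 (i : 'I_0) : T by case: i.
by apply: (H k.+1 0%N b0 y0); rewrite ?add0n//; split=> -[].
Qed.

End DualSystems.

(** * Free pro-p-groups and their first cohomology *)

Section LocallyConstant.
Variables (X : topologicalType) (p : nat).
Implicit Types f g : X -> 'F_p.

Definition locally_constant f := forall a, open (f @^-1` [set a]).

Lemma locally_constant_preim f (A : set 'F_p) : locally_constant f -> open (f @^-1` A).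
Proof.
move=> lf; have -> : f @^-1` A = \bigcup_(a in A) f @^-1` [set a].
  by apply/seteqP; split=> [x Ax|x [a Aa /= ->]//]; exists (f x).
by apply: bigcup_open => a _; exact: lf.
Qed.

Lemma locally_constant2 (h : 'F_p -> 'F_p -> 'F_p) f g :
  locally_constant f -> locally_constant g -> locally_constant (fun x => h (f x) (g x)).
Proof.
move=> lf lg c.
have -> : (fun x => h (f x) (g x)) @^-1` [set c] =
    \bigcup_(u in setT) (f @^-1` [set u] `&` g @^-1` [set v | h u v = c]).
  by apply/seteqP; split=> [x /= e|x [u _ [/= ->]]//]; exists (f x).
apply: bigcup_open => u _; apply: openI => //.
exact: locally_constant_preim.
Qed.

Lemma locally_constant_cst c : locally_constant (fun=> c).
Proof.
move=> a; have [->|ca] := pselect (c = a).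
  by rewrite (_ : _ @^-1` _ = setT); [exact: openT|apply/seteqP].
by rewrite (_ : _ @^-1` _ = set0); [exact: open0|apply/seteqP; split].
Qed.

End LocallyConstant.

Lemma locally_constant_comp (X Y : topologicalType) (p : nat) (f : X -> Y) (g : Y -> 'F_p) :
  continuous f -> locally_constant g -> locally_constant (g \o f).
Proof. by move=> cf lg a; rewrite comp_preimage; move/continuousP: cf; apply. Qed.

Section Chars.
Variables (p : nat) (G : topGroupType).
Implicit Types (f g : G -> 'F_p) (R : set G).

Lemma H1_at1 f : H1 f -> f 1 = 0%R.
Proof.
move=> [_ fM]; have /eqP := fM 1 1.
by rewrite mulg1 -[X in X == _]GRing.addr0 eq_sym (inj_eq (GRing.addrI _)) => /eqP.
Qed.

Lemma H1_V f x : H1 f -> f x^-1 = (- f x)%R.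
Proof.
move=> hf; have := hf.2 x x^-1; rewrite mulgV (H1_at1 hf) => /esym/eqP.
by rewrite GRing.addr_eq0 => /eqP ->; rewrite GRing.opprK.
Qed.

Lemma H1_J f x y : H1 f -> f (x ^ y) = f x.
Proof.
by move=> hf; rewrite conjgE !hf.2 (H1_V _ hf) GRing.addrCA GRing.addNr GRing.addr0.
Qed.

Lemma H1_expg f x k : H1 f -> f (x ^+ k) = (f x *+ k)%R.
Proof.
move=> hf; elim: k => [|k IH]; first by rewrite expg0 (H1_at1 hf).
by rewrite expgS hf.2 IH GRing.mulrS.
Qed.

Lemma H1_0 : H1 (fun _ : G => 0%R : 'F_p).
Proof. by split; [exact: locally_constant_cst|move=> x y; rewrite GRing.addr0]. Qed.

Lemma H1_D (a : 'F_p) f g : H1 f -> H1 g -> H1 (fun x => (f x + a * g x)%R).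
Proof.
move=> [lf fM] [lg gM]; split.
  exact: (locally_constant2 (fun u v => (u + a * v)%R)).
by move=> x y; rewrite fM gM GRing.mulrDr GRing.addrACA.
Qed.

Lemma H1_kernel f : H1 f ->
  [/\ is_normal [set x | f x = 0%R], open [set x | f x = 0%R] & closed [set x | f x = 0%R]].
Proof.
move=> hf; have nK : is_normal [set x | f x = 0%R].
  split; first split.
  - exact: H1_at1.
  - by move=> x y /= fx fy; rewrite hf.2 (H1_V _ hf) fx fy GRing.subr0.
  - by move=> x g /= fx; rewrite H1_J.
have oK : open [set x | f x = 0%R] := hf.1 0%R.
by split=> //; exact: open_subgroup_closed nK.1 oK.
Qed.

(** If [f x] were nonzero, the kernel of [f] would be a maximal closed subgroup, because its index
    is the prime [p], and [x] would have to lie in it. *)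
Lemma H1_kills_frattini f x : prime p -> H1 f -> frattini x -> f x = 0%R.
Proof.
move=> p_pr hf Fx; apply: contrapT => fx.
have [nK oK clK] := H1_kernel hf.
apply: (fx); apply: (Fx [set x | f x = 0%R]); split=> //.
- exact: nK.1.
- move=> e; have : [set x | f x = 0%R] x by rewrite e.
  by move=> fx0; move: fx; rewrite fx0.
- move=> K sK clK' sMK.
  have [[y Ky fy]|h] := pselect (exists2 y, K y & f y <> 0%R); last first.
    left; apply/seteqP; split=> // y Ky; apply: contrapT => fy.
    by apply: h; exists y.
  right; apply/seteqP; split=> // z _.
  have Kyk k : K (y ^+ k).
    by elim: k => [|k IH]; rewrite ?expg0; [exact: sg1|rewrite expgS; exact: sgM].
  have [c ec] : exists c : 'F_p, (c * f y)%R = f z.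
    by exists (f z / f y)%R; rewrite GRing.divfK//; apply/eqP.
  have : K (z * (y ^+ c)^-1).
    apply: sMK => /=; rewrite hf.2 (H1_V _ hf) (H1_expg _ _ hf) -GRing.mulr_natr natr_Zp.
    by rewrite GRing.mulrC ec GRing.subrr.
  by move=> /(sgM sK)/(_ (Kyk c)); rewrite -mulgA mulVg mulg1.
Qed.

End Chars.

Section NormalChars.
Variables (p : nat) (G : sigmaGroupType).
Implicit Types (f g : G -> 'F_p) (R : set G).

Lemma char_at1 R f : is_normal R -> is_char R f -> f 1 = 0%R.
Proof.
move=> nR [_ fM _ _]; have /eqP := fM 1 1 (sg1 nR.1) (sg1 nR.1).
by rewrite mulg1 -[X in X == _]GRing.addr0 eq_sym (inj_eq (GRing.addrI _)) => /eqP.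
Qed.

Lemma char_V R f x : is_normal R -> is_char R f -> f x^-1 = (- f x)%R.
Proof.
move=> nR cf; have [Rx|nRx] := pselect (R x).
  have [_ fM _ _] := cf.
  have := fM x x^-1 Rx (sgV nR.1 Rx); rewrite mulgV (char_at1 nR cf) => /esym/eqP.
  by rewrite GRing.addr_eq0 => /eqP ->; rewrite GRing.opprK.
have [_ _ _ f0] := cf; rewrite !f0 ?GRing.oppr0//.
by move/(sgV nR.1); rewrite invgK.
Qed.

Lemma char_0 R : is_char R (fun _ : G => 0%R : 'F_p).
Proof. by split=> //; [exact: locally_constant_cst|move=> x y _ _; rewrite GRing.addr0]. Qed.

Lemma char_D R (a : 'F_p) f g : is_char R f -> is_char R g ->
  is_char R (fun x => (f x + a * g x)%R).
Proof.
move=> [lf fM fJ f0] [lg gM gJ g0]; split.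
- exact: (locally_constant2 (fun u v => (u + a * v)%R)).
- by move=> x y Rx Ry; rewrite fM// gM// GRing.mulrDr GRing.addrACA.
- by move=> x y Rx; rewrite fJ// gJ.
- by move=> x Rx; rewrite f0// g0// GRing.mulr0 GRing.addr0.
Qed.

Lemma char_kernel R f : is_normal R -> open R -> is_char R f ->
  [/\ is_normal [set x | R x /\ f x = 0%R], open [set x | R x /\ f x = 0%R] &
      closed [set x | R x /\ f x = 0%R]].
Proof.
move=> nR oR cf; have [lf fM fJ f0] := cf.
have nK : is_normal [set x | R x /\ f x = 0%R].
  split; first split.
  - by split; [exact: (sg1 nR.1)|exact: char_at1 nR cf].
  - move=> x y /= [Rx fx] [Ry fy]; split; first exact: nR.1.2.
    by rewrite fM//; [rewrite (char_V _ nR cf) fx fy GRing.subr0|exact: (sgV nR.1)].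
  - by move=> x g /= [Rx fx]; split; [exact: nR.2|rewrite fJ].
have oK : open [set x | R x /\ f x = 0%R] by apply: openI => //; exact: lf.
by split=> //; exact: open_subgroup_closed nK.1 oK.
Qed.

End NormalChars.

Lemma gen_min (G : topGroupType) (S H : set G) :
  is_subgroup H -> closed H -> S `<=` H -> gen S `<=` H.
Proof. by move=> sH clH sSH x; apply. Qed.

Lemma ngen_min (G : topGroupType) (S N : set G) :
  is_normal N -> closed N -> S `<=` N -> ngen S `<=` N.
Proof.
move=> nN clN sSN; apply: gen_min => //; first exact: nN.1.
by move=> _ [x [g [Sx ->]]]; apply: nN.2; exact: sSN.
Qed.

Lemma sub_ngen (G : topGroupType) (S : set G) : S `<=` ngen S.
Proof. by move=> x Sx; apply: sub_gen; exists x, 1; rewrite conjg1. Qed.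

Lemma H1_comp p (G H : topGroupType) (f : G -> H) (g : H -> 'F_p) :
  is_hom f -> H1 g -> H1 (g \o f).
Proof.
move=> [cf fM] [lg gM]; split; first exact: locally_constant_comp.
by move=> x y /=; rewrite fM gM.
Qed.

Lemma hom_image_subgroup (A H : groupType) (f : A -> H) (B : set A) : {morph f : x y / x * y} ->
  is_subgroup B -> is_subgroup (f @` B).
Proof.
move=> fM sB; split; first by exists 1; [exact: sg1|exact: hom1].
move=> _ _ [x Bx <-] [y By <-]; exists (x * y^-1); first exact: sB.2.
by rewrite fM (homV fM).
Qed.

Section H1Surj.
Variables (p : nat) (A B : sigmaGroupType).
Hypotheses (p_pr : prime p) (cA : compact [set: A]) (pB : is_pro_p p B).
Variable f : A -> B.
Hypothesis hf : is_hom f.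

(** The dual form of the Burnside basis theorem: the image is closed by compactness, and if it were
    proper a nonzero class in H1 would vanish on it. *)
Lemma surj_of_H1 :
  (forall h : B -> 'F_p, H1 h -> (forall x, h (f x) = 0%R) -> forall y, h y = 0%R) ->
  forall y, exists x, f x = y.
Proof.
move=> h y; apply: contrapT => ny; have [_ hB _ _] := pB; have [cf fM] := hf.
have [||e|k [hk kf [z kz]]] := profinite_maximal_char pB p_pr
    (H := f @` setT) (hom_image_subgroup fM _).
- by split.
- exact: closed_image.
- have : (f @` setT) y by rewrite e.
  by move=> [x _ ex]; apply: ny; exists x.
- by case: kz; apply: h => // x; apply: kf; exists x.
Qed.

Lemma H1_descend (g : A -> 'F_p) : (forall y, exists x, f x = y) -> H1 g ->
  (forall x, f x = 1 -> g x = 0%R) -> exists h : B -> 'F_p, H1 h /\ forall x, h (f x) = g x.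
Proof.
move=> sf hg gk; have [_ hB _ _] := pB; have [cf fM] := hf.
pose s y := xget 1 [set x | f x = y].
have sP y : f (s y) = y by have [x ?] := sf y; apply: (@xgetPex _ 1 [set x | f x = y]); exists x.
have gE x : g (s (f x)) = g x.
  have : g (x^-1 * s (f x)) = 0%R by apply/gk; rewrite fM (homV fM) sP mulVg.
  by rewrite hg.2 (H1_V _ hg) GRing.addrC => /eqP; rewrite GRing.subr_eq0 => /eqP.
exists (g \o s); split=> //; split=> [a|x y].
  have -> : (g \o s) @^-1` [set a] = ~` (f @` (g @^-1` (~` [set a]))).
    apply/seteqP; split=> [y /= ga [x gx e]|y /= h].
      by apply: gx; rewrite /= -gE e.
    by apply: contrapT => ga; apply: h; exists (s y).
  apply: closed_openC; apply: closed_image => //.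
  by rewrite -preimage_setC; apply: open_closedC; exact: hg.1.
have [u <-] := sf x; have [v <-] := sf y.
by rewrite /= -fM !gE hg.2.
Qed.

End H1Surj.

Section Free.
Variables (p n : nat) (F : sigmaFreeProP p n).
Hypothesis p_pr : prime p.
Local Notation x_ := (@free_gen p n F).
Let pF := free_pro_p F.
Let cF : compact [set: F]. Proof. by case: pF. Qed.

Lemma free_hom_eq (H : topGroupType) (f g : F -> H) : is_pro_p p H ->
  is_hom f -> is_hom g -> (forall i, f (x_ i) = g (x_ i)) -> f = g.
Proof.
move=> pH hf hg e; have [h [_ hu]] := free_univ F (fun i => g (x_ i)) pH.
by rewrite -(hu f)// -(hu g).
Qed.

(** Equivariance comes from uniqueness: [f] and its conjugate by [sigma] agree on the generators. *)
Lemma free_sigma_hom (H : sigmaGroupType) (h : 'I_n -> H) : is_pro_p p H ->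
  (forall i, minus_set (h i)) -> exists f : F -> H, is_sigma_hom f /\ forall i, f (x_ i) = h i.
Proof.
move=> pH hm; have [f [[[cf fM] fx] _]] := free_univ F h pH.
exists f; split=> //; split=> // x.
have e : sigma \o f \o sigma = f.
  apply: free_hom_eq => //; first split.
  - by move=> y; apply: continuous_comp; first exact: sigma_continuous;
      apply: continuous_comp; [exact: cf|exact: sigma_continuous].
  - by move=> y z /=; rewrite sigmaM fM sigmaM.
  - by move=> i /=; rewrite free_sigma (homV fM) fx (homV (@sigmaM H)) hm invgK.
by rewrite -{1}e /= sigmaK.
Qed.

(** Projectivity of the free object: the images of the generators are anti-invariant, and
    [minus_lift] lifts them to anti-invariant elements of [A]. *)
Lemma free_sigma_lift (A B : sigmaGroupType) (al : A -> B) (be : F -> B) : (2 < p)%N ->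
  is_pro_p p A -> is_pro_p p B -> is_sigma_hom al -> (forall y, exists x, al x = y) ->
  is_sigma_hom be -> exists ga : F -> A, is_sigma_hom ga /\ forall x, al (ga x) = be x.
Proof.
move=> p2 pA pB hal sal hbe; have [_ hB _ _] := pB.
have ex i : exists a : A, minus_set a /\ al a = be (x_ i).
  have [y ey] := sal (be (x_ i)).
  have my : minus_set (al y).
    by rewrite ey /minus_set /= -hbe.2 free_sigma (homV hbe.1.2).
  have [a ma ea] := minus_lift p_pr p2 pA hB hal my.
  by exists a; rewrite ea.
have [ga [hga gx]] := free_sigma_hom pA (fun i => (projT2 (cid (ex i))).1).
exists ga; split=> // x.
have -> // : be = al \o ga.
apply: (free_hom_eq pB hbe.1 (sigma_hom_comp hga hal).1) => i /=.
by rewrite gx; case: cid => a [].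
Qed.

Lemma free_H1_eq0 (f : F -> 'F_p) : H1 f -> (forall i, f (x_ i) = 0%R) -> forall x, f x = 0%R.
Proof.
move=> hf fx x; pose f' x : fp_group p := f x.
have hom (g : F -> 'F_p) : H1 g -> is_hom (g : F -> fp_group p).
  by move=> [lg gM]; split=> //; apply/continuousP => A _; exact: locally_constant_preim.
have -> // : f = (fun=> 0%R).
apply: (@free_hom_eq (fp_group p) f (fun=> 0%R)) => //.
- exact: fp_group_pro_p.
- exact: hom.
- exact/hom/H1_0.
Qed.

Lemma free_H1_ex (c : 'I_n -> 'F_p) : exists f : F -> 'F_p, H1 f /\ forall i, f (x_ i) = c i.
Proof.
have [f [[[cf fM] fx] _]] := free_univ F (c : 'I_n -> fp_group p) (fp_group_pro_p p_pr).
exists f; split=> //; split=> // a.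
by move/continuousP: cf => /(_ [set a]); apply.
Qed.

Lemma free_H1_sigma (f : F -> 'F_p) x : H1 f -> f (sigma x) = (- f x)%R.
Proof.
move=> hf; apply/eqP; rewrite -GRing.addr_eq0; apply/eqP.
have hs : H1 (f \o sigma) by apply: H1_comp => //; exact: sigma_is_hom.
have := H1_D 1%R hs hf; move/free_H1_eq0 => /(_ _ x) /=; rewrite GRing.mul1r; apply=> i.
by rewrite free_sigma (H1_V _ hf) GRing.mul1r GRing.addNr.
Qed.

Definition free_basis (i : 'I_n) : F -> 'F_p :=
  projT1 (cid (free_H1_ex (fun j => (i == j)%:R%R))).

Lemma free_basis_dual : dual_system (@H1 p F) free_basis x_.
Proof. by split=> [i|i j]; rewrite /free_basis; case: cid => f [hf e] //=. Qed.

Lemma free_basis_separates : separates (@H1 p F) x_.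
Proof. by move=> f hf; exact: free_H1_eq0. Qed.

Lemma free_basis_spans : spans (@H1 p F) free_basis x_.
Proof.
exact: (separates_spans (@H1_0 p F) (@H1_D p F) free_basis_dual free_basis_separates).
Qed.

End Free.

(** * The conditions on the relators *)

Lemma H1_dim_of_dual p (G : topGroupType) n (b : 'I_n -> G -> 'F_p) y :
  dual_system (@H1 p G) b y -> spans (@H1 p G) b y -> H1_dim p G n.
Proof.
move=> dby sp; exists b; split; first exact: dby.1.
move=> f hf; exists [ffun i => f (y i)]; split.
  by apply: funext => x; rewrite sp//; apply: eq_bigr => i _; rewrite ffunE.
move=> c ->; apply/ffunP => j; rewrite ffunE; exact: (dual_coef _ _ dby).
Qed.

Lemma H1_dim_transfer p (A B : topGroupType) n (al : A -> B) : is_hom al ->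
  (forall h : B -> 'F_p, H1 h -> (forall x, h (al x) = 0%R) -> forall y, h y = 0%R) ->
  (forall g : A -> 'F_p, H1 g -> exists h, H1 h /\ forall x, h (al x) = g x) ->
  H1_dim p A n -> H1_dim p B n.
Proof.
move=> hal inj surj [b [hb bu]].
pose b' i := projT1 (cid (surj _ (hb i))).
have hb' i : H1 (b' i) by rewrite /b'; case: cid => g [].
have b'E i x : b' i (al x) = b i x by rewrite /b'; case: cid => g [].
exists b'; split=> // f hf.
have [c [fc cu]] := bu _ (H1_comp hal hf).
exists c; split=> [|c' ec'].
  apply: funext => y; apply/eqP; rewrite -GRing.subr_eq0; apply/eqP.
  move: y; apply: inj => [|x].
    have := H1_D (-1)%R hf (lin_sum (@H1_0 p B) (@H1_D p B) c hb').
    by congr H1; apply: funext => z; rewrite GRing.mulN1r.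
  have /= -> := congr1 (fun g => g x) fc.
  by apply/eqP; rewrite GRing.subr_eq0; apply/eqP/eq_bigr => i _; rewrite b'E.
apply: cu; apply: funext => x /=; rewrite ec'.
by apply: eq_bigr => i _; rewrite b'E.
Qed.

Section FreeH1.
Variables (p n : nat) (F : sigmaFreeProP p n).
Hypotheses (p_pr : prime p) (p_gt2 : (2 < p)%N).
Local Notation x_ := (@free_gen p n F).
Let pF := free_pro_p F.
Let cF : compact [set: F]. Proof. by case: pF. Qed.

Lemma free_H1_dim : H1_dim p F n.
Proof. exact: (H1_dim_of_dual (@free_basis_dual p n F p_pr) (@free_basis_spans p n F p_pr)). Qed.

(** Pullback along [al] is an injective map between two spaces with [p ^ n] elements, hence onto.
    The count is made on coefficient vectors, through the values at the free generators. *)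
Lemma free_H1_pullback (B : topGroupType) (al : F -> B) : is_hom al -> H1_dim p B n ->
  (forall h : B -> 'F_p, H1 h -> (forall x, h (al x) = 0%R) -> forall y, h y = 0%R) ->
  forall g : F -> 'F_p, H1 g -> exists h, H1 h /\ forall x, h (al x) = g x.
Proof.
move=> hal [b [hb bu]] inj g hg.
pose fc (c : {ffun 'I_n -> 'F_p}) y := (\sum_i c i * b i y)%R.
have hfc c : H1 (fc c) by exact: (lin_sum (@H1_0 p B) (@H1_D p B)).
pose T (c : {ffun 'I_n -> 'F_p}) : {ffun 'I_n -> 'F_p} := [ffun i => fc c (al (x_ i))].
have eqc c (g' : F -> 'F_p) : H1 g' -> (forall i, fc c (al (x_ i)) = g' (x_ i)) ->
    forall x, fc c (al x) = g' x.
  move=> hg' e x; apply/eqP; rewrite -GRing.subr_eq0; apply/eqP.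
  have := H1_D (-1)%R (H1_comp hal (hfc c)) hg'.
  move/(free_H1_eq0 p_pr) => /(_ _ x) /=; rewrite GRing.mulN1r; apply=> i.
  by rewrite GRing.mulN1r e GRing.subrr.
have injT : injective T.
  move=> c c' /ffunP e.
  have ecc : forall y, fc c y = fc c' y.
    move=> y; apply/eqP; rewrite -GRing.subr_eq0; apply/eqP.
    have := inj _ (H1_D (-1)%R (hfc c) (hfc c')) _ y; rewrite GRing.mulN1r; apply=> x.
    rewrite GRing.mulN1r; apply/eqP; rewrite GRing.subr_eq0; apply/eqP.
    apply: (eqc c _ (H1_comp hal (hfc c'))) => i /=.
    by have := e i; rewrite !ffunE.
  have [c0 [_ cu]] := bu _ (hfc c).
  by rewrite -(cu c)// -(cu c')//; apply: funext.
have [T' _ T'K] := injF_bij injT.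
exists (fc (T' [ffun i => g (x_ i)])); split; first exact: hfc.
apply: eqc => // i.
by have /ffunP/(_ i) := T'K [ffun i => g (x_ i)]; rewrite !ffunE.
Qed.

(* A section of [phi], which exists by projectivity, is surjective for the same
   reason as [phi]. *)
Lemma free_endo_iso (phi : F -> F) : is_sigma_hom phi ->
  (forall g : F -> 'F_p, H1 g -> (forall x, g (phi x) = 0%R) -> forall x, g x = 0%R) ->
  is_sigma_iso phi.
Proof.
move=> hphi inj; have [_ hF _ _] := pF.
have sphi := surj_of_H1 p_pr cF pF hphi.1 inj.
have hid : is_sigma_hom (@id F) by split=> //; split=> // x; exact: cvg_id.
have [s [hs phis]] := free_sigma_lift p_pr p_gt2 pF pF hphi sphi hid.
have ss : forall y, exists x, s x = y.
  apply: (surj_of_H1 p_pr cF pF hs.1) => g hg gs.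
  have [h [hh e]] := free_H1_pullback hphi.1 free_H1_dim inj hg.
  have h0 x : h x = 0%R by rewrite -[x]phis e gs.
  by move=> x; rewrite -e h0.
split=> //; exists s; split=> // x.
by have [y <-] := ss x; rewrite phis.
Qed.

(** Projectivity writes [pi'] as [pi \o phi]. Both surjections identify H1 of [H] with H1 of [F], so
    [phi] is injective on H1, hence an automorphism, and it preserves [D]. *)
Lemma img_unique (D : sigmaNormal F)
  (D_aut : forall f : F -> F, is_sigma_iso f -> f @` nset D = nset D)
  (H : sigmaGroupType) (pi pi' : F -> H) : is_pro_p p H -> H1_dim p H n ->
  is_sigma_hom pi -> (forall y, exists x, pi x = y) ->
  is_sigma_hom pi' -> (forall y, exists x, pi' x = y) -> pi @` nset D = pi' @` nset D.
Proof.
move=> pH dH hpi spi hpi' spi'.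
have inj (rho : F -> H) : (forall y, exists x, rho x = y) -> forall h : H -> 'F_p, H1 h ->
    (forall x, h (rho x) = 0%R) -> forall y, h y = 0%R.
  by move=> srho h _ h0 y; have [x <-] := srho y.
have [phi [hphi e]] := free_sigma_lift p_pr p_gt2 pF pH hpi spi hpi'.
have iphi : is_sigma_iso phi.
  apply: free_endo_iso => // g hg g0 x.
  have [h [hh eh]] := free_H1_pullback hpi.1 dH (inj _ spi) hg.
  rewrite -eh; apply: (inj _ spi') => // z.
  by rewrite -e eh g0.
rewrite -[X in pi @` X](D_aut _ iphi) image_comp.
by congr image; apply: funext => x /=; rewrite e.
Qed.

End FreeH1.

Definition ker_of (A B : sigmaGroupType) (f : A -> B) : set A := [set x | f x = 1].

Lemma ker_of_normal (A B : sigmaGroupType) (f : A -> B) : is_sigma_hom f -> is_normal (ker_of f).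
Proof.
move=> [[_ fM] _]; rewrite /ker_of; split; first split.
- exact: (hom1 fM).
- by move=> x y /= fx fy; rewrite fM (homV fM) fx fy mulgV.
- by move=> x g /= fx; rewrite (homJ fM) fx conj1g.
Qed.

Lemma ker_of_open (A B : sigmaGroupType) (f : A -> B) : (forall C : set B, open C) ->
  sigma_surj f -> open (ker_of f).
Proof.
by move=> oB sf; have := sf.1.1.1; move/continuousP => /(_ [set 1]); apply; exact: oB.
Qed.

Section Event.
Variables (p n m : nat) (F : sigmaFreeProP p n) (E : sigmaFreeProP p m).
Hypotheses (p_pr : prime p) (p_gt2 : (2 < p)%N).
Variables (D : sigmaNormal F) (D_frattini : nset D `<=` @frattini F).
Hypothesis D_aut : forall f : F -> F, is_sigma_iso f -> f @` nset D = nset D.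
Variables (Q : sigmaGroupType) (q : F -> Q).
Hypotheses (pQ : is_pro_p p Q) (oQ : forall A : set Q, open A) (sq : sigma_surj q).
Hypothesis qD : forall d, nset D d -> q d = 1.
Hypothesis q_H1 : forall g : F -> 'F_p, H1 g -> forall x, q x = 1 -> g x = 0%R.
Variables (rel : set E) (S : sigmaNormal E).
Hypothesis SE : nset S = ngen rel.

Let pE := free_pro_p E.
Let cE : compact [set: E]. Proof. by case: pE. Qed.
Let cF : compact [set: F]. Proof. by case: (free_pro_p F). Qed.
Let clS : closed (nset S). Proof. by rewrite SE; exact: gen_closed. Qed.
Let pH : is_pro_p p (quot S). Proof. exact: quot_pro_p. Qed.
Let kap := coset S.
Let hkap : is_sigma_hom kap := coset_sigma_hom S.

Variables (th : E -> Q) (tau : F -> E).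
Hypotheses (sth : sigma_surj th) (htau : is_sigma_hom tau) (thtau : forall x, th (tau x) = q x).

Definition event_chars : set (E -> 'F_p) :=
  [set f | is_char (ker_of th) f /\ forall d, nset D d -> f (tau d) = 0%R].

(* Dually: [rel] and [tau(D)] generate [ker th] as a normal subgroup. *)
Definition relators_generate := (forall x, rel x -> th x = 1) /\
  forall f, event_chars f -> (forall x, rel x -> f x = 0%R) -> forall x, f x = 0%R.

(** In contrast to [relators_generate] this does not involve [tau], so its equivalence with that
    condition leaves the lift free to choose. *)
Definition relators_present := H1_dim p (quot S) n /\
  exists pi : F -> quot S, sigma_surj pi /\
    forall x, th x = 1 <-> (pi @` nset D) (kap x).

Let nR := ker_of_normal sth.1.

Let oR := ker_of_open oQ sth.
Let clR := open_subgroup_closed nR.1 oR.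

Let kap_rel x : rel x -> kap x = 1.
Proof. by move=> rx; apply/coset1P; rewrite SE; exact: sub_ngen. Qed.

Lemma sub_ngen_rel (N : set E) : is_normal N -> closed N -> rel `<=` N -> nset S `<=` N.
Proof. by move=> nN clN rN; rewrite SE; exact: ngen_min. Qed.

Lemma split_tau x : exists y z, [/\ x = tau y * z & th z = 1].
Proof.
have [y ey] := sq.2 (th x); exists y, ((tau y)^-1 * x); split; first by rewrite mulVKg.
by rewrite sth.1.1.2 (homV sth.1.1.2) thtau ey mulVg.
Qed.

Lemma hom_pi : is_sigma_hom (kap \o tau). Proof. exact: sigma_hom_comp. Qed.

Lemma H1_zero_of_ker (h : quot S -> 'F_p) : H1 h -> (forall x, h (kap (tau x)) = 0%R) ->
  (forall x, th x = 1 -> h (kap x) = 0%R) -> forall y, h y = 0%R.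
Proof.
move=> hh ht hR y; have [x <-] := coset_surj y.
have [u [z [-> tz]]] := split_tau x.
by rewrite -/kap hkap.1.2 hh.2 ht hR// GRing.addr0.
Qed.

Lemma img_closed_normal : (forall y, exists x, (kap \o tau) x = y) ->
  is_normal (kap @^-1` ((kap \o tau) @` nset D)) /\ (closed (nset D) ->
  closed (kap @^-1` ((kap \o tau) @` nset D))).
Proof.
move=> spi; have nI := img_normal (SigmaSurj hom_pi spi) D.
split; first exact: normal_preim.
move=> clD; have [_ hH _ _] := pH.
have : continuous kap := hkap.1.1.
move/continuous_closedP; apply; apply: closed_image => //; exact: hom_pi.1.1.
Qed.

(** The required surjection is [kap \o tau]. By duality the relators and [tau(D)] normally generate
    [ker th], so a class in H1 of the quotient that vanishes on the image of [tau] vanishes on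
    [ker th] too, hence everywhere. *)
Lemma generates_presents : closed (nset D) -> relators_generate -> relators_present.
Proof.
move=> clD [relR sepA].
have ngenR : ngen (rel `|` tau @` nset D) = ker_of th.
  apply: contrapT => neq.
  have sub : ngen (rel `|` tau @` nset D) `<=` ker_of th.
    apply: ngen_min => // x [/relR//|[d Dd <-]]; by rewrite /ker_of /= thtau qD.
  have [f [cf fS [x Rx []]]] := profinite_normal_char pE p_pr nR oR
    (ngen_normal _) (@gen_closed _ _) sub neq.
  apply: sepA => [|y ry]; first split=> // d Dd; apply: fS; apply: sub_ngen.
  - by right; exists d.
  - by left.
have inj : forall h : quot S -> 'F_p, H1 h -> (forall x, h ((kap \o tau) x) = 0%R) ->
    forall y, h y = 0%R.
  move=> h hh ht; apply: H1_zero_of_ker => // x; rewrite -[th x = 1]/(ker_of th x) -ngenR.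
  have [nK oK clK] := H1_kernel (H1_comp hkap.1 hh).
  apply: (ngen_min nK clK) => y [ry|[d Dd <-]] /=; last exact: ht.
  by rewrite kap_rel// (H1_at1 hh).
have spi := surj_of_H1 p_pr cF pH hom_pi.1 inj.
split.
  apply: (H1_dim_transfer hom_pi.1 inj _ (free_H1_dim F p_pr)) => g hg.
  (* The class [g] descends to [Q] along [q]; its pullback along [th] kills the relators and so
     descends to [quot S]. *)
  have [g' [hg' eg]] := H1_descend cF pQ sq.1.1 sq.2 hg (q_H1 hg).
  have [|h [hh eh]] := H1_descend cE pH hkap.1 (@coset_surj _ _) (H1_comp sth.1.1 hg').
    have [nK oK clK] := H1_kernel (H1_comp sth.1.1 hg').
    move=> x /coset1P; apply: (sub_ngen_rel nK clK) => y ry /=.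
    by rewrite relR// (H1_at1 hg').
  by exists h; split=> // x /=; rewrite eh /= thtau eg.
exists (kap \o tau); split; first by split=> //; exact: hom_pi.
have [nI clI] := img_closed_normal spi.
move=> x; split=> [tx|[d Dd /= e]].
  have : ngen (rel `|` tau @` nset D) x by rewrite ngenR.
  apply: (ngen_min nI (clI clD)) => y [ry|[d Dd <-]] /=; last by exists d.
  exists 1; first exact: (sg1 (nset_normal D).1).
  by rewrite (kap_rel ry); exact: (hom1 hom_pi.1.2).
move/coset_eq/(sub_ngen_rel nR clR relR): e.
by rewrite /ker_of /= sth.1.1.2 (homV sth.1.1.2) thtau qD// invg1 mul1g.
Qed.

(** The given [pi] is unrelated to [tau]. Since [D] lies in the Frattini subgroup, classes in H1
    vanish on [pi(D)], which makes [kap \o tau] surjective as well; [img_unique] then identifies the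
    two images of [D]. *)
Lemma presents_generates : relators_present -> relators_generate.
Proof.
move=> [dH [pi [spi' e]]].
have relR x : rel x -> th x = 1.
  move=> rx; apply/e; exists 1; first exact: (sg1 (nset_normal D).1).
  by rewrite (kap_rel rx) (hom1 spi'.1.1.2).
split=> // f [cf fD] frel.
have inj : forall h : quot S -> 'F_p, H1 h -> (forall x, h ((kap \o tau) x) = 0%R) ->
    forall y, h y = 0%R.
  move=> h hh ht; apply: H1_zero_of_ker => // x /e[d Dd <-].
  exact: (H1_kills_frattini p_pr (H1_comp spi'.1.1 hh)) (D_frattini Dd).
have spi := surj_of_H1 p_pr cF pH hom_pi.1 inj.
have eD := img_unique p_pr p_gt2 D_aut pH dH hom_pi spi spi'.1 spi'.2.
have [nK oK clK] := char_kernel nR oR cf.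
have SK : nset S `<=` [set x | ker_of th x /\ f x = 0%R].
  by apply: sub_ngen_rel => // x rx; split; [exact: relR|exact: frel].
move=> x; have [_ fM _ f0] := cf.
have [tx|ntx] := pselect (th x = 1); last exact: f0.
have := proj1 (e x) tx; rewrite -eD => -[d Dd /= /coset_eq/SK[Rdx fdx]].
have -> : x = tau d * ((tau d)^-1 * x) by rewrite mulVKg.
by rewrite fM// ?fD ?fdx ?GRing.addr0// /ker_of /= thtau qD.
Qed.

End Event.

(** * The space of characters of the kernel *)

Section JoinDual.
Variables (T : Type) (p : nat) (X : set (T -> 'F_p)).

Definition join (U : Type) d1 d2 (u1 : 'I_d1 -> U) (u2 : 'I_d2 -> U) (i : 'I_(d1 + d2)) : U :=
  match fintype.split i with inl j => u1 j | inr j => u2 j end.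

Lemma join_dual d1 d2 (b1 : 'I_d1 -> T -> 'F_p) y1 (b2 : 'I_d2 -> T -> 'F_p) y2 :
  dual_system X b1 y1 -> dual_system X b2 y2 ->
  (forall i j, b1 i (y2 j) = 0%R) -> (forall i j, b2 i (y1 j) = 0%R) ->
  dual_system X (join b1 b2) (join y1 y2).
Proof.
move=> [X1 d11] [X2 d22] d12 d21; split=> [i|i j].
  by rewrite /join; case: fintype.split.
rewrite /join -(inj_eq (can_inj fintype.splitK) i j).
by case: (fintype.split i) => i'; case: (fintype.split j) => j'.
Qed.

Lemma join_separates d1 d2 (y1 : 'I_d1 -> T) (y2 : 'I_d2 -> T) :
  (forall f, X f -> (forall j, f (y1 j) = 0%R) -> (forall j, f (y2 j) = 0%R) ->
     forall x, f x = 0%R) -> separates X (join y1 y2).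
Proof.
move=> h f Xf f0; apply: h => // j.
  by have := f0 (unsplit (inl j)); rewrite /join unsplitK.
by have := f0 (unsplit (inr j)); rewrite /join unsplitK.
Qed.

End JoinDual.

Section Split.
Variables (p n m : nat) (F : sigmaFreeProP p n) (E : sigmaFreeProP p m).
Hypotheses (p_pr : prime p) (p_gt2 : (2 < p)%N).
Variables (D : sigmaNormal F) (Q : sigmaGroupType) (q : F -> Q).
Hypotheses (pQ : is_pro_p p Q) (oQ : forall A : set Q, open A) (sq : sigma_surj q).
Hypothesis qD : forall d, nset D d -> q d = 1.
Hypothesis q_H1 : forall g : F -> 'F_p, H1 g -> forall x, q x = 1 -> g x = 0%R.
Variable th : E -> Q.
Hypothesis sth : sigma_surj th.

Let pE := free_pro_p E.
Let pF := free_pro_p F.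
Let cE : compact [set: E]. Proof. by case: pE. Qed.
Let cF : compact [set: F]. Proof. by case: pF. Qed.

(* [lam \o tau] is bijective for any two lifts; absorbing its inverse into [tau]
   makes [lam] a retraction. *)
Lemma split_exists : exists (tau : F -> E) (lam : E -> F),
  [/\ is_sigma_hom tau, is_sigma_hom lam, forall x, lam (tau x) = x,
      forall x, th (tau x) = q x & forall x, q (lam x) = th x].
Proof.
have [lam [hlam elam]] := free_sigma_lift p_pr p_gt2 pF pQ sq.1 sq.2 sth.1.
have [tau [htau etau]] := free_sigma_lift p_pr p_gt2 pE pQ sth.1 sth.2 sq.1.
have [_ [s [hs es1 es2]]] : is_sigma_iso (lam \o tau).
  apply: (free_endo_iso p_pr p_gt2 (sigma_hom_comp htau hlam)) => g hg g0 x.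
  have [g' [hg' eg]] := H1_descend cF pQ sq.1.1 sq.2 hg (q_H1 hg).
  by rewrite -eg -etau -elam eg; exact: g0.
have qs x : q (s x) = q x by rewrite -[in RHS](es2 x) /= elam etau.
exists (tau \o s), lam; split=> //; first exact: sigma_hom_comp.
by move=> x /=; rewrite etau.
Qed.

Variables (tau : F -> E) (lam : E -> F).
Hypotheses (htau : is_sigma_hom tau) (hlam : is_sigma_hom lam).
Hypotheses (lamtau : forall x, lam (tau x) = x) (thtau : forall x, th (tau x) = q x)
  (qlam : forall x, q (lam x) = th x).

Let nR := ker_of_normal sth.1.
Let oR : open (ker_of th) := ker_of_open oQ sth.
Let nB := ker_of_normal sq.1.

(** The analogue of [event_chars] with [tau] the identity of [F] and [th] replaced by [q]. For
    [q = q_D] its dimension is [m_{D,G}], see [m_D_dim]. *)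
Definition base_chars : set (F -> 'F_p) :=
  [set g | is_char (ker_of q) g /\ forall d, nset D d -> g d = 0%R].

Lemma char_pullback (A B : sigmaGroupType) (f : A -> B) (R : set B) (R' : set A) (g : B -> 'F_p) :
  is_hom f -> (forall x, R' x <-> R (f x)) -> is_char R g -> is_char R' (g \o f).
Proof.
move=> [cf fM] e [lg gM gJ g0]; split.
- exact: locally_constant_comp.
- by move=> x y /e Rx /e Ry /=; rewrite fM gM.
- by move=> x y /e Rx /=; rewrite (homJ fM) gJ.
- by move=> x h /=; apply: g0 => /e.
Qed.

Lemma base_to_event g : base_chars g -> event_chars D th tau (g \o lam).
Proof.
move=> [cg gD]; split; last by move=> d Dd /=; rewrite lamtau gD.
by apply: char_pullback cg; [exact: hlam.1|move=> x; rewrite /ker_of /= qlam].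
Qed.

Lemma event_to_base f : event_chars D th tau f -> base_chars (f \o tau).
Proof.
move=> [cf fD]; split; last by move=> d Dd /=; rewrite fD.
by apply: char_pullback cf; [exact: htau.1|move=> x; rewrite /ker_of /= thtau].
Qed.

Lemma event_chars0 : event_chars D th tau (fun=> 0%R).
Proof. by split=> //; exact: char_0. Qed.

Lemma event_charsD a f g : event_chars D th tau f -> event_chars D th tau g ->
  event_chars D th tau (fun x => (f x + a * g x)%R).
Proof.
move=> [cf fD] [cg gD]; split; first exact: char_D.
by move=> d Dd; rewrite fD// gD// GRing.mulr0 GRing.addr0.
Qed.

Lemma base_chars0 : base_chars (fun=> 0%R).
Proof. by split=> //; exact: char_0. Qed.

Lemma base_charsD a f g : base_chars f -> base_chars g ->
  base_chars (fun x => (f x + a * g x)%R).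
Proof.
move=> [cf fD] [cg gD]; split; first exact: char_D.
by move=> d Dd; rewrite fD// gD// GRing.mulr0 GRing.addr0.
Qed.

(* As [lam] is a retraction of [tau], these are the characters of [E] that factor
   through [ver], the projection to [ker lam]. *)
Definition vertical : set (E -> 'F_p) := [set h | H1 h /\ forall x, h (tau x) = 0%R].

Let ver (z : E) := z * (tau (lam z))^-1.

Let ver_ker z : ker_of th (ver z).
Proof. by rewrite /ker_of /= sth.1.1.2 (homV sth.1.1.2) thtau qlam mulgV. Qed.

Let lam_ver z : lam (ver z) = 1.
Proof. by rewrite /ver hlam.1.2 (homV hlam.1.2) lamtau mulgV. Qed.

Let ver_H1 (h : E -> 'F_p) z : vertical h -> h (ver z) = h z.
Proof. by move=> [hh ht]; rewrite /ver hh.2 (H1_V _ hh) ht GRing.subr0. Qed.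

(** H1 of [E] is the sum of the pullback of H1 of [F] along [lam] and of [vertical]. Joining dual
    systems of both gives one that is separated by its own points, and comparison with the [m] free
    generators of [E] yields the dimension. *)
Lemma vertical_dual : exists (b : 'I_(m - n) -> E -> 'F_p) (z : 'I_(m - n) -> E),
  (n <= m)%N /\ dual_system vertical b z /\ spans vertical b z.
Proof.
have ver0 : vertical (fun=> 0%R) by split=> //; exact: H1_0.
have verD a f g : vertical f -> vertical g -> vertical (fun x => (f x + a * g x)%R).
  move=> [hf ft] [hg gt]; split; first exact: H1_D.
  by move=> x; rewrite ft gt GRing.mulr0 GRing.addr0.
have sepv : separates vertical (@free_gen p m E).
  by move=> f [hf _]; exact: free_H1_eq0.
have [d [b [z [dbz spz]]]] := dual_exists p_pr ver0 verD sepv.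
suff emd : m = (n + d)%N.
  have -> : (m - n = d)%N by rewrite emd addKn.
  exists b, z; split=> //.
  by apply: (leq_trans (leq_addr d n)); rewrite -emd.
have dj : dual_system (@H1 p E) (join (fun i => @free_basis p n F p_pr i \o lam) b)
    (join (tau \o @free_gen p n F) (ver \o z)).
  have [hb0 d0] := @free_basis_dual p n F p_pr; have [hb db] := dbz.
  apply: join_dual.
  - by split=> [i|i j] /=; [exact: (H1_comp hlam.1)|rewrite lamtau d0].
  - by split=> [i|i j] /=; [exact: (hb i).1|rewrite ver_H1//].
  - by move=> i j /=; rewrite lam_ver (H1_at1 (hb0 i)).
  - by move=> i j /=; rewrite (hb i).2.
have sj : separates (@H1 p E) (join (tau \o @free_gen p n F) (ver \o z)).
  apply: join_separates => f hf f1 f2.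
  have vf : vertical f.
    split=> // x.
    by have := free_H1_eq0 p_pr (H1_comp htau.1 hf); apply.
  apply: (dual_spans_separates spz vf) => j.
  by rewrite -(ver_H1 _ vf); exact: f2.
apply/eqP; rewrite eqn_leq.
rewrite (dual_le p_pr (@H1_0 p E) (@H1_D p E) (@free_basis_dual p m E p_pr) sj).
by rewrite (dual_le p_pr (@H1_0 p E) (@H1_D p E) dj (@free_basis_separates p m E p_pr)).
Qed.

Definition restrict_char (R : set E) (h : E -> 'F_p) : E -> 'F_p :=
  fun x => if `[< R x >] then h x else 0%R.

Lemma restrict_charE (R : set E) (h : E -> 'F_p) x : R x -> restrict_char R h x = h x.
Proof. by move=> Rx; rewrite /restrict_char; case: asboolP. Qed.

Lemma restrict_is_char (R : set E) (h : E -> 'F_p) : is_normal R -> open R -> H1 h ->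
  is_char R (restrict_char R h).
Proof.
move=> nR' oR' hh; split.
- pose ind x : 'F_p := if `[< R x >] then 1%R else 0%R.
  have li : locally_constant ind.
    have clR' := open_subgroup_closed nR'.1 oR'.
    have li1 : open (~` R) by exact: closed_openC.
    move=> a; have -> : ind @^-1` [set a] = (R `&` [set _ | a = 1%R]) `|` (~` R `&` [set _ | a = 0%R]).
      apply/seteqP; rewrite /ind; split=> x /=.
        by case: asboolP => Rx <-; [left|right].
      by case=> -[Rx ->]; case: asboolP.
    have oP (P : Prop) : open [set _ : E | P].
      have [hP|nP] := pselect P.
        by rewrite (_ : [set _ | _] = setT); [exact: openT|apply/seteqP; split].
      by rewrite (_ : [set _ | _] = set0); [exact: open0|apply/seteqP; split].
    by apply: openU; apply: openI.
  have := locally_constant2 (fun u v => (u * v)%R) li hh.1.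
  congr locally_constant; apply: funext => x; rewrite /ind /restrict_char.
  by case: asboolP; rewrite ?GRing.mul1r ?GRing.mul0r.
- by move=> x y Rx Ry; rewrite !restrict_charE ?hh.2//; exact: (sgM nR'.1).
- by move=> x g Rx; rewrite !restrict_charE ?(H1_J _ _ hh)//; exact: nR'.2.
- by move=> x Rx; rewrite /restrict_char; case: asboolP.
Qed.

(** The map [ver] is only a crossed homomorphism, [ver (x * y) = ver y ^ x^-1 * ver x], but [f] is
    invariant under conjugation and does not see the twist. *)
Let ver_char_H1 f : event_chars D th tau f -> vertical (f \o ver).
Proof.
move=> [[lf fM fJ f0] fD]; split; first split.
- apply: locally_constant_comp lf.
  have c1 : continuous ((fun z : E => z^-1) \o (tau \o lam)).
    move=> y; apply: continuous_comp; last exact: invg_continuous.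
    by apply: continuous_comp; [exact: hlam.1.1|exact: htau.1.1].
  move=> x; apply: (@cvg_comp _ _ _ (fun y => (y, ((fun z : E => z^-1) \o (tau \o lam)) y))
    (fun z => z.1 * z.2)).
    exact: (cvg_pair (@cvg_id _ _) (c1 x)).
  exact: (@mulg_continuous E (x, (tau (lam x))^-1)).
- move=> x y /=.
  have -> : ver (x * y) = ver y ^ x^-1 * ver x.
    rewrite /ver hlam.1.2 htau.1.2 conjgE invgM invgK -!mulgA.
    by rewrite mulKg.
  rewrite fM; [|by apply: nR.2; exact: ver_ker|exact: ver_ker].
  by rewrite fJ; [exact: GRing.addrC|exact: ver_ker].
- by move=> x /=; rewrite /ver lamtau mulgV (char_at1 nR).
Qed.

(** From [x = ver x * tau (lam x)] a character of [ker th] is the sum of a vertical class and of a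
    base character pulled back along [lam]. On vertical classes [sigma] is -1 because it inverts the
    free generators, so the sign only has to be known on the base. *)
Lemma event_chars_dual e (g : 'I_e -> F -> 'F_p) u :
  dual_system base_chars g u -> spans base_chars g u ->
  exists (b : 'I_(e + (m - n)) -> E -> 'F_p) y, [/\ (n <= m)%N,
    dual_system (event_chars D th tau) b y, spans (event_chars D th tau) b y &
    (forall j x, g j (sigma x) = (- g j x)%R) -> forall j x, b j (sigma x) = (- b j x)%R].
Proof.
move=> [hg dg] spg.
have [h [z [nm [[hh dh] sph]]]] := vertical_dual.
pose b1 i := g i \o lam; pose b2 i := restrict_char (ker_of th) (h i).
have tauR d : nset D d -> ker_of th (tau d) by move=> Dd; rewrite /ker_of /= thtau qD.
have uR j : ker_of th (tau (u j)).
  rewrite /ker_of /= thtau; apply: contrapT => nu.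
  have [[_ _ _ g0] _] := hg j; have := dg j j; rewrite g0// eqxx => /eqP.
  by rewrite eq_sym GRing.oner_eq0.
exists (join b1 b2), (join (tau \o u) (ver \o z)).
have dj : dual_system (event_chars D th tau) (join b1 b2) (join (tau \o u) (ver \o z)).
  apply: join_dual.
  - by split=> [i|i j]; [exact: base_to_event|rewrite /b1 /= lamtau dg].
  - split=> [i|i j]; last first.
      rewrite /b2 /= restrict_charE; last exact: ver_ker.
      by rewrite (ver_H1 _ (hh i)) dh.
    split; first by apply: restrict_is_char => //; exact: (hh i).1.
    by move=> d Dd; rewrite /b2 restrict_charE ?(hh i).2//; exact: tauR.
  - by move=> i j; rewrite /b1 /= lam_ver; exact: (char_at1 nB (hg i).1).
  - by move=> i j; rewrite /b2 restrict_charE ?(hh i).2//; exact: uR.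
split=> //.
  apply: (separates_spans event_chars0 event_charsD dj); apply: join_separates => f Xf f1 f2.
  have ft : forall x, f (tau x) = 0%R.
    exact: (dual_spans_separates spg (event_to_base Xf)).
  have fv : forall x, f (ver x) = 0%R.
    exact: (dual_spans_separates sph (ver_char_H1 Xf)).
  have [[lf fM fJ f0] fD] := Xf.
  move=> x; have [tx|ntx] := pselect (ker_of th x); last exact: f0.
  have -> : x = ver x * tau (lam x) by rewrite /ver mulgVK.
  by rewrite fM// ?ft ?fv ?GRing.addr0// /ker_of /= thtau qlam.
move=> gs j x; rewrite /join; case: fintype.split => i; first by rewrite /b1 /= hlam.2 gs.
rewrite /b2 /restrict_char; have -> : `[< ker_of th (sigma x) >] = `[< ker_of th x >].
  apply: asbool_equiv_eq; rewrite /ker_of /= sth.1.2; split=> [e1|->].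
    by rewrite -[th x]sigmaK e1 (hom1 (@sigmaM Q)).
  by rewrite (hom1 (@sigmaM Q)).
by case: asboolP => _; rewrite ?GRing.oppr0// (free_H1_sigma p_pr _ (hh i).1).
Qed.

Lemma base_of_event k (r : 'I_k -> E) : separates (event_chars D th tau) r ->
  separates base_chars (lam \o r).
Proof.
move=> sr g Xg g0 x; rewrite -[x]lamtau.
exact: (sr _ (base_to_event Xg)).
Qed.

(** The function [g \o sigma + g] is a base character. It vanishes at the points [lam (r i)], which
    are anti-invariant and separate the base characters. *)
Lemma event_sigma k (r : 'I_k -> E) : separates (event_chars D th tau) r ->
  (forall i, minus_set (r i)) ->
  forall g, base_chars g -> forall x, g (sigma x) = (- g x)%R.
Proof.
move=> sr mr g Xg.
have Xs : base_chars (g \o sigma).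
  have [cg gD] := Xg; split; last by move=> d Dd /=; rewrite gD//; exact: nset_sigma.
  apply: char_pullback cg; first exact: sigma_is_hom.
  move=> x; rewrite /ker_of /= sq.1.2; split=> [->|e1]; first by rewrite (hom1 (@sigmaM Q)).
  by rewrite -[q x]sigmaK e1 (hom1 (@sigmaM Q)).
have Xgs := base_charsD 1%R Xs Xg.
move=> x; apply/eqP; rewrite -GRing.addr_eq0 -[X in (_ + X)%R]GRing.mul1r; apply/eqP.
move: x; apply: (base_of_event sr Xgs) => i /=.
rewrite GRing.mul1r -hlam.2 (mr i) (homV hlam.1.2).
by rewrite (char_V _ nB Xg.1) GRing.addNr.
Qed.

End Split.

Lemma sigma_surj_comp (A B C : sigmaGroupType) (f : A -> B) (g : B -> C) :
  sigma_surj f -> sigma_surj g -> sigma_surj (g \o f).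
Proof.
move=> [hf sf] [hg sg]; split; first exact: sigma_hom_comp.
by move=> z; have [y <-] := sg z; have [x <-] := sf y; exists x.
Qed.

Lemma sigma_iso_surj (A B : sigmaGroupType) (f : A -> B) : is_sigma_iso f -> sigma_surj f.
Proof. by move=> [hf [g [hg fK gK]]]; split=> // y; exists (g y). Qed.

Lemma sigma_iso_inj (A B : sigmaGroupType) (f : A -> B) : is_sigma_iso f -> injective f.
Proof. by move=> [hf [g [hg fK gK]]]; exact: can_inj fK. Qed.

Lemma sigmaSurj_surj (A B : sigmaGroupType) (f : sigmaSurj A B) : sigma_surj f.
Proof. by split; [exact: surj_hom|exact: surjP]. Qed.

Lemma min_natE (P : set nat) m : P m -> (forall k, P k -> (m <= k)%N) -> min_nat P = m.
Proof.
move=> Pm mmin; rewrite /min_nat.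
have [Px xmin] : (fun m => P m /\ forall k, P k -> (m <= k)%N)
    (xget 0%N [set m | P m /\ forall k, P k -> (m <= k)%N]).
  by apply: (@xgetPex _ 0%N [set m | P m /\ forall k, P k -> (m <= k)%N]); exists m.
by apply/eqP; rewrite eqn_leq xmin// mmin.
Qed.

(** * The finite quotient [G_D] and the number [m_{D,G}] *)

Section Quotient.
Variables (p n : nat) (F_ : forall n, sigmaFreeProP p n).
Local Notation F := (F_ n).
Hypotheses (p_pr : prime p) (p_gt2 : (2 < p)%N).
Variables (D : sigmaNormal F) (D_frattini : nset D `<=` @frattini F).
Hypothesis D_aut : forall f : F -> F, is_sigma_iso f -> f @` nset D = nset D.
Hypothesis D_open : open (nset D).
Variables (G : sigmaGroupType) (pG : is_pro_p p G) (G_dim : H1_dim p G n) (prj : sigmaSurj F G).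

Let pF := free_pro_p F.
Let cF : compact [set: F]. Proof. by case: pF. Qed.
Let hG : hausdorff_space G. Proof. by case: pG. Qed.
Let clD := open_subgroup_closed (nset_normal D).1 D_open.

Local Notation Q := (quot (img prj D)).

Definition q_D : F -> Q := @coset G (img prj D) \o prj.

Lemma q_D_surj : sigma_surj q_D.
Proof. by apply: sigma_surj_comp; [exact: sigmaSurj_surj|exact: coset_sigma_surj]. Qed.

Lemma img_D_closed : closed (prj @` nset D).
Proof. apply: closed_image => //; exact: (surj_hom prj).1.1. Qed.

Lemma quot_img_pro_p : is_pro_p p Q.
Proof. by apply: quot_pro_p => //; exact: img_D_closed. Qed.

Lemma q_D1 x : q_D x = 1 <-> exists2 d, nset D d & prj d = prj x.
Proof. exact: coset1P. Qed.

Lemma q_D_ker_D d : nset D d -> q_D d = 1.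
Proof. by move=> Dd; apply/q_D1; exists d. Qed.

Lemma q_D_open (A : set Q) : open A.
Proof.
have [_ hQ _ _] := quot_img_pro_p.
rewrite -[A]setCK; apply: closed_openC.
have -> : ~` A = q_D @` (q_D @^-1` (~` A)).
  apply/seteqP; split=> [y nA|_ [x nA <-]//].
  by have [x e] := q_D_surj.2 y; exists x => //; rewrite /= e.
apply: closed_image => //; first exact: q_D_surj.1.1.1.
rewrite -preimage_setC; apply: open_closedC.
have -> : q_D @^-1` A = \bigcup_(x in q_D @^-1` A) ((fun y => x^-1 * y) @^-1` nset D).
  apply/seteqP; split=> [x Ax|x [y Ay /= Dyx]].
    by exists x => //=; rewrite mulVg; exact: (sg1 (nset_normal D).1).
  have -> : x = y * (y^-1 * x) by rewrite mulVKg.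
  by rewrite q_D_surj.1.1.2 (q_D_ker_D Dyx) mulg1.
by apply: bigcup_open => x _; exact: open_mulgl.
Qed.

Lemma q_D_finite : finite_set [set: Q].
Proof.
have -> : [set: Q] = (fun a : quot D => q_D (coset_repr a)) @` setT.
  apply/seteqP; split=> // y _; have [x <-] := q_D_surj.2 y.
  exists (coset D x) => //; apply/(hom_eq_ker q_D_surj.1.1.2)/q_D_ker_D.
  exact: repr_coset.
by apply: finite_image; exact: (finite_quot pF D_open).
Qed.

(** As [d_G = n], the class [g] descends to [G]; it kills [D], which lies in the Frattini subgroup.
    Hence it descends to [Q]. *)
Lemma q_D_H1 (g : F -> 'F_p) : H1 g -> forall x, q_D x = 1 -> g x = 0%R.
Proof.
move=> hg x /q_D1[d Dd e].
have [|h [hh eh]] := free_H1_pullback p_pr (surj_hom prj).1 G_dim _ hg.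
  by move=> h _ h0 y; have [z <-] := surjP prj y.
rewrite -eh -e eh; exact: (H1_kills_frattini p_pr hg) (D_frattini Dd).
Qed.

(** A Burnside basis theorem for normal generators. The points [u] generate [ND/D], since otherwise
    a nonzero base character would vanish on them; conversely, lifts of any generating family
    separate the base characters, so [dual_le] bounds its size below by [e]. *)
Lemma m_D_dim e (g : 'I_e -> F -> 'F_p) u :
  dual_system (base_chars D q_D) g u -> spans (base_chars D q_D) g u -> m_D D prj = e.
Proof.
move=> [hg dg] spg.
have nB := ker_of_normal q_D_surj.1.
have oB := ker_of_open q_D_open q_D_surj.
have imgE : coset D @` [set x | prj x = 1] = coset D @` ker_of q_D.
  apply/seteqP; split=> y [x].
    move=> /= px <-; exists x => //; apply/q_D1; exists 1; first exact: (sg1 (nset_normal D).1).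
    by rewrite px (hom1 (surj_hom prj).1.2).
  move=> /q_D1[d Dd e1] <-; exists (x * d^-1).
    by rewrite /= (surj_hom prj).1.2 (homV (surj_hom prj).1.2) e1 mulgV.
  by apply/coset_eq; rewrite invgM invgK -mulgA mulVg mulg1.
have clq (A : set (quot D)) : closed A.
  by rewrite -[A]setCK; apply: open_closedC; exact: (open_quot D_open).
have uB j : ker_of q_D (u j).
  apply: contrapT => nu.
  have [[_ _ _ g0] _] := hg j; have := dg j j; rewrite g0// eqxx => /eqP.
  by rewrite eq_sym GRing.oner_eq0.
apply: min_natE.
  exists (coset D \o u); rewrite imgE.
  have sT : ngen (range (coset D \o u)) `<=` coset D @` ker_of q_D.
    apply: ngen_min; [exact: normal_image|exact: clq|].
    by move=> _ [j _ <-]; exists (u j).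
  apply/seteqP; split=> //.
  pose S := coset D @^-1` ngen (range (coset D \o u)).
  have nS : is_normal S by apply: normal_preim; exact: ngen_normal.
  have clS : closed S.
    by have := @coset_continuous F D; move/continuous_closedP; apply; exact: clq.
  have SB : S `<=` ker_of q_D.
    move=> x /sT[y qy /coset_eq Dyx].
    have -> : x = y * (y^-1 * x) by rewrite mulVKg.
    by rewrite /ker_of /= q_D_surj.1.1.2 qy mul1g; exact: q_D_ker_D.
  have [->|neq] := pselect (ker_of q_D = S); first by move=> _ [x Sx <-].
  have [f [cf fS [x Bx []]]] := profinite_normal_char pF p_pr nB oB nS clS SB (not_eq_sym neq).
  apply: (dual_spans_separates spg); last first.
    by move=> j; apply: fS; apply: sub_ngen; exists j.
  split=> // d Dd; apply: fS; rewrite /S /=.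
  have -> : coset D d = 1 by exact/coset1P.
  exact: (sg1 (ngen_normal _).1).
move=> k [t et].
have ex j : exists x, q_D x = 1 /\ coset D x = t j.
  have : ngen (range t) (t j) by apply: sub_ngen; exists j.
  by rewrite et imgE => -[x qx e1]; exists x.
pose r j := projT1 (cid (ex j)).
have rP j : q_D (r j) = 1 /\ coset D (r j) = t j by rewrite /r; case: cid.
apply: (dual_le p_pr (@base_chars0 p n F D _ q_D) (@base_charsD p n F D _ q_D) (r := r)).
  by split; [exact: hg|exact: dg].
move=> f [cf fD] fr.
have [nK oK clK] := char_kernel nB oB cf.
move=> x; have [qx|nqx] := pselect (ker_of q_D x); last by have [_ _ _] := cf; apply.
have : (coset D @` ker_of q_D) (coset D x) by exists x.
rewrite -imgE -et => tx.
have : (coset D @` [set x | ker_of q_D x /\ f x = 0%R]) (coset D x).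
  move: tx; apply: ngen_min; [exact: normal_image|exact: clq|].
  by move=> _ [j _ <-]; exists (r j); [split; [exact: (rP j).1|exact: fr]|exact: (rP j).2].
move=> [y [By fy] /coset_eq Dyx].
have -> : x = y * (y^-1 * x) by rewrite mulVKg.
have [_ fM _ _] := cf; rewrite fM ?fy ?fD ?GRing.addr0//.
exact: q_D_ker_D.
Qed.

(** The presentation of [G] itself satisfies the generation criterion, for the projection of its
    free group to [Q]. Its [k] relators therefore separate a space of dimension [e + (k - n)],
    whence [e <= n], and their anti-invariance gives the sign of [sigma]. *)
Lemma base_chars_dual k (E : sigmaFreeProP p k) (r : k.-tuple (minus_borel E)) :
  sigma_isomorphic G (quot (relN r)) ->
  exists (g : 'I_(m_D D prj) -> F -> 'F_p) u, [/\ (m_D D prj <= n)%N,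
    dual_system (base_chars D q_D) g u, spans (base_chars D q_D) g u &
    forall j x, g j (sigma x) = (- g j x)%R].
Proof.
move=> [phi iphi]; have [_ [phi' [hphi' phiK phiK']]] := iphi.
have sphi := sigma_iso_surj iphi.
have sphi' : sigma_surj phi' by split=> // y; exists (phi y).
have pH : is_pro_p p (quot (relN r)).
  by apply: quot_pro_p; [exact: free_pro_p|exact: gen_closed].
pose th : E -> Q := @coset _ (img prj D) \o phi' \o @coset E (relN r).
have sth : sigma_surj th.
  apply: sigma_surj_comp; first exact: coset_sigma_surj.
  by apply: sigma_surj_comp => //; exact: coset_sigma_surj.
have [tau [lam [htau hlam lamtau thtau qlam]]] :=
  split_exists p_pr p_gt2 quot_img_pro_p q_D_surj q_D_H1 sth.
have inj (A B : sigmaGroupType) (f : A -> B) : sigma_surj f -> forall h : B -> 'F_p, H1 h ->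
    (forall x, h (f x) = 0%R) -> forall y, h y = 0%R.
  by move=> sf h _ h0 y; have [x <-] := sf.2 y.
have [_ sepA] : relators_generate D (relators r) th tau.
  apply: (presents_generates p_pr p_gt2 D_frattini D_aut q_D_open q_D_surj q_D_ker_D
    (S := relN r) erefl sth htau thtau).
  split.
    apply: (H1_dim_transfer sphi.1.1 (inj _ _ _ sphi) _ G_dim) => g hg.
    exists (g \o phi'); split; first by apply: H1_comp => //; exact: hphi'.1.
    by move=> x /=; rewrite phiK.
  exists (phi \o prj); split; first by apply: sigma_surj_comp => //; exact: sigmaSurj_surj.
  move=> x; rewrite /th /= coset1P; split=> [[d Dd e]|[d Dd /= e]]; exists d => //=.
    by rewrite e phiK'.
  by rewrite -e phiK.
have sepr : separates (event_chars D th tau) (fun i => minus_val (tnth r i)).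
  by move=> f Xf fr; apply: sepA => // _ [i _ <-].
have mr i : minus_set (minus_val (tnth r i)) by have /set_mem := valP (tnth r i).
have sepb := base_of_event hlam lamtau qlam sepr.
have [e [g [u [dgu spg]]]] := dual_exists p_pr (@base_chars0 p n F D _ q_D)
  (@base_charsD p n F D _ q_D) sepb.
have sg := event_sigma q_D_surj hlam lamtau qlam sepr mr.
have [b [y [nk dby spb _]]] := event_chars_dual p_pr q_D_open q_D_surj q_D_ker_D sth
  htau hlam lamtau thtau qlam dgu spg.
have ek := dual_le p_pr (@event_chars0 _ _ _ _ _ D _ th tau) (@event_charsD _ _ _ _ _ D _ th tau) dby sepr.
rewrite (m_D_dim dgu spg); exists g, u; split=> //; first by lia.
by move=> j; apply: sg; exact: dgu.1.
Qed.

End Quotient.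

(** * The Zassenhaus filtration and the openness of [U_D] *)

Section ZassenhausTheory.
Variable p : nat.
Hypothesis p_pr : prime p.
Let p1 : (1 < p)%N := prime_gt1 p_pr.

Lemma zassenhaus_closed (G : topGroupType) i : closed (zassenhaus p G i).
Proof.
case: (ltnP 1 i) => i1; first by rewrite zassenhausE//; exact: gen_closed.
by case: i i1 => [|[|//]] _; rewrite /zassenhaus /=; exact: closedT.
Qed.

Lemma zassenhaus_le1 (G : topGroupType) i : (i <= 1)%N -> zassenhaus p G i = setT.
Proof. by case: i => [|[|//]] _; rewrite /zassenhaus. Qed.

Lemma zassenhaus_image (A B : sigmaGroupType) (f : A -> B) i :
  compact [set: A] -> hausdorff_space B -> is_hom f -> (forall y, exists x, f x = y) ->
  zassenhaus p B i `<=` f @` zassenhaus p A i.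
Proof.
move=> cA hB [cf fM] sf; elim/ltn_ind: i => i IH.
case: (ltnP 1 i) => i1; last first.
  by rewrite !zassenhaus_le1// => y _; have [x <-] := sf y; exists x.
rewrite (zassenhausE _ p1 i1); apply: gen_min.
- exact: (hom_image_subgroup fM (zassenhaus_subgroup _ _ _)).
- by apply: closed_image => //; exact: zassenhaus_closed.
have lt := ceil_lt p1 i1.
move=> y [[x /(IH _ lt)[u Du <-] <-]|[j [k [a [b [j0 k0 jk [ja kb ->]]]]]]].
  exists (u ^+ p); last exact: homX.
  by rewrite (zassenhausE _ p1 i1); apply: sub_gen; left; exists u.
have ji : (j < i)%N by lia.
have ki : (k < i)%N by lia.
have [u Du <-] := IH j ji _ ja; have [v Dv <-] := IH k ki _ kb.
exists [~ u, v]; last exact: homR.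
rewrite (zassenhausE _ p1 i1); apply: sub_gen; right.
by exists j, k, u, v.
Qed.

Lemma zassenhaus_H1 (G : topGroupType) (f : G -> 'F_p) i x : (1 < i)%N -> H1 f ->
  zassenhaus p G i x -> f x = 0%R.
Proof.
move=> i1 hf; have [nK oK clK] := H1_kernel hf.
rewrite (zassenhausE _ p1 i1); move: x; apply: gen_min; [exact: nK.1|by []|].
move=> _ [[x _ <-]|[j [k [a [b [_ _ _ [_ _ ->]]]]]]] /=.
  by rewrite H1_expg// -GRing.mulr_natr (pchar_Fp_0 p_pr) GRing.mulr0.
by rewrite commgEl hf.2 (H1_J _ _ hf) (H1_V _ hf) GRing.addNr.
Qed.

Section OpenSub.
Variable (G : sigmaGroupType).
Hypothesis pG : is_pro_p p G.

Lemma char_expg (R : set G) (f : G -> 'F_p) x k : is_normal R -> is_char R f -> R x ->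
  R (x ^+ k) /\ f (x ^+ k) = (f x *+ k)%R.
Proof.
move=> nR cf Rx; elim: k => [|k [Rk IH]].
  by rewrite expg0 (char_at1 nR cf); split=> //; exact: (sg1 nR.1).
rewrite expgS; split; first exact: (sgM nR.1).
by have [_ fM _ _] := cf; rewrite fM// IH GRing.mulrS.
Qed.

(** Each generator of a deep filtration step dies under [f]: a [p]-th power because its base already
    lies in [R], a commutator because one entry lies in [R] and [f] is invariant under
    conjugation. *)
Lemma zassenhaus_step (R : set G) (f : G -> 'F_p) j : is_normal R -> open R -> is_char R f ->
  (forall i, (p ^ j <= i)%N -> zassenhaus p G i `<=` R) ->
  forall i, (p ^ j.+1 <= i)%N -> zassenhaus p G i `<=` [set x | R x /\ f x = 0%R].
Proof.
move=> nR oR cf hR i hi; have [nK oK clK] := char_kernel nR oR cf.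
have pj : (0 < p ^ j)%N by rewrite expn_gt0 prime_gt0.
have i1 : (1 < i)%N by apply: leq_trans hi; rewrite expnS; nia.
rewrite (zassenhausE _ p1 i1); apply: gen_min; [exact: nK.1|by []|].
have [_ fM fJ _] := cf.
have hc : (p ^ j <= (i + p).-1 %/ p)%N.
  by rewrite leq_divRL ?prime_gt0// -expnSr; apply: leq_trans hi _; lia.
move=> _ [[x /(hR _ hc) Rx <-]|[k [l [a [b [k0 l0 kl [ka lb ->]]]]]]] /=.
  have [Rxp fxp] := char_expg p nR cf Rx; split=> //.
  by rewrite fxp -GRing.mulr_natr (pchar_Fp_0 p_pr) GRing.mulr0.
have := hi; rewrite expnS => hi'.
have [ge|lt] := leqP (p ^ j) k.
  have Ra := hR _ ge _ ka; have Rab : R (a ^ b) := nR.2 _ _ Ra.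
  have RV := sgV nR.1 Ra.
  rewrite commgEl; split; first exact: (sgM nR.1).
  by rewrite fM// fJ// (char_V _ nR cf) GRing.addNr.
(* Since [k + l = i] is at least [p ^ j.+1], at least twice [p ^ j], one of the two indices reaches
   [p ^ j]. *)
have ge : (p ^ j <= l)%N by nia.
have Rb := hR _ ge _ lb; have Rba : R (b^-1 ^ a) := nR.2 _ _ (sgV nR.1 Rb).
have -> : [~ a, b] = b^-1 ^ a * b by rewrite commgEl !conjgE !mulgA.
split; first exact: (sgM nR.1).
by rewrite fM// fJ ?(char_V _ nR cf) ?GRing.addNr//; exact: (sgV nR.1).
Qed.

(* Descend from [G] to [N] through kernels of characters, each of which is reached
   by the filtration. *)
Lemma zassenhaus_open_sub (N : sigmaNormal G) : open (nset N) ->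
  exists2 i, (2 <= i)%N & zassenhaus p G i `<=` nset N.
Proof.
move=> oN; have clN := open_subgroup_closed (nset_normal N).1 oN.
have fin (A : set (quot N)) : finite_set A.
  by apply: sub_finite_set (finite_quot pG oN).
have H c : forall R : set G, is_normal R -> open R -> nset N `<=` R ->
    (#|` fset_set (coset N @` R)| <= c)%N ->
    (exists j, forall i, (p ^ j <= i)%N -> zassenhaus p G i `<=` R) ->
    exists j, forall i, (p ^ j <= i)%N -> zassenhaus p G i `<=` nset N.
  elim: c => [|c IH] R nR oR NR hc [j hj].
    move: hc; rewrite leqn0 cardfs_eq0 => /eqP/(fset_set_set0 (fin _)) e.
    have : (coset N @` R) (coset N 1) by exists 1 => //; exact: (sg1 nR.1).
    by rewrite e.
  have [->|neq] := pselect (nset N = R); first by exists j.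
  have [f [cf fN [x Rx fx]]] := profinite_normal_char pG p_pr nR oR (nset_normal N) clN NR neq.
  have [nK oK clK] := char_kernel nR oR cf.
  apply: (IH _ nK oK).
  - by move=> y Ny; split; [exact: NR|exact: fN].
  - rewrite -ltnS; apply: leq_trans hc; apply: fproper_ltn_card.
    rewrite fproperE; apply/andP; split.
      by rewrite -(fset_set_sub (fin _) (fin _)); apply: image_subset => y [].
    apply/negP; rewrite -(fset_set_sub (fin _) (fin _)) => /(_ (coset N x)) [|y [Ry fy]].
      by exists x.
    move=> /coset_eq Nyx; apply: fx; have -> : x = y * (y^-1 * x) by rewrite mulVKg.
    by have [_ fM _ _] := cf; rewrite fM ?fy ?fN ?GRing.addr0//; exact: NR.
  - exists j.+1; exact: zassenhaus_step.
have [||||j hj] := H _ setT _ _ _ (leqnn _) _.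
- by split.
- exact: openT.
- by [].
- by exists 0%N.
exists (p ^ j.+1)%N; last by apply: hj; rewrite leq_exp2l.
by rewrite expnS; have : (0 < p ^ j)%N by [rewrite expn_gt0 prime_gt0]; nia.
Qed.

End OpenSub.
End ZassenhausTheory.

Section UD.
Variables (p n : nat) (F_ : forall n, sigmaFreeProP p n).
Local Notation F := (F_ n).
Hypotheses (p_pr : prime p) (p_gt2 : (2 < p)%N).
Variables (D : sigmaNormal F) (D_frattini : nset D `<=` @frattini F).
Hypothesis D_aut : forall f : F -> F, is_sigma_iso f -> f @` nset D = nset D.
Hypothesis D_open : open (nset D).
Variables (G : sigmaGroupType) (pG : is_pro_p p G) (G_dim : H1_dim p G n) (prj : sigmaSurj F G).

Let pF := free_pro_p F.
Let cF : compact [set: F]. Proof. by case: pF. Qed.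

Local Notation Q := (G_D D prj).

Let pQ : is_pro_p p Q. Proof. exact: quot_img_pro_p. Qed.

Lemma H1_inj_surj (A B : sigmaGroupType) (f : A -> B) : sigma_surj f ->
  forall h : B -> 'F_p, H1 h -> (forall x, h (f x) = 0%R) -> forall y, h y = 0%R.
Proof. by move=> sf h _ h0 y; have [x <-] := sf.2 y. Qed.

Lemma quot_img_iso (H H' : sigmaGroupType) (pi : sigmaSurj F H) (pi' : sigmaSurj F H') :
  is_pro_p p H -> is_pro_p p H' ->
  (forall x, (exists2 d, nset D d & pi d = pi x) <-> (exists2 d, nset D d & pi' d = pi' x)) ->
  sigma_isomorphic (quot (img pi D)) (quot (img pi' D)).
Proof.
move=> pH pH' e.
have hq (K : sigmaGroupType) (rho : sigmaSurj F K) : is_pro_p p K -> hausdorff_space (quot (img rho D)).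
  by move=> pK; have [_] : is_pro_p p (quot (img rho D)) by exact: quot_img_pro_p.
have [s hs] := q_D_surj D pi; have [s' hs'] := q_D_surj D pi'.
have [|g [ig _]] := sigma_iso_same_ker cF (hq _ pi pH) (hq _ pi' pH') s hs s' hs'.
  by move=> x; rewrite !q_D1.
by exists g.
Qed.

Lemma coset_img (H : sigmaGroupType) (pi : sigmaSurj F H) (N : sigmaNormal H) x :
  nset N `<=` pi @` nset D ->
  (exists2 d, nset D d & pi d = pi x) <->
  (exists2 d, nset D d & coset N (pi d) = coset N (pi x)).
Proof.
move=> ND; have piM := (surj_hom pi).1.2.
split=> [[d Dd e]|[d Dd /coset_eq/ND[d' Dd' e]]]; first by exists d; rewrite ?e.
exists (d * d'); first exact: (sgM (nset_normal D).1).
by rewrite piM e mulVKg.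
Qed.

(** An open [D] contains some [D_i(F)] with [i >= 2], so [H / D_i(H)] already determines [d_H] and
    the class of [H_D]. Hence [U_D] contains a basic neighbourhood of each of its points. *)
Lemma U_D_sch_open : sch_open (U_D D prj).
Proof.
have [i i2 sD] := zassenhaus_open_sub p_pr pF D_open.
pose good H := [/\ weak_schur F_ H, H1_dim p H n &
  exists prjH : sigmaSurj F H, sigma_isomorphic (quot (img prjH D)) Q].
exists [set U | exists H, good H /\ U = sch_basic i H]; split.
  by move=> U [H [[wH _ _] ->]]; exists i, H.
have zD (H : sigmaGroupType) (pi : sigmaSurj F H) : is_pro_p p H ->
    nset (zassenhausN p H i) `<=` pi @` nset D.
  move=> [_ hH _ _] x /(zassenhaus_image p_pr cF hH (surj_hom pi).1 (surjP pi))[y Dy <-].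
  by exists y => //; exact: sD.
apply/seteqP; split=> [c [H [wH cH dH [prjH iH]]]|c].
  exists (sch_basic i H); first by exists H; split=> //; split=> //; exists prjH.
  by exists H; split=> //; exact: sigma_iso_refl.
move=> [_ [H [[wH dH [prjH iH]] ->]] [H' [wH' cH']]].
move=> /sigma_iso_sym[psi ipsi].
have pH := wH.1; have pH' := wH'.1; have cp' : compact [set: H'] by case: pH'.
have pP : is_pro_p p (quot (zassenhausN p H i)).
  by apply: quot_pro_p => //; exact: zassenhaus_closed.
have pP' : is_pro_p p (quot (zassenhausN p H' i)).
  by apply: quot_pro_p => //; exact: zassenhaus_closed.
pose rho := coset (zassenhausN p H i) \o prjH.
have srho : sigma_surj rho by apply: sigma_surj_comp; [exact: sigmaSurj_surj|exact: coset_sigma_surj].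
have srho' : sigma_surj (psi \o rho) by apply: sigma_surj_comp => //; exact: sigma_iso_surj.
(* The surjection from [F] to the common truncation lifts to [H']. The lift is surjective because,
   as [i >= 2], every class in H1 of [H'] factors through [H' / D_i(H')]. *)
have [pi' [hpi' epi']] := free_sigma_lift p_pr p_gt2 pH' pP' (coset_sigma_surj _).1
  (coset_sigma_surj _).2 srho'.1.
have cH : compact [set: H] by case: pH.
have kz (K : sigmaGroupType) (h : K -> 'F_p) x : H1 h -> coset (zassenhausN p K i) x = 1 -> h x = 0%R.
  by move=> hh /coset1P; apply: zassenhaus_H1.
have inj : forall h : H' -> 'F_p, H1 h -> (forall x, h (pi' x) = 0%R) -> forall y, h y = 0%R.
  move=> h hh h0 y.
  have [h' [hh' eh]] := H1_descend cp' pP' (coset_sigma_surj _).1.1 (coset_sigma_surj _).2 hh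
    (fun x => @kz _ h x hh).
  rewrite -eh; apply: (H1_inj_surj srho' hh') => x.
  by rewrite -epi' eh h0.
have spi' := surj_of_H1 p_pr cF pH' hpi'.1 inj.
pose prjH' := SigmaSurj hpi' spi'.
exists H'; split=> //.
  apply: (H1_dim_transfer hpi'.1 inj _ (free_H1_dim F p_pr)) => g hg.
  have [h [hh eh]] := free_H1_pullback p_pr (surj_hom prjH).1 dH
    (H1_inj_surj (sigmaSurj_surj prjH)) hg.
  have [h' [hh' eh']] := H1_descend cH pP (coset_sigma_surj _).1.1 (coset_sigma_surj _).2 hh
    (fun x => @kz _ h x hh).
  have [_ [psi' [hpsi' psiK psiK']]] := ipsi.
  exists (h' \o psi' \o coset (zassenhausN p H' i)); split.
    apply: H1_comp; first exact: (coset_sigma_surj _).1.1.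
    by apply: H1_comp => //; exact: hpsi'.1.
  by move=> x /=; rewrite epi' /= psiK eh' eh.
exists prjH'; apply: sigma_iso_trans iH; apply: quot_img_iso => // x.
rewrite (coset_img _ (zD _ prjH' pH')) (coset_img _ (zD _ prjH pH)) /=.
split=> -[d Dd e]; exists d => //; move: e; rewrite !epi'.
  exact: (sigma_iso_inj ipsi).
exact: (congr1 psi).
Qed.

(** * Membership in [U_{D,G}] in terms of surjections onto [G_D] *)

Section Relators.
Variables (m : nat) (r : m.-tuple (minus_borel (F_ m))).

Definition good_surj : set (F_ m -> Q) :=
  [set th | sigma_surj th /\ relators_present D (relN r) th].

Lemma sch_of_relatorsP k (s : k.-tuple (minus_borel (F_ k))) :
  sch_of_relators r = sch_of_relators s -> sigma_isomorphic (Gr r) (Gr s).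
Proof. by move=> /eqmodP/asboolP. Qed.

Lemma U_D_relators : U_D D prj (sch_of_relators r) <-> good_surj !=set0.
Proof.
have pGr : is_pro_p p (Gr r).
  by apply: quot_pro_p; [exact: free_pro_p|exact: gen_closed].
split=> [[H [wH [k [s [isoH es]]] dH [prjH [psi ipsi]]]]|[th [sth [dH [pi [spi e]]]]]].
  have [phi iphi] : sigma_isomorphic H (Gr r).
    by apply: sigma_iso_trans isoH _; apply: sigma_iso_sym; exact: sch_of_relatorsP.
  have [_ [phi' [hphi' phiK phiK']]] := iphi.
  have sphi' : sigma_surj phi' by split=> // y; exists (phi y).
  have sphi := sigma_iso_surj iphi.
  exists (psi \o (@coset _ (img prjH D) \o (phi' \o @coset (F_ m) (relN r)))); split.
    apply: sigma_surj_comp; last exact: sigma_iso_surj.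
    apply: sigma_surj_comp; last exact: coset_sigma_surj.
    by apply: sigma_surj_comp => //; exact: coset_sigma_surj.
  split.
    apply: (H1_dim_transfer sphi.1.1 (H1_inj_surj sphi) _ dH) => g hg.
    exists (g \o phi'); split; first by apply: H1_comp => //; exact: hphi'.1.
    by move=> x /=; rewrite phiK.
  exists (phi \o prjH); split; first by apply: sigma_surj_comp => //; exact: sigmaSurj_surj.
  move=> x /=.
  have -> (z : quot (img prjH D)) : psi z = 1 <-> z = 1.
    split=> [ez|->]; last exact: (hom1 ipsi.1.1.2).
    by apply: (sigma_iso_inj ipsi); rewrite ez (hom1 ipsi.1.1.2).
  rewrite coset1P; split=> [[d Dd ed]|[d Dd ed]]; exists d => //=.
    by rewrite ed phiK'.
  by rewrite -ed /= phiK.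
exists (Gr r); split=> //; first exact: weak_schur_Gr.
  by exists m, r; split=> //; exact: sigma_iso_refl.
exists (SigmaSurj spi.1 spi.2).
have cE : compact [set: F_ m] by case: (free_pro_p (F_ m)).
set I := img _ D.
have pI : is_pro_p p (quot I) by exact: quot_img_pro_p.
have [_ hI _ _] := pI; have [_ hQ _ _] := pQ.
have sI : sigma_surj (@coset _ I \o @coset (F_ m) (relN r)).
  by apply: sigma_surj_comp; exact: coset_sigma_surj.
have [x|g [ig _]] := sigma_iso_same_ker cE hI hQ sI.1 sI.2 sth.1 sth.2; last by exists g.
by rewrite /= coset1P e.
Qed.

(** By [img_unique] all good surjections have the same kernel, the preimage of [pi(D)], so each
    differs from [th1] by exactly one automorphism of [Q]. *)
Lemma good_surj_card th1 : good_surj th1 -> (good_surj #= @sigma_auts Q)%card.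
Proof.
move=> [sth1 B1].
have pGr : is_pro_p p (quot (relN r)).
  by apply: quot_pro_p; [exact: free_pro_p|exact: gen_closed].
have cE : compact [set: F_ m] by case: (free_pro_p (F_ m)).
have [_ hQ _ _] := pQ.
have -> : good_surj = (fun a => a \o th1) @` @sigma_auts Q.
  apply/seteqP; split=> [th [sth B]|_ [a ia <-]].
    have [|a [ia e]] := sigma_iso_same_ker cE hQ hQ sth1.1 sth1.2 sth.1 sth.2.
      move=> x; have [dH [pi [spi e]]] := B; have [_ [pi1 [spi1 e1]]] := B1.
      by rewrite e e1 (img_unique p_pr p_gt2 D_aut pGr dH spi.1 spi.2 spi1.1 spi1.2).
    by exists a => //; apply: funext.
  have sa := sigma_iso_surj ia.
  split; first exact: sigma_surj_comp.
  have [dH [pi [spi e]]] := B1; split=> //; exists pi; split=> // x.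
  rewrite -e /=; split=> [ex|->]; last exact: (hom1 ia.1.1.2).
  by apply: (sigma_iso_inj ia); rewrite ex (hom1 ia.1.1.2).
apply: inj_card_eq => a b _ _ /= e; apply: funext => y.
by have [x <-] := sth1.2 y; have := congr1 (fun f => f x) e.
Qed.

End Relators.
End UD.

(** * Haar measure *)

Section FiniteMeasure.
Local Open Scope ereal_scope.
Variables (d : measure_display) (X : measurableType d) (R : realType).
Variables (mu : {measure set X -> \bar R}) (I : finType) (A : I -> set X).
Hypothesis mA : forall i, measurable (A i).

Lemma measure_fin_cover : trivIset setT A -> mu (\bigcup_i A i) = \sum_i mu (A i).
Proof.
move=> tA; rewrite measure_fin_bigcup//; last exact: finite_finset.
rewrite (_ : [set: I] = [set` index_enum I]); first by rewrite -fsbig_seq ?index_enum_uniq.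
by apply/seteqP; split=> // i _ /=; exact: mem_index_enum.
Qed.

(** Integrate the pointwise identity between the sum of the indicators of the [A i] and [k] times
    the indicator of [U]. *)
Lemma measure_multiplicity (U : set X) (k : nat) : measurable U ->
  (forall x, #|[set i | `[< A i x >]]%SET| = if `[< U x >] then k else 0%N) ->
  \sum_i mu (A i) = k%:R%:E * mu U.
Proof.
move=> mU hk.
have -> : \sum_i mu (A i) = \sum_i \int[mu]_x (\1_(A i) x)%:E.
  by apply: eq_bigr => i _; rewrite integral_indic// setIT.
rewrite -ge0_integral_sum//; last first.
  by move=> i; apply/measurable_EFinP; exact: measurable_indic.
have -> : mu U = \int[mu]_x (\1_U x)%:E by rewrite integral_indic// setIT.
have mU1 : measurable_fun setT (fun x => (\1_U x)%:E : \bar R).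
  by apply/measurable_EFinP; exact: measurable_indic.
rewrite -ge0_integralZl//.
apply: eq_integral => x _; rewrite sumEFin -EFinM; congr EFin.
transitivity ((#|[set i | `[< A i x >]]%SET|)%:R : R)%R.
  rewrite -sum1_card natr_sum [RHS]big_mkcond /=; apply: eq_bigr => i _.
  by rewrite finset.inE indicE; case: asboolP => h; [rewrite mem_set|rewrite memNset].
by rewrite hk indicE; case: asboolP => h; [rewrite mem_set// mulr1|rewrite memNset// mulr0].
Qed.

End FiniteMeasure.

Section Haar.
Variables (R : realType) (p : nat) (E : sigmaGroupType) (mu : probability (minus_borel E) R).
Hypotheses (p_pr : prime p) (pE : is_pro_p p E) (haar : is_haar mu).
Let cE : compact [set: E]. Proof. by case: pE. Qed.

Lemma minus_open_measurable (B : set E) : open B ->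
  measurable [set a : minus_borel E | B (minus_val a)].
Proof.
by move=> oB; apply: sub_gen_smallest; exists B.
Qed.

Section Surj.
Variables (Q : sigmaGroupType) (th : E -> Q).
Hypotheses (hQ : hausdorff_space Q) (oQ : forall A : set Q, open A) (sth : sigma_surj th).

Lemma ker_of_sigma x : ker_of th x -> ker_of th (sigma x).
Proof. by rewrite /ker_of /= sth.1.2 => ->; rewrite (hom1 (@sigmaM Q)). Qed.

Definition kerN : sigmaNormal E := SigmaNormal (ker_of_normal sth.1) ker_of_sigma.

Lemma kerN_iso : exists g : quot kerN -> Q, is_sigma_iso g /\ forall x, g (coset kerN x) = th x.
Proof.
have oK : open (nset kerN) := ker_of_open oQ sth.
have [_ hK _ _] : is_pro_p p (quot kerN).
  by apply: quot_pro_p => //; apply: open_subgroup_closed oK; exact: (nset_normal kerN).1.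
apply: (sigma_iso_same_ker cE hK hQ (coset_sigma_surj _).1 (coset_sigma_surj _).2 sth.1 sth.2).
by move=> x; rewrite coset1P.
Qed.

Lemma ncard_minus_iso (A B : sigmaGroupType) (g : A -> B) : is_sigma_iso g ->
  finite_set [set: A] -> ncard (@minus_set A) = ncard (@minus_set B).
Proof.
move=> ig finA; have [hg [g' [hg' gK g'K]]] := ig.
have e : @minus_set B = g @` @minus_set A.
  apply/seteqP; split=> [b mb|_ [a ma <-]].
    by exists (g' b) => //; rewrite /minus_set /= -hg'.2 mb (homV hg'.1.2).
  by rewrite /minus_set /= -hg.2 ma (homV hg.1.2).
have finm : finite_set (@minus_set A) by apply: sub_finite_set finA.
have finB : finite_set (@minus_set B) by rewrite e; exact: finite_image.
apply/esym/(fcard_eq finB finm).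
by rewrite e; apply: inj_card_eq => x y _ _; exact: (can_inj gK).
Qed.

Lemma haar_surj t : minus_set t ->
  mu [set a | th (minus_val a) = t] = ((ncard (@minus_set Q))%:R^-1)%:E.
Proof.
move=> mt; have [g [ig ge]] := kerN_iso; have [hg [g' [hg' gK g'K]]] := ig.
have oK : open (nset kerN) := ker_of_open oQ sth.
rewrite -(ncard_minus_iso ig); last exact: (finite_quot pE oK).
rewrite -(haar oK (q := g' t)).
  congr (mu _); apply/seteqP; split=> a /=; rewrite -ge => e.
    by rewrite -e gK.
  by rewrite e g'K.
by rewrite /minus_set /= -hg'.2 mt (homV hg'.1.2).
Qed.

Variables (k : nat) (b : 'I_k -> E -> 'F_p) (y : 'I_k -> E).
Hypothesis cb : forall i, is_char (ker_of th) (b i).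
Hypothesis dby : forall i j, b i (y j) = (i == j)%:R%R.
Hypothesis bs : forall i x, b i (sigma x) = (- b i x)%R.

Let nR := ker_of_normal sth.1.
Let oR : open (ker_of th) := ker_of_open oQ sth.

Lemma dual_in_ker j : ker_of th (y j).
Proof.
apply: contrapT => nu; have [_ _ _ b0] := cb j.
have := dby j j; rewrite b0// eqxx => /eqP.
by rewrite eq_sym GRing.oner_eq0.
Qed.

Definition joint_ker : set E := [set x | ker_of th x /\ forall i, b i x = 0%R].

Lemma joint_ker_normal : is_normal joint_ker.
Proof.
split; first split.
- by split; [exact: (sg1 nR.1)|move=> i; exact: char_at1 nR (cb i)].
- move=> x z [Rx bx] [Rz bz]; split; first exact: nR.1.2.
  move=> i; have [_ fM _ _] := cb i.
  by rewrite fM//; [rewrite (char_V _ nR (cb i)) bx bz GRing.subr0|exact: (sgV nR.1)].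
- move=> x g [Rx bx]; split; first exact: nR.2.
  by move=> i; have [_ _ fJ _] := cb i; rewrite fJ.
Qed.

Lemma joint_ker_sigma x : joint_ker x -> joint_ker (sigma x).
Proof.
move=> [Rx bx]; split; first exact: ker_of_sigma.
by move=> i; rewrite bs bx GRing.oppr0.
Qed.

Lemma joint_ker_open : open joint_ker.
Proof.
apply: openI => //; rewrite openE => x bx; apply: filter_forall => i.
have [lf _ _ _] := cb i; apply: open_nbhs_nbhs; split; first exact: lf.
exact: bx.
Qed.

Definition jointN : sigmaNormal E := SigmaNormal joint_ker_normal joint_ker_sigma.

Lemma dual_realize (v : 'I_k -> 'F_p) : exists z, ker_of th z /\ forall i, b i z = v i.
Proof.
suff H l : (l <= k)%N -> exists z, ker_of th z /\
    forall i : 'I_k, b i z = if (i < l)%N then v i else 0%R.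
  have [z [Rz bz]] := H k (leqnn k); exists z; split=> // i.
  by rewrite bz ltn_ord.
elim: l => [|l IH] lk.
  exists 1; split; first exact: (sg1 nR.1).
  by move=> i; rewrite (char_at1 nR (cb i)).
have [z [Rz bz]] := IH (ltnW lk); pose j := Ordinal lk.
have pow i := char_expg (v j) nR (cb i) (dual_in_ker j).
exists (z * y j ^+ v j); split; first exact: (sgM nR.1 Rz (pow j).1).
move=> i; have [_ fM _ _] := cb i; rewrite fM//; last exact: (pow i).1.
rewrite bz (pow i).2 dby.
have -> : (i < l.+1)%N = (i == j) || (i < l)%N by rewrite ltnS leq_eqVlt.
have [->|il] := eqVneq i j; last by rewrite GRing.mul0rn GRing.addr0.
by rewrite /= ltnn GRing.add0r natr_Zp.
Qed.

Definition joint_fiber (v : 'I_k -> 'F_p) : set (minus_borel E) :=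
  [set a | ker_of th (minus_val a) /\ forall i, b i (minus_val a) = v i].

Lemma joint_fiberE v z : ker_of th z -> (forall i, b i z = v i) ->
  joint_fiber v = [set a | coset jointN (minus_val a) = coset jointN z].
Proof.
move=> Rz bz; apply/seteqP; split=> a /=.
  move=> [Ra ba]; apply/esym/coset_eq; split; first exact: (sgM nR.1 (sgV nR.1 Rz)).
  move=> i; have [_ fM _ _] := cb i; rewrite fM//; last exact: (sgV nR.1).
  by rewrite (char_V _ nR (cb i)) bz ba GRing.addNr.
move=> /esym/coset_eq[Rza bza].
have e : minus_val a = z * (z^-1 * minus_val a) by rewrite mulVKg.
split; first by rewrite e; exact: (sgM nR.1).
by move=> i; have [_ fM _ _] := cb i; rewrite e fM// bza bz GRing.addr0.
Qed.

Lemma joint_fiber_measurable v : measurable (joint_fiber v).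
Proof.
have [z [Rz bz]] := dual_realize v; rewrite (joint_fiberE Rz bz).
have : continuous (@coset _ jointN) by exact: coset_continuous.
move/continuousP => /(_ [set coset jointN z]) h; apply: (minus_open_measurable (h _)).
exact: (@open_quot _ jointN joint_ker_open).
Qed.

(* All fibers are cosets of the same subgroup, and they partition [ker th]. *)
Lemma haar_fiber v :
  mu (joint_fiber v) = (((ncard (@minus_set Q))%:R * (p ^ k)%:R)^-1)%:E.
Proof.
have fiberE w : mu (joint_fiber w) = ((ncard (@minus_set (quot jointN)))%:R^-1)%:E.
  have [z [Rz bz]] := dual_realize w; rewrite (joint_fiberE Rz bz).
  apply: haar; first exact: joint_ker_open.
  (* By [bs] the elements [sigma z] and [z^-1] have the same coordinates, so the coset of any [z] in
     [ker th] is anti-invariant and carries Haar mass. *)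
  rewrite /minus_set /= -coset_sigma -cosetV; apply/coset_eq.
  have Rs := ker_of_sigma Rz.
  split; first by apply: (sgM nR.1); exact: (sgV nR.1).
  move=> i; have [_ fM _ _] := cb i; rewrite fM; try exact: (sgV nR.1).
  by rewrite !(char_V _ nR (cb i)) bs GRing.opprK GRing.addrN.
have : mu [set a | th (minus_val a) = 1] = ((ncard (@minus_set Q))%:R^-1)%:E.
  by apply: haar_surj; rewrite /minus_set /= invg1 (hom1 (@sigmaM Q)).
have -> : [set a | th (minus_val a) = 1] =
    \bigcup_(w : {ffun 'I_k -> 'F_p}) joint_fiber w.
  apply/seteqP; split=> [a /= ta|a [w _ []]//].
  by exists [ffun i => b i (minus_val a)] => //; split=> // i; rewrite ffunE.
rewrite measure_fin_cover; last 2 first.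
- by move=> w; exact: joint_fiber_measurable.
- move=> w w' _ _ [a [[_ e] [_ e']]]; apply/ffunP => i.
  by rewrite -e -e'.
rewrite (eq_bigr (fun=> ((ncard (@minus_set (quot jointN)))%:R^-1)%:E : \bar R)); last first.
  by move=> w _; exact: fiberE.
rewrite sumEFin sumr_const card_ffun !card_ord (Fp_cast p_pr) fiberE => -[e].
congr EFin; rewrite invfM -e -[X in (X / _)%R]mulr_natr mulfK// pnatr_eq0.
by rewrite -lt0n expn_gt0 (prime_gt0 p_pr).
Qed.

End Surj.
End Haar.

(** The vectors [M i] span ['F_p^k], in dual form: no nonzero linear form [c] vanishes on all of
    them. *)
Definition full_rank (p m k : nat) (M : 'I_m -> {ffun 'I_k -> 'F_p}) :=
  forall c : 'I_k -> 'F_p, (forall i, (\sum_j c j * M i j)%R = 0%R) -> forall j, c j = 0%R.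

Lemma card_full_rank p m k : prime p -> (k <= m)%N ->
  #|[set M : {ffun 'I_m -> {ffun 'I_k -> 'F_p}} | `[< full_rank M >]]%SET| =
    (\prod_(i < k) (p ^ m - p ^ i))%N.
Proof.
move=> p_pr km; have := card_row_free 'F_p km; rewrite card_Fp// => <-.
pose f (M : {ffun 'I_m -> {ffun 'I_k -> 'F_p}}) : 'M['F_p]_(k, m) := (\matrix_(j, i) M i j)%R.
pose g (A : 'M['F_p]_(k, m)) := [ffun i => [ffun j => A j i]].
have fK : cancel f g by move=> M; apply/ffunP => i; apply/ffunP => j; rewrite !ffunE mxE.
have gK : cancel g f by move=> A; apply/matrixP => i j; rewrite mxE !ffunE.
rewrite -(card_imset _ (can_inj fK)); apply: eq_card => A.
rewrite -[A in LHS]gK (mem_imset _ _ (can_inj fK)) !finset.inE.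
have e (c : 'I_k -> 'F_p) i : (((\row_j c j) *m A) 0 i)%R = (\sum_j c j * g A i j)%R.
  by rewrite mxE; apply: eq_bigr => j _; rewrite mxE !ffunE.
apply/asboolP/idP => [nd|fA c c0 j].
  rewrite -kermx_eq0; apply/rowV0P => v; rewrite sub_kermx => /eqP vA.
  apply/rowP => j; rewrite [RHS]mxE; apply: nd => i.
  rewrite -e; have -> : (\row_j v 0 j)%R = v by apply/rowP => l; rewrite mxE.
  by rewrite vA mxE.
have : (\row_j c j)%R = 0%R :> 'rV_k.
  apply: (row_free_inj fA); rewrite mul0mx; apply/rowP => i.
  by rewrite e c0 mxE.
by move/rowP => /(_ j); rewrite !mxE.
Qed.

(** * The probability that random relators realize a given surjection *)

Section TupleMeasure.
Variables (R : realType) (p m : nat) (E : sigmaFreeProP p m).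
Hypothesis p_pr : prime p.
Variables (mu : probability (minus_borel E) R) (haar : is_haar mu).
Variables (nu : probability (m.-tuple (minus_borel E)) R) (nuP : is_product mu nu).
Variables (n : nat) (F : sigmaFreeProP p n) (D : sigmaNormal F).
Variables (Q : sigmaGroupType) (pQ : is_pro_p p Q) (oQ : forall A : set Q, open A).
Variables (th : E -> Q) (sth : sigma_surj th) (tau : F -> E).
Variables (k : nat) (b : 'I_k -> E -> 'F_p) (y : 'I_k -> E).
Hypothesis dby : dual_system (event_chars D th tau) b y.
Hypothesis spb : spans (event_chars D th tau) b y.
Hypothesis bs : forall i x, b i (sigma x) = (- b i x)%R.

Let pE := free_pro_p E.
Let hQ : hausdorff_space Q. Proof. by case: pQ. Qed.
Let cb i : is_char (ker_of th) (b i). Proof. exact: (dby.1 i).1. Qed.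

Definition event_tuples : set (m.-tuple (minus_borel E)) :=
  [set r | relators_generate D (relators r) th tau].

Definition cylinder (M : 'I_m -> {ffun 'I_k -> 'F_p}) : set (m.-tuple (minus_borel E)) :=
  [set r | forall i, joint_fiber th b (M i) (tnth r i)].

Lemma tuple_rect_measurable (A : 'I_m -> set (minus_borel E)) :
  (forall i, measurable (A i)) -> measurable [set r : m.-tuple (minus_borel E) | forall i, A i (tnth r i)].
Proof.
move=> mA.
have -> : [set r : m.-tuple (minus_borel E) | forall i, A i (tnth r i)] =
    \bigcap_(i in setT) ((fun r : m.-tuple (minus_borel E) => tnth r i) @^-1` A i).
  by apply/seteqP; split=> [r h i _|r h i]; [exact: h|exact: (h i Logic.I)].
apply: fin_bigcap_measurable => [|i _]; first exact: finite_finset.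
have := @measurable_tnth _ (minus_borel E) m i measurableT (A i) (mA i).
by rewrite setTI.
Qed.

Lemma cylinder_measurable M : measurable (cylinder M).
Proof.
apply: (@tuple_rect_measurable (fun i => joint_fiber th b (M i))) => i.
exact: (joint_fiber_measurable oQ sth cb dby.2 bs).
Qed.

Local Notation kappa := (((ncard (@minus_set Q))%:R * (p ^ k)%:R)^-1 : R)%R.

Lemma cylinder_measure M : nu (cylinder M) = (kappa ^+ m)%R%:E.
Proof.
rewrite [LHS](nuP (A := fun i => joint_fiber th b (M i))); last first.
  by move=> i; exact: (joint_fiber_measurable oQ sth cb dby.2 bs).
rewrite (eq_bigr (fun=> (kappa)%:E)); last first.
  by move=> i _; exact: (haar_fiber p_pr pE haar hQ oQ sth cb dby.2 bs).
by rewrite prodEFin prodr_const card_ord.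
Qed.

Definition event_piece (M : {ffun 'I_m -> {ffun 'I_k -> 'F_p}}) :=
  if `[< full_rank M >] then cylinder M else set0.

(** Once the relators lie in [ker th], the event depends only on their coordinates: a character
    vanishing on them is a linear form, with coefficients [f (y j)], vanishing on the rows of
    [M]. *)
Lemma event_pieceE : event_tuples = \bigcup_M event_piece M.
Proof.
apply/seteqP; split=> r.
  move=> [rth sepA].
  exists [ffun i => [ffun j => b j (minus_val (tnth r i))]] => //; rewrite /event_piece.
  case: asboolP => [_ i|[]].
    split; first by apply: rth; exists i.
    by move=> j; rewrite !ffunE.
  move=> c c0 j.
  pose f x := (\sum_j c j * b j x)%R.
  have Xf : event_chars D th tau f.
    exact: (lin_sum (@event_chars0 _ _ _ _ _ D _ th tau) (@event_charsD _ _ _ _ _ D _ th tau) _ dby.1).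
  have f0 : forall x, f x = 0%R.
    apply: sepA => // _ [i _ <-]; rewrite -[RHS](c0 i); apply: eq_bigr => l _.
    by rewrite !ffunE.
  by rewrite -(f0 (y j)) /f (dual_coef _ _ dby).
move=> [M _]; rewrite /event_piece; case: asboolP => // nd cyl.
split; first by move=> _ [i _ <-]; exact: (cyl i).1.
move=> f Xf fr x; rewrite spb// big1// => j _.
rewrite (nd (fun j => f (y j)))%R ?GRing.mul0r// => i.
have := fr (minus_val (tnth r i)); rewrite spb//; have [_ cb'] := cyl i.
under eq_bigr do rewrite cb'.
by apply; exists i.
Qed.

Lemma event_tuples_measurable : measurable event_tuples.
Proof.
rewrite event_pieceE; apply: fin_bigcup_measurable => [|M _]; first exact: finite_finset.
by rewrite /event_piece; case: asboolP => _; [exact: cylinder_measurable|exact: measurable0].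
Qed.

Lemma event_tuples_measure : (k <= m)%N ->
  nu event_tuples = ((\prod_(i < k) (p ^ m - p ^ i))%N%:R * kappa ^+ m)%R%:E.
Proof.
move=> km; rewrite event_pieceE measure_fin_cover; last 2 first.
- by move=> M; rewrite /event_piece; case: asboolP => _; [exact: cylinder_measurable|exact: measurable0].
- move=> M M' _ _ [r []]; rewrite /event_piece; case: asboolP => // _ c.
  case: asboolP => // _ c'; apply/ffunP => i; apply/ffunP => j.
  by have [_ <-] := c i; have [_ <-] := c' i.
rewrite -(card_full_rank p_pr km) -sum1_card natr_sum big_distrl /= -sumEFin.
rewrite [RHS]big_mkcond /=; apply: eq_bigr => M _; rewrite finset.inE /event_piece.
case: asboolP => _; last exact: measure0.
by rewrite GRing.mul1r; exact: cylinder_measure.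
Qed.

End TupleMeasure.

(** * Counting surjections onto [G_D] *)

Section CountSurjections.
Variables (R : realType) (p n : nat) (F : sigmaFreeProP p n).
Hypothesis p_pr : prime p.
Variables (mu : probability (minus_borel F) R) (haar : is_haar mu).
Variables (Q : sigmaGroupType) (pQ : is_pro_p p Q) (oQ : forall A : set Q, open A).
Hypothesis finQ : finite_set [set: Q].
Variables (q : F -> Q) (sq : sigma_surj q).
Hypothesis q_H1 : forall g : F -> 'F_p, H1 g -> forall x, q x = 1 -> g x = 0%R.

Let pF := free_pro_p F.
Let cF : compact [set: F]. Proof. by case: pF. Qed.
Let hQ : hausdorff_space Q. Proof. by case: pQ. Qed.
Local Notation T := (fin_copy finQ).
Local Notation basis := (@free_basis p n F p_pr).

Let basis_H1 i : H1 (basis i). Proof. exact: (@free_basis_dual p n F p_pr).1. Qed.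

Lemma descend_basis_ex i : exists h : Q -> 'F_p, H1 h /\ forall x, h (q x) = basis i x.
Proof. exact: (H1_descend cF pQ sq.1.1 sq.2 (basis_H1 i) (q_H1 (basis_H1 i))). Qed.

Definition qbasis i : Q -> 'F_p := projT1 (cid (descend_basis_ex i)).

Lemma qbasis_H1 i : H1 (qbasis i). Proof. by rewrite /qbasis; case: cid => h []. Qed.

Lemma qbasisE i x : qbasis i (q x) = basis i x. Proof. by rewrite /qbasis; case: cid => h []. Qed.

Definition qfiber (v : 'I_n -> 'F_p) : {set T} :=
  [set a : T | `[< minus_set (a : Q) /\ forall j, qbasis j a = v j >]]%SET.

(** The trivial quotient. Its kernel is all of [F], so [haar_fiber] applies to the elements of H1 of
    [F] themselves. *)
Definition totalN : sigmaNormal F.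
Proof. by apply: (@SigmaNormal F setT); split. Defined.

Lemma totalN1 (a : quot totalN) : a = 1.
Proof. by have [x <-] := coset_surj a; apply/coset1P. Qed.

(* Equidistribution of [Q^- -> 'F_p^n] is read off the Haar measure of [F]. *)
Lemma card_qfiber v : ((#|qfiber v|)%:R * (p ^ n)%:R = (ncard (@minus_set Q))%:R :> R)%R.
Proof.
have pT : is_pro_p p (quot totalN) by apply: quot_pro_p => //; exact: closedT.
have [_ hT _ _] := pT.
have oT : forall A : set (quot totalN), open A by apply: open_quot; exact: openT.
have cb i : is_char (ker_of (@coset _ totalN)) (basis i).
  have hb := basis_H1 i; split; first exact: hb.1.
  - by move=> x y _ _; exact: hb.2.
  - by move=> x g _; exact: H1_J.
  - by move=> x []; exact: totalN1.
have fib := haar_fiber p_pr pF haar hT oT (coset_sigma_surj _) cb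
  (@free_basis_dual p n F p_pr).2 (fun i x => free_H1_sigma p_pr x (basis_H1 i)) v.
have n1 : ncard (@minus_set (quot totalN)) = 1%N.
  rewrite /ncard (_ : @minus_set _ = [set 1]); first by rewrite fset_set1 cardfs1.
  by apply/seteqP; split=> a _; [exact: totalN1|rewrite [a]totalN1 /minus_set /= invg1 (hom1 (@sigmaM _))].
pose B (a : T) := if a \in qfiber v then [set x : minus_borel F | q (minus_val x) = a] else set0.
have mB a : measurable (B a).
  rewrite /B; case: ifP => _; last exact: measurable0.
  apply: (@minus_open_measurable _ [set x | q x = a]).
  have : continuous q := sq.1.1.1.
  by move/continuousP => /(_ [set (a : Q)]); apply; exact: oQ.
have e : joint_fiber (@coset _ totalN) (fun i => basis i) v = \bigcup_a B a.
  apply/seteqP; split=> x.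
    move=> [_ bx]; exists (q (minus_val x)) => //; rewrite /B finset.inE.
    case: asboolP => // -[]; split; last by move=> j; rewrite qbasisE.
    have /set_mem mx := valP x.
    by rewrite /minus_set /= -sq.1.2 -(homV sq.1.1.2); congr q.
  move=> [a _]; rewrite /B finset.inE; case: asboolP => // -[_ ba] /= qx.
  split; first exact: totalN1.
  by move=> j; rewrite -ba -qx qbasisE.
have : (mu (\bigcup_a B a) = ((#|qfiber v|)%:R * (ncard (@minus_set Q))%:R^-1)%R%:E)%E.
  rewrite measure_fin_cover//; last first.
    move=> a a' _ _ [x []]; rewrite /B.
    by case: ifP => // _ ex; case: ifP => // _ ex'; rewrite -[LHS]ex ex'.
  rewrite -sum1_card natr_sum big_distrl /= -sumEFin [RHS]big_mkcond /=.
  apply: eq_bigr => a _; rewrite /B; case: ifPn => [|_]; last exact: measure0.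
  rewrite finset.inE => /asboolP[ma _]; rewrite GRing.mul1r.
  exact: (haar_surj pF haar hQ oQ sq ma).
rewrite -e fib n1 GRing.mul1r => -[e1].
have nQ : ((ncard (@minus_set Q))%:R != 0 :> R)%R.
  apply/eqP => e0; move: e1; rewrite e0 invr0 mulr0 => /eqP.
  rewrite invr_eq0 pnatr_eq0 expn_eq0 => /andP[/eqP p0 _].
  by move: p_pr; rewrite p0.
have np : ((p ^ n)%:R != 0 :> R)%R.
  by rewrite pnatr_eq0 -lt0n expn_gt0 prime_gt0.
move: e1 => /(congr1 (fun z => z * (p ^ n)%:R * (ncard (@minus_set Q))%:R)%R).
by rewrite mulVf// mul1r mulrAC divfK// => ->.
Qed.

Section Count.
Variables (m : nat) (E : sigmaFreeProP p m).
Let pE := free_pro_p E.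
Let cE : compact [set: E]. Proof. by case: pE. Qed.

Definition hom_with_images (t : 'I_m -> Q) (th : E -> Q) :=
  sigma_surj th /\ forall i, th (free_gen E i) = t i.

(** A homomorphism from [E] is given by the images of the generators and is equivariant when these
    are anti-invariant. It is surjective iff no nonzero class in H1 of [Q] dies on them, which is
    full rank in the coordinates [qbasis]. *)
Lemma hom_with_imagesP (t : 'I_m -> Q) : (exists th, hom_with_images t th) <->
  (forall i, minus_set (t i)) /\ full_rank (fun i => [ffun j => qbasis j (t i)]).
Proof.
have lin (c : 'I_n -> 'F_p) : H1 (fun y => \sum_j c j * qbasis j y)%R.
  exact: (lin_sum (@H1_0 p Q) (@H1_D p Q) c qbasis_H1).
split=> [[th [sth et]]|[mt nd]].
  split=> [i|c c0 j].
    by rewrite -et /minus_set /= -sth.1.2 free_sigma (homV sth.1.1.2).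
  have h0 : forall x, (\sum_j c j * qbasis j (th x))%R = 0%R.
    apply: (free_H1_eq0 p_pr (H1_comp sth.1.1 (lin c))) => i /=.
    by rewrite -[RHS](c0 i); apply: eq_bigr => l _; rewrite ffunE et.
  have [x ex] := sth.2 (q (free_gen F j)).
  have := h0 x; rewrite ex.
  under eq_bigr do rewrite qbasisE.
  by rewrite (dual_coef _ _ (@free_basis_dual p n F p_pr)).
have [th [hth et]] := free_sigma_hom E pQ mt.
exists th; split=> //; split=> //.
apply: (surj_of_H1 p_pr cE pQ hth.1) => h hh h0 y.
have hE z : h z = (\sum_j h (q (free_gen F j)) * qbasis j z)%R.
  have [x <-] := sq.2 z.
  rewrite -[LHS]/((h \o q) x) (@free_basis_spans p n F p_pr _ (H1_comp sq.1.1 hh) x) /=.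
  by apply: eq_bigr => j _; rewrite qbasisE.
rewrite hE big1// => j _; rewrite (nd (fun j => h (q (free_gen F j)))) ?GRing.mul0r// => i.
rewrite -[RHS](h0 (free_gen E i)) et hE; apply: eq_bigr => l _.
by rewrite ffunE.
Qed.

Definition generating_tuples : {set {ffun 'I_m -> T}} :=
  [set t : {ffun 'I_m -> T} | `[< exists th, hom_with_images t th >]]%SET.

Lemma generating_tuplesP (t : {ffun 'I_m -> T}) :
  reflect (exists th, hom_with_images t th) (t \in generating_tuples).
Proof. by rewrite /generating_tuples finset.inE; exact: asboolP. Qed.

(** Sort the tuples by their coordinate matrix: by [card_qfiber] each full-rank matrix comes from
    the same number of anti-invariant tuples. *)
Lemma card_generating_tuples : (n <= m)%N ->
  ((#|generating_tuples|)%:R * (p ^ n)%:R ^+ m =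
   (\prod_(i < n) (p ^ m - p ^ i))%N%:R * (ncard (@minus_set Q))%:R ^+ m :> R)%R.
Proof.
move=> nm.
pose Mt (t : {ffun 'I_m -> T}) : {ffun 'I_m -> {ffun 'I_n -> 'F_p}} :=
  [ffun i => [ffun j => qbasis j (t i)]].
have -> : #|generating_tuples| = (\sum_(M : {ffun 'I_m -> {ffun 'I_n -> 'F_p}} | `[< full_rank M >])
    \prod_(i < m) #|qfiber (M i)|)%N.
  rewrite -sum1_card (partition_big Mt (fun M => `[< full_rank M >])) /=; last first.
    move=> t /generating_tuplesP/hom_with_imagesP[_ nd]; apply/asboolP.
    by move: nd; congr full_rank; apply: funext => i; rewrite ffunE.
  apply: eq_bigr => M /asboolP ndM.
  transitivity #|family (fun i => mem (qfiber (M i)))|; last first.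
    by rewrite card_family foldrE big_map big_enum.
  rewrite -sum1_card; apply: eq_bigl => t.
  apply/andP/familyP => [[/generating_tuplesP/hom_with_imagesP[mt _] /eqP <-] i|h].
    rewrite finset.inE; apply/asboolP; split; first exact: mt.
    by move=> j; rewrite !ffunE.
  have hM i j : qbasis j (t i) = M i j.
    by have := h i; rewrite finset.inE => /asboolP[_ ->].
  have eM : Mt t = M by apply/ffunP => i; apply/ffunP => j; rewrite !ffunE hM.
  split; last exact/eqP.
  apply/generating_tuplesP/hom_with_imagesP; split.
    by move=> i; have := h i; rewrite finset.inE => /asboolP[].
  by move: ndM; rewrite -eM; congr full_rank; apply: funext => i; rewrite ffunE.
rewrite -(card_full_rank p_pr nm) -sum1_card !natr_sum !big_distrl /=.
apply: eq_big => [M|M _]; first by rewrite finset.inE.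
rewrite mul1r natr_prod.
have -> : ((p ^ n)%:R ^+ m = \prod_(i < m) (p ^ n)%:R :> R)%R by rewrite prodr_const card_ord.
rewrite -big_split /= (eq_bigr (fun=> (ncard (@minus_set Q))%:R : R)%R).
  by rewrite prodr_const card_ord.
by move=> i _; exact: card_qfiber.
Qed.

End Count.
End CountSurjections.

(** * The limit *)

Lemma card_asbool_set (T : finType) (A : set T) :
  #|[set t | `[< A t >]]%SET| = (#|` fset_set A|)%fset.
Proof.
rewrite cardE; apply: perm_size; apply: uniq_perm; [exact: enum_uniq|exact: fset_uniq|].
move=> t; rewrite mem_enum finset.inE in_fset_set; last exact: finite_finset.
by apply/asboolP/idP => [/mem_set//|/set_mem].
Qed.

Lemma sum_if_in (V : pzRingType) (T : finType) (S : {set T}) (c : V) :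
  (\sum_t (if t \in S then c else 0) = (#|S|)%:R * c)%R.
Proof. by rewrite -big_mkcond sumr_const mulr_natl. Qed.

Section EulerProduct.
Variables (R : realType) (p : nat).
Hypothesis p1 : (1 < p)%N.
Local Open Scope ring_scope.
Local Notation C := (C_ R p).

Let p0 : 0 < p%:R :> R. Proof. by rewrite ltr0n; lia. Qed.

Lemma euler_factor_gt0 i : (0 < i)%N -> 0 < 1 - p%:R ^- i :> R.
Proof.
move=> i0; have h0 : 0 <= p%:R^-1 :> R by rewrite invr_ge0 ltW.
have h1 : p%:R^-1 < 1 :> R by rewrite invf_lt1// ltr1n.
by rewrite subr_gt0 -exprVn exprn_ilt1// -lt0n.
Qed.

Lemma euler_rec k : C k.+1 = C k * (1 - p%:R ^- k.+1).
Proof. by rewrite /C_ big_nat_recr. Qed.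

Lemma euler_gt0 k : 0 < C k.
Proof.
elim: k => [|k IH]; first by rewrite /C_ big_nil.
by rewrite euler_rec mulr_gt0// euler_factor_gt0.
Qed.

Lemma euler_ratio d m : (d <= m)%N ->
  (\prod_(i < d) (p ^ m - p ^ i))%N%:R / (p ^ d)%:R ^+ m = C m / C (m - d).
Proof.
elim: d => [|d IH] dm.
  by rewrite big_ord0 expn0 expr1n subn0 !divff// gt_eqF// euler_gt0.
have -> : C m / C (m - d.+1) = C m / C (m - d) * (1 - p%:R ^- (m - d)).
  have -> : (m - d)%N = (m - d.+1).+1 by lia.
  rewrite euler_rec invfM mulrA divfK//.
  by rewrite gt_eqF// euler_factor_gt0.
rewrite -IH; last by lia.
rewrite big_ord_recr /= natrM expnSr natrM exprMn invfM mulrACA; congr (_ * _).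
rewrite natrB; last by rewrite leq_exp2l//; lia.
have pn0 k : (p%:R ^+ k != 0 :> R) by rewrite expf_neq0// gt_eqF.
rewrite !natrX mulrBl divff//; congr (_ - _).
have -> : (p%:R ^+ m = p%:R ^+ d * p%:R ^+ (m - d) :> R).
  by rewrite -exprD subnKC//; lia.
by rewrite invfM mulrA divff// mul1r.
Qed.

Lemma euler_cvg : C k @[k --> \oo] --> C_infty R p.
Proof.
apply: nonincreasing_is_cvgn.
  apply/nonincreasing_seqP => k; rewrite euler_rec; apply: ler_piMr; first exact: ltW (euler_gt0 k).
  by rewrite gerBl invr_ge0 exprn_ge0// ltW.
by exists 0 => _ [k _ <-]; rewrite ltW// euler_gt0.
Qed.

Lemma euler_ratio_cvg d : C m / C (m - d) @[m --> \oo] --> (1 : R).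
Proof.
elim: d => [|d IH].
  under eq_fun => m do rewrite subn0 divff ?gt_eqF ?euler_gt0//.
  exact: cvg_cst.
(* After the shift the truncated subtractions are exact, and the ratio acquires one further factor,
   which tends to 1. *)
rewrite -(cvg_shiftn d.+1) /=.
have -> : (fun m => C (m + d.+1) / C (m + d.+1 - d.+1)) =
    (fun m => C (m + d.+1) / C (m + d.+1 - d) * (1 - p%:R ^- m.+1)).
  apply: funext => m; have -> : (m + d.+1 - d)%N = m.+1 by lia.
  rewrite addnK euler_rec invfM mulrA divfK//.
  by rewrite gt_eqF// euler_factor_gt0.
have h1 : C (m + d.+1) / C (m + d.+1 - d) @[m --> \oo] --> (1 : R).
  by move: IH; rewrite -(cvg_shiftn d.+1).
have h0 : (p%:R^-1) ^+ m.+1 @[m --> \oo] --> (0 : R).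
  have : (fun m => (p%:R^-1) ^+ m : R) @ \oo --> (0 : R).
    apply: cvg_expr; rewrite ger0_norm; first by rewrite invf_lt1// ltr1n.
    by rewrite invr_ge0 ltW.
  by rewrite -(cvg_shiftn 1) /=; under eq_fun do rewrite addn1.
have h2 : 1 - p%:R ^- m.+1 @[m --> \oo] --> (1 - 0 : R).
  under eq_fun => m do rewrite -exprVn.
  by apply: cvgB => //; exact: cvg_cst.
by have := cvgM h1 h2; rewrite subr0 mulr1; apply.
Qed.

End EulerProduct.

(** * The measure at level [m] and its limit *)

Section Assembly.
Variables (R : realType) (p : nat).
Hypotheses (p_pr : prime p) (p_gt2 : (2 < p)%N).
Variable F_ : forall n, sigmaFreeProP p n.
Variable haar : forall n, probability (minus_borel (F_ n)) R.
Hypothesis haarP : forall n, is_haar (haar n).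
Variable mutilde : forall n, probability (n.-tuple (minus_borel (F_ n))) R.
Hypothesis mutildeP : forall n, is_product (haar n) (mutilde n).
Variables (n : nat) (D : sigmaNormal (F_ n)).
Hypotheses (D_frattini : nset D `<=` @frattini (F_ n))
  (D_aut : forall f : F_ n -> F_ n, is_sigma_iso f -> f @` nset D = nset D)
  (D_open : open (nset D)).
Variables (G : sigmaGroupType) (G_schur : weak_schur F_ G) (G_dim : H1_dim p G n).
Variable prj : sigmaSurj (F_ n) G.

Local Notation Q := (G_D D prj).
Let pG := G_schur.1.
Let pQ : is_pro_p p Q. Proof. exact: quot_img_pro_p. Qed.
Let finQ : finite_set [set: Q]. Proof. exact: q_D_finite. Qed.
Let oQ : forall A : set Q, open A. Proof. exact: q_D_open. Qed.
Let sq := q_D_surj D prj.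
Let q_H1 (g : F_ n -> 'F_p) := @q_D_H1 p n F_ p_pr D D_frattini G G_dim prj g.
Let qD d := @q_D_ker_D p n F_ D G prj d.
Let clD : closed (nset D) := open_subgroup_closed (nset_normal D).1 D_open.

Local Notation T := (fin_copy finQ).

Section Level.
Variable m : nat.
Hypothesis nm : (n <= m)%N.
Local Notation E := (F_ m).

Definition level_set : set (m.-tuple (minus_borel E)) :=
  [set r | U_D D prj (sch_of_relators r)].

(** Surjections are indexed by the images [t] of the free generators, which range over a finite
    type; tuples that come from no surjection contribute the empty set. *)
Definition level_piece (t : {ffun 'I_m -> T}) : set (m.-tuple (minus_borel E)) :=
  [set r | exists th : E -> Q, hom_with_images (t : 'I_m -> Q) th /\ relators_present D (relN r) th].

Lemma hom_with_images_unique (t : 'I_m -> Q) (th th' : E -> Q) :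
  hom_with_images t th -> hom_with_images t th' -> th = th'.
Proof.
move=> [sth et] [sth' et']; apply: (free_hom_eq pQ sth.1.1 sth'.1.1) => i.
by rewrite et et'.
Qed.

Local Notation d := (m_D D prj + (m - n))%N.
Local Notation kappa := (((ncard (@minus_set Q))%:R * (p ^ d)%:R)^-1 : R)%R.

Lemma m_D_le : (m_D D prj <= n)%N.
Proof.
have [k [r iG]] := G_schur.2.
by have [g [u []]] := base_chars_dual p_pr p_gt2 D_frattini D_aut D_open pG G_dim prj iG.
Qed.

(** A generating [t] determines [th], so the piece is the event of a single surjection. The
    presentation of [G] supplies the base characters and the sign of [sigma] on them, independently
    of [th]. *)
Lemma level_piece_measure t : measurable (level_piece t) /\
  mutilde m (level_piece t) = (if t \in generating_tuples finQ E then
    ((\prod_(i < d) (p ^ m - p ^ i))%N%:R * kappa ^+ m)%R%:E else 0%E).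
Proof.
case: generating_tuplesP => [[th it]|nt]; last first.
  have -> : level_piece t = set0.
    by apply/seteqP; split=> // r [th [it _]]; apply: nt; exists th.
  by rewrite measure0; split=> //; exact: measurable0.
have sth := it.1.
have [tau [lam [htau hlam lamtau thtau qlam]]] := split_exists p_pr p_gt2 pQ sq q_H1 sth.
have [k [r0 iG]] := G_schur.2.
have [g [u [_ dgu spg gs]]] := base_chars_dual p_pr p_gt2 D_frattini D_aut D_open pG G_dim prj iG.
have [b [y [_ dby spb bs]]] := event_chars_dual p_pr oQ sq qD sth
  htau hlam lamtau thtau qlam dgu spg.
have -> : level_piece t = event_tuples D th tau.
  apply/seteqP; split=> r.
    move=> [th' [it']]; rewrite (hom_with_images_unique it' it).
    exact: (presents_generates p_pr p_gt2 D_frattini D_aut oQ sq qD (S := relN r) (rel := relators r) erefl sth htau thtau).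
  move=> hA; exists th; split=> //.
  exact: (generates_presents p_pr pQ oQ sq qD q_H1 (S := relN r) (rel := relators r) erefl sth htau thtau clD hA).
split; first exact: (event_tuples_measurable oQ sth dby spb (bs gs)).
have dm : (d <= m)%N by have := m_D_le; lia.
exact: (event_tuples_measure p_pr (@haarP m) (@mutildeP m) pQ oQ sth dby spb (bs gs) dm).
Qed.

Lemma level_multiplicity r : #|[set t | `[< level_piece t r >]]%SET| =
  if `[< level_set r >] then ncard (@sigma_auts Q) else 0%N.
Proof.
have UP := U_D_relators D_open pG prj r.
case: asboolP => [/UP[th1 gth1]|nU]; last first.
  apply: eq_card0 => t; rewrite finset.inE; apply/asboolP => -[th [[sth _] B]].
  by apply/nU/UP; exists th.
have cg := good_surj_card p_pr p_gt2 D_aut D_open pG gth1.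
pose ev (th : E -> Q) : {ffun 'I_m -> T} := [ffun i => th (free_gen E i)].
have evE : [set t | level_piece t r] = ev @` good_surj r.
  apply/seteqP; split=> [t [th [[sth et] B]]|_ [th [sth B] <-]].
    by exists th => //; apply/ffunP => i; rewrite ffunE et.
  by exists th; split=> //; split=> // i; rewrite ffunE.
have cev : ([set t | level_piece t r] #= @sigma_auts Q)%card.
  apply: card_eq_trans cg; rewrite evE; apply: inj_card_eq => th th'.
  move=> /set_mem[sth _] /set_mem[sth' _] /ffunP e.
  apply: (free_hom_eq pQ sth.1.1 sth'.1.1) => i.
  by have := e i; rewrite !ffunE.
have fin1 : finite_set [set t | level_piece t r] by exact: finite_finset.
have fin2 : finite_set (@sigma_auts Q) by rewrite -(eq_finite_set cev).
by rewrite (card_asbool_set [set t | level_piece t r]); apply/(fcard_eq fin1 fin2).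
Qed.

Lemma level_set_measurable : measurable level_set.
Proof.
have -> : level_set = \bigcup_t level_piece t.
  apply/seteqP; split=> r.
    move=> /(U_D_relators D_open pG prj r)[th [sth B]].
    exists [ffun i => th (free_gen E i)] => //; exists th; split=> //; split=> // i.
    by rewrite ffunE.
  move=> [t _ [th [[sth _] B]]].
  by apply/(U_D_relators D_open pG prj r); exists th.
apply: fin_bigcup_measurable => [|t _]; first exact: finite_finset.
exact: (level_piece_measure t).1.
Qed.

Lemma ncard_gt0 (X : choiceType) (A : set X) x : finite_set A -> A x -> (0 < ncard A)%N.
Proof.
move=> fA Ax; rewrite /ncard cardfs_gt0; apply/fset0Pn; exists x.
by rewrite in_fset_set// mem_set.
Qed.

Lemma finite_auts : finite_set (@sigma_auts Q).
Proof.
pose g (f : Q -> Q) : {ffun T -> T} := [ffun a : T => f a : T].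
have : finite_set (g @` @sigma_auts Q) by exact: finite_finset.
rewrite (eq_finite_set (B := @sigma_auts Q))//; apply: inj_card_eq => f f' _ _ /ffunP e.
by apply: funext => a; have := e a; rewrite !ffunE.
Qed.

Lemma level_set_measure : mutilde m level_set =
  ((C_ R p m / C_ R p (m - n)) * (C_ R p m / C_ R p (n - m_D D prj))
    / (ncard (@sigma_auts Q))%:R)%R%:E.
Proof.
have h := measure_multiplicity (mutilde m) (fun t => (level_piece_measure t).1)
  level_set_measurable level_multiplicity.
have fU := fin_num_measure (mutilde m) _ level_set_measurable.
have A0 : ((ncard (@sigma_auts Q))%:R != 0 :> R)%R.
  rewrite pnatr_eq0 -lt0n; apply: (@ncard_gt0 _ (@sigma_auts Q) (@id Q)); first exact: finite_auts.
  have hid : is_sigma_hom (@id Q) by split=> //; split=> // x; exact: cvg_id.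
  by split=> //; exists id; split.
have Q0 : ((ncard (@minus_set Q))%:R != 0 :> R)%R.
  rewrite pnatr_eq0 -lt0n; apply: (@ncard_gt0 _ _ 1); first exact: sub_finite_set finQ.
  by rewrite /minus_set /= invg1 (hom1 (@sigmaM Q)).
have p1 : (1 < p)%N := prime_gt1 p_pr.
have pn0 k : ((p ^ k)%:R ^+ m != 0 :> R)%R.
  by rewrite expf_neq0// pnatr_eq0 -lt0n expn_gt0; lia.
have mn := m_D_le.
have dm : (d <= m)%N by lia.
have {}h : (\sum_t mutilde m (level_piece t))%E =
    ((ncard (@sigma_auts Q))%:R%:E * (fine (mutilde m level_set))%:E)%E.
  by rewrite (fineK fU); exact: h.
rewrite -(fineK fU); move: h; rewrite -EFinM.
have -> : (\sum_t mutilde m (level_piece t))%E = ((#|generating_tuples finQ E|)%:R *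
    ((\prod_(i < d) (p ^ m - p ^ i))%N%:R * kappa ^+ m))%R%:E.
  rewrite -(sum_if_in (generating_tuples finQ E)) -sumEFin; apply: eq_bigr => t _.
  by rewrite (level_piece_measure t).2; case: ifP.
move=> [e]; congr EFin.
apply: (mulfI A0); rewrite -e mulrC [RHS]mulrC divfK//.
have := card_generating_tuples p_pr (haarP (n := n)) pQ oQ finQ sq q_H1 E nm.
(* As [d] is [m_D + (m - n)], the difference [m - d] equals [n - m_D], and [euler_ratio] produces
   both quotients. *)
rewrite -(euler_ratio R p1 nm) -[(n - _)%N](_ : (m - d)%N = _); last by lia.
rewrite -(euler_ratio R p1 dm) invfM exprMn !exprVn => e1.
have -> : (\prod_(i < n) (p ^ m - p ^ i))%N%:R =
    ((#|generating_tuples finQ E|)%:R * (p ^ n)%:R ^+ m / (ncard (@minus_set Q))%:R ^+ m)%R :> R.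
  by rewrite e1 mulfK// expf_neq0.
by field; rewrite !pn0 expf_neq0.
Qed.

End Level.

Lemma mu_infty_level : mu_infty mutilde (U_D D prj) =
  (C_infty R p / C_ R p (n - m_D D prj) * (1 / (ncard (@sigma_auts Q))%:R))%:E.
Proof.
have p1 : (1 < p)%N := prime_gt1 p_pr.
(* The formula at level [m] requires [n <= m], hence the shift by [n]. *)
apply/cvg_lim => //; rewrite -(cvg_shiftn n) /=.
pose c := ((C_ R p (n - m_D D prj))^-1 / (ncard (@sigma_auts Q))%:R)%R.
have -> : (fun m => mu_ mutilde (m + n) (U_D D prj)) =
    (fun m => ((C_ R p (m + n) / C_ R p (m + n - n)) * (C_ R p (m + n) * c))%R%:E).
  apply: funext => m; rewrite [LHS](level_set_measure (leq_addl m n)); congr EFin.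
  by rewrite /c !mulrA.
apply: cvg_EFin; first by apply: nearW.
have -> : (C_infty R p / C_ R p (n - m_D D prj) * (1 / (ncard (@sigma_auts Q))%:R))%R =
  (1 * (C_infty R p * c))%R by rewrite /c div1r mul1r !mulrA.
apply: cvgM; first by have := @euler_ratio_cvg R p p1 n; rewrite -(cvg_shiftn n).
apply: cvgM; last exact: cvg_cst.
by have := @euler_cvg R p p1; rewrite -(cvg_shiftn n).
Qed.

Lemma U_D_measurable : measurable (U_D D prj).
Proof. by apply: sub_gen_smallest; exact: U_D_sch_open. Qed.

End Assembly.

Local Open Scope ring_scope.

Theorem proposition10p2 (R : realType) (p : nat)
    (p_prime : prime p) (p_gt2 : (2 < p)%N)
    (F : forall n, sigmaFreeProP p n)
    (haar : forall n, probability (minus_borel (F n)) R)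
    (haarP : forall n, is_haar (haar n))
    (mutilde : forall n, probability (n.-tuple (minus_borel (F n))) R)
    (mutildeP : forall n, is_product (haar n) (mutilde n))
    (n : nat) (D : sigmaNormal (F n))
    (D_frattini : nset D `<=` @frattini (F n))
    (D_aut : forall f : F n -> F n, is_sigma_iso f -> f @` nset D = nset D)
    (G : sigmaGroupType) (G_schur : weak_schur F G) (G_dim : H1_dim p G n)
    (prj : sigmaSurj (F n) G) (D_open : open (nset D)) :
  measurable (U_D D prj) /\
  mu_infty mutilde (U_D D prj) =
    (C_infty R p / C_ R p (n - m_D D prj)
       * (1 / (ncard (@sigma_auts (G_D D prj)))%:R))%:E.
Proof.
split; first exact: U_D_measurable.
exact: mu_infty_level.
Qed.
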